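(* Let $\Gamma$ be a Fuchsian group and $t_0\in\mathbb T$ with $\sum_{\gamma\in\Gamma}|\gamma'(t_0)|<\infty$. If $m'_{t_0}$ is of bounded characteristic, then $$ m'_{t_0}=\frac{\Delta_{t_0}}{\varphi}, $$ where $\Delta_{t_0}$ is an inner function and $\varphi$ is an outer function with $|\varphi|\le 4$.
   Context: $\mathbb D$ is the open unit disk and $\mathbb T$ the unit circle. A Fuchsian group $\Gamma$ is a discrete subgroup of the group of conformal automorphisms $\zeta\mapsto\frac{a\zeta+b}{\overline b\zeta+\overline a}$, $|a|^2-|b|^2=1$, of $\mathbb D$. For $t_0\in\mathbb T$ with $\sum_{\gamma\in\Gamma}|\gamma'(t_0)|<\infty$ the Martin function of $t_0$ is $$m_{t_0}(\zeta)=\frac i2\sum_{\gamma\in\Gamma}\frac{\gamma(t_0)+\zeta}{\gamma(t_0)-\zeta}|\gamma'(t_0)|,\qquad \zeta\in\mathbb D,$$ so that $$m'_{t_0}(\zeta)=i\sum_{\gamma\in\Gamma}\frac{\gamma(t_0)|\gamma'(t_0)|}{(\gamma(t_0)-\zeta)^2}=i t_0\sum_{\gamma\in\Gamma}\frac{\gamma'(t_0)}{(\gamma(t_0)-\zeta)^2}.$$ A function on $\mathbb D$ is of bounded characteristic if it is a quotient of two bounded analytic functions on $\mathbb D$. *)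

(* Defs.v *)
From HB Require Import structures.
From mathcomp Require Import all_boot all_order all_algebra.
From mathcomp Require Import complex.
From mathcomp Require Import all_classical all_reals all_analysis.
From mathcomp.analysis.showcase Require summability.

Set Implicit Arguments.
Unset Strict Implicit.
Unset Printing Implicit Defensive.

Import Order.TTheory GRing.Theory Num.Theory.
Import numFieldNormedType.Exports.

Local Open Scope classical_set_scope.
Local Open Scope complex_scope.
Local Open Scope ring_scope.

(* Derivatives are taken in R[i] regarded as a normed module over
   itself, so [derivable _ z 1] is complex differentiability and [derive1] is
   the complex derivative. *)

Definition disk (R : realType) : set R[i] := [set z | `|z| < 1].

Definition cexp (R : realType) (z : R[i]) : R[i] :=
  (expR (complex.Re z))%:C * (cos (complex.Im z) +i* sin (complex.Im z)).

Definition cis (R : realType) (theta : R) : R[i] := cos theta +i* sin theta.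

Definition analytic_disk (R : realType) (f : R[i] -> R[i]) : Prop :=
  forall z, disk z -> derivable (f : R[i]^o -> R[i]^o) z 1.

Definition bounded_analytic (R : realType) (f : R[i] -> R[i]) : Prop :=
  analytic_disk f /\ exists M : R, forall z, disk z -> `|f z| <= M%:C.

(* The quotient is one of meromorphic functions, hence the equality away from
   the zeros of the denominator, which is not identically zero. *)
Definition bounded_characteristic (R : realType) (F : R[i] -> R[i]) : Prop :=
  exists f g, [/\ bounded_analytic f, bounded_analytic g,
    exists2 z, disk z & g z != 0 &
    forall z, disk z -> g z != 0 -> F z = f z / g z].

(* The radial limits of f are unimodular at almost every point of the unit
   circle. *)
Definition inner (R : realType) (f : R[i] -> R[i]) : Prop :=
  bounded_analytic f /\
  {ae @lebesgue_measure R, forall theta : R, exists2 w : R[i]^o, `|w| = 1 &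
     (f (r%:C * cis theta) : R[i]^o) @[r --> (1 : R)^'-] --> w}.

Definition cintegral (R : realType) (D : set R) (f : R -> R[i]) : R[i] :=
  Rintegral (@lebesgue_measure R) D (fun x => complex.Re (f x)) +i*
  Rintegral (@lebesgue_measure R) D (fun x => complex.Im (f x)).

(* phi(z) = c exp (1/(2 pi) \int_0^(2 pi)
                     (e^(i theta) + z)/(e^(i theta) - z) log k(theta) dtheta)
   on the disk, with |c| = 1, k > 0 and log k in L^1. *)
Definition outer (R : realType) (phi : R[i] -> R[i]) : Prop :=
  exists (c : R[i]) (k : R -> R),
    [/\ `|c| = 1, forall theta, 0 < k theta,
      (@lebesgue_measure R).-integrable `[0, 2 * pi]
        (fun theta => (ln (k theta))%:E) &
      forall z, disk z -> phi z = c * cexp (((2 * pi)^-1)%:C *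
        cintegral `[0, 2 * pi] (fun theta =>
          (cis theta + z) / (cis theta - z) * (ln (k theta))%:C))].

(* For |a|^2 - |b|^2 = 1 the pole lies outside the closed unit disk. *)
Definition moebius (R : realType) (a b : R[i]) : R[i] -> R[i] :=
  fun z => (a * z + b) / (b^* * z + a^*).

(* An automorphism of the disk is represented by its total extension
   [moebius a b]; (a, b) and (-a, -b) give the same function, so each
   transformation occurs exactly once in such a set G.  The value at the pole
   is a convention of the library, hence the group operations are expressed
   on the disk, where they determine the transformation. *)
Record fuchsian (R : realType) (G : set (R[i] -> R[i])) : Prop := Fuchsian {
  fuchsian_aut : forall g, G g ->
    exists a b, `|a| ^+ 2 - `|b| ^+ 2 = 1 /\ g = moebius a b;
  fuchsian_id : exists2 g, G g & forall z, disk z -> g z = z;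
  fuchsian_comp : forall g h, G g -> G h ->
    exists2 k, G k & forall z, disk z -> k z = g (h z);
  fuchsian_inv : forall g, G g ->
    exists2 k, G k & forall z, disk z -> k (g z) = z;
  (* The preimage of G under the two-sheeted covering (a, b) |-> moebius a b
     is a discrete subset of {|a|^2 - |b|^2 = 1}. *)
  fuchsian_discrete :
    let L := [set p : R[i]^o * R[i]^o |
      `|p.1 : R[i]| ^+ 2 - `|p.2 : R[i]| ^+ 2 = 1 /\ G (moebius p.1 p.2)] in
    L `<=` isolated L }.

Definition cderiv (R : realType) (f : R[i] -> R[i]) : R[i] -> R[i] :=
  derive1 (f : R[i]^o -> R[i]^o).

(* The sum over G is the unconditional one, i.e. the limit of the finite
   partial sums directed by inclusion. *)
Definition martin (R : realType) (G : set (R[i] -> R[i])) (t0 : R[i]) :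
    R[i] -> R[i] := fun z =>
  'i / 2 * @summability.sum _ R[i] R[i]^o (fun g : R[i] -> R[i] =>
    if g \in G then (g t0 + z) / (g t0 - z) * `|cderiv g t0| else 0).

(* Main.v *)
Require Import Defs.
From HB Require Import structures.
From mathcomp Require Import all_boot all_order all_algebra.
From mathcomp Require Import complex.
From mathcomp Require Import all_classical all_reals all_analysis.
From mathcomp Require Import ring lra measurable_realfun.
From mathcomp Require finmap.
From mathcomp.analysis.showcase Require summability.

(**
Write t_k = gamma(t_0) and c_k = |gamma'(t_0)|, so that m' = i sum c_k t_k / (t_k - z)^2, and put
W(zeta) = sum c_k / |t_k - zeta|^2 on the circle.  The identity of the group gives W >= 1/4, and
t_k / (t_k - zeta)^2 = - zeta^-1 / |t_k - zeta|^2 shows that |m'| has the radial limit W wherever W is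
finite.  Since m' has bounded characteristic it has finite radial limits almost everywhere; as Im m
is the Poisson integral of a discrete measure, it tends to 0 almost everywhere, so Im m = O(1 - r)
along almost every radius, whence W < oo almost everywhere.  Moreover log W is integrable, being the
difference of the logarithms of the boundary moduli of the numerator and denominator of m'.

Let phi be the outer function with |phi| = 1/W on the circle; 1/W <= 4 gives |phi| <= 4.  Because
|m'(r zeta)| <= 8 W(zeta), the subharmonicity of log |m'| passes to the limit r -> 1 and
log |m'| is at most the Poisson integral of log W, i.e. Delta = m' phi is bounded by 1.  Its boundary
modulus is W |phi*| <= 1, and the Jensen inequality for phi at 0 forces log |phi*| = - log W almost
everywhere, so that Delta is inner.
*)

Set Implicit Arguments.
Unset Strict Implicit.
Unset Printing Implicit Defensive.

Import Order.TTheory GRing.Theory Num.Theory.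
Import numFieldNormedType.Exports.
Local Open Scope classical_set_scope.
Local Open Scope complex_scope.
Local Open Scope ring_scope.

(** * Interval integrals and the Goursat theorem *)

Section IntervalIntegral.
Context {R : realType}.
Implicit Types (f g : R -> R) (a b c : R).
Local Notation mu := (@lebesgue_measure R).

(** Bounded characteristic and integrability of log W do not suffice by themselves: exp((1 + z)/(1 -
    z)) is a quotient of bounded functions with modulus 1 almost everywhere on the circle, yet it is
    not an inner function over a bounded outer one, since its denominator carries a singular inner
    factor. The radial majorant 8 W excludes such a factor. That W is at once the radial limit of
    |m'| and, up to a constant, its majorant is due to the terms of m' having the same argument at a
    boundary point: nothing cancels.

    Only bounded analytic functions are given radial limits here. The boundary values of the Poisson
    integral of a singular measure (for Im m) and of an integrable function (for log |phi|) are
    obtained by one device: exponentiate to get a bounded function, bound its boundary logarithm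
    pointwise on one side, and compare with the Jensen inequality at 0, which bounds its integral on
    the other side; both must then be equalities. *)

Definition cont_on a b f := {within `[a, b], continuous f}.

(** Unoriented: the interval is empty for [b < a] and the value is then 0, whence the order
    hypotheses below. *)
Definition int a b f := Rintegral mu `[a, b] f.

Lemma cont_onP a b f :
  (forall x, a <= x <= b -> forall e, 0 < e -> exists2 d, 0 < d &
    forall y, a <= y <= b -> `|y - x| < d -> `|f y - f x| <= e) ->
  cont_on a b f.
Proof.
move=> H; apply/subspace_continuousP => x; rewrite /= in_itv /= => xab.
apply/cvgrPdist_le => /= e e0.
have [d d0 hd] := H x xab e e0.
rewrite near_withinE; apply/nbhs_ballP; exists d => //= y; rewrite /ball /= => xy.
by rewrite in_itv /= => yab; rewrite distrC; apply: hd => //; rewrite distrC.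
Qed.

Lemma cont_on_cont a b f : continuous f -> cont_on a b f.
Proof. by move=> cf; apply: continuous_subspaceT => x; exact: cf. Qed.

Lemma cont_on_eps a b f : cont_on a b f ->
  forall x, a <= x <= b -> forall e, 0 < e -> exists2 d, 0 < d &
    forall y, a <= y <= b -> `|y - x| < d -> `|f y - f x| <= e.
Proof.
move=> /subspace_continuousP cf x xab e e0.
have /cvgrPdist_le/(_ e e0) := cf x ltac:(by rewrite /= in_itv).
rewrite near_withinE => /nbhs_ballP[d /= d0 hd].
exists d => // y yab yx; rewrite distrC; apply: hd; last by rewrite /= in_itv.
by rewrite /ball /= distrC.
Qed.

Lemma cont_on_sub a b c d f : a <= c -> d <= b -> cont_on a b f -> cont_on c d f.
Proof.
move=> ac db; apply: continuous_subspaceW => x /=; rewrite !in_itv /= => /andP[cx xd].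
by rewrite (le_trans ac cx) (le_trans xd db).
Qed.

Lemma cont_on_int a b f : cont_on a b f -> mu.-integrable `[a, b] (EFin \o f).
Proof. by move=> cf; apply: continuous_compact_integrable => //; exact: segment_compact. Qed.

Lemma cont_onD a b f g : cont_on a b f -> cont_on a b g -> cont_on a b (fun x => f x + g x).
Proof. by move=> cf cg x; apply: (@cvgD _ _ _ _ _ _ _ _ _ (cf x) (cg x)). Qed.

Lemma cont_onM a b f g : cont_on a b f -> cont_on a b g -> cont_on a b (fun x => f x * g x).
Proof. by move=> cf cg x; apply: (@cvgM _ _ _ _ _ _ _ _ (cf x) (cg x)). Qed.

Lemma cont_onN a b f : cont_on a b f -> cont_on a b (fun x => - f x).
Proof. by move=> cf x; apply: (@cvgN _ _ _ _ _ _ _ (cf x)). Qed.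

Lemma cont_on_cst a b k : cont_on a b (fun=> k).
Proof. by apply: cont_on_cont => x; exact: cvg_cst. Qed.

Lemma intD a b f g : cont_on a b f -> cont_on a b g ->
  int a b (fun x => f x + g x) = int a b f + int a b g.
Proof. by move=> cf cg; rewrite /int RintegralD //; exact: cont_on_int. Qed.

Lemma intZ a b k f : cont_on a b f -> int a b (fun x => k * f x) = k * int a b f.
Proof. by move=> cf; rewrite /int RintegralZl //; exact: cont_on_int. Qed.

Lemma intN a b f : cont_on a b f -> int a b (fun x => - f x) = - int a b f.
Proof.
move=> cf; rewrite -[RHS]mulN1r -intZ //.
by apply: eq_Rintegral => x _; rewrite mulN1r.
Qed.

Lemma intB a b f g : cont_on a b f -> cont_on a b g ->
  int a b (fun x => f x - g x) = int a b f - int a b g.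
Proof. by move=> cf cg; rewrite intD ?intN //; exact: cont_onN. Qed.

Lemma eq_int a b f g : (forall x, a <= x <= b -> f x = g x) -> int a b f = int a b g.
Proof. by move=> fg; apply: eq_Rintegral => x; rewrite inE /= in_itv /= => /fg. Qed.

Lemma int_cst a b k : a <= b -> int a b (fun=> k) = k * (b - a).
Proof.
move=> ab; rewrite /int Rintegral_cst //= lebesgue_measure_itv /= lte_fin.
move: ab; rewrite le_eqVlt => /predU1P[->|ab]; first by rewrite ltxx subrr.
by rewrite ab.
Qed.

Lemma le_int a b f g : cont_on a b f -> cont_on a b g ->
  (forall x, a <= x <= b -> f x <= g x) -> int a b f <= int a b g.
Proof.
move=> cf cg fg; apply: le_Rintegral (cont_on_int cf) (cont_on_int cg) _ => //.
Qed.

Lemma int_abs_le a b f C : a <= b -> cont_on a b f ->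
  (forall x, a <= x <= b -> `|f x| <= C) -> `|int a b f| <= C * (b - a).
Proof.
move=> ab cf fC; rewrite ler_norml; apply/andP; split.
  rewrite -mulNr -int_cst //; apply: le_int => //; first exact: cont_on_cst.
  by move=> x /fC; rewrite ler_norml => /andP[].
rewrite -int_cst //; apply: le_int => //; first exact: cont_on_cst.
by move=> x /fC; rewrite ler_norml => /andP[].
Qed.

Lemma int_chasles a b c f : a <= b -> b <= c -> cont_on a c f ->
  int a c f = int a b f + int b c f.
Proof.
move=> ab bc cf; apply/eqP; rewrite addrC -subr_eq; apply/eqP.
rewrite /int Rintegral_itvB ?bnd_simp //; last exact: cont_on_int.
rewrite Rintegral_itv_obnd_cbnd //; apply: integrableS (cont_on_int cf) => //.
by apply: subset_itvr; rewrite bnd_simp.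
Qed.

Lemma intxx a f : int a a f = 0.
Proof. by rewrite /int set_itv1 Rintegral_set1. Qed.

Lemma int_id a b : a <= b -> int a b id = (b ^+ 2 - a ^+ 2) / 2.
Proof.
rewrite le_eqVlt => /predU1P[->|ab]; first by rewrite intxx subrr mul0r.
pose F (x : R) := x ^+ 2 / 2.
have dF x : is_derive x (1 : R) F x.
  by rewrite /F; apply: is_derive_eq; rewrite /GRing.scale /= ?mulr1 ?mul0r ?addr0; lra.
rewrite /int /Rintegral (@continuous_FTC2 R id F) //=.
- by rewrite /F mulrBl.
- by apply: continuous_subspaceT => x; exact: cvg_id.
- have cF : continuous F.
    by move=> x; apply/differentiable_continuous/derivable1_diffP; case: (dF x).
  by split => [x _||]; [by case: (dF x)|apply: cvg_at_right_filter; exact: cF|apply: cvg_at_left_filter; exact: cF].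
- by move=> x _; rewrite derive1E; case: (dF x).
Qed.

Lemma int_affine a b k l : a <= b ->
  int a b (fun x => k + l * x) = k * (b - a) + l * ((b ^+ 2 - a ^+ 2) / 2).
Proof.
move=> ab; have ci : cont_on a b id by apply: cont_on_cont => x; exact: cvg_id.
rewrite intD; [|exact: cont_on_cst|by apply: cont_onM => //; exact: cont_on_cst].
by rewrite int_cst // intZ // int_id.
Qed.

Lemma intE a b f : int a b f = \int[mu]_(t in `[a, b]) f t. Proof. by []. Qed.

End IntervalIntegral.
Global Opaque int.

Lemma dist_in_itv (R : realType) (s u w x x' : R) :
  s <= x <= s + u -> s <= x' <= s + u -> u <= w -> `|x' - x| <= w.
Proof. by move=> /andP[h1 h2] /andP[h3 h4] uw; rewrite ler_norml; apply/andP; split; lra. Qed.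

Section Goursat.
Context {R : realType}.
Implicit Types (p q : R -> R -> R).

(** The counterclockwise integral of p dx + q dy along the boundary of the rectangle. *)
Definition rect_int p q (a b c d : R) : R :=
  int a b (p ^~ c) - int a b (p ^~ d) + (int c d (q b) - int c d (q a)).

(* The form [p dx + q dy] is closed at (x, y): [l] is both dp/dy and dq/dx. *)
Definition closed_at p q (D : R -> R -> Prop) x y :=
  exists k l m : R, forall e, 0 < e -> exists2 r, 0 < r &
    forall x' y', D x' y' -> `|x' - x| < r -> `|y' - y| < r ->
      `|p x' y' - (p x y + k * (x' - x) + l * (y' - y))| <= e * (`|x' - x| + `|y' - y|) /\
      `|q x' y' - (q x y + l * (x' - x) + m * (y' - y))| <= e * (`|x' - x| + `|y' - y|).

Definition in_rect (a b c d x y : R) := a <= x <= b /\ c <= y <= d.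

Lemma in_rect_sub a b c d a' b' c' d' x y : a <= a' -> b' <= b -> c <= c' -> d' <= d ->
  in_rect a' b' c' d' x y -> in_rect a b c d x y.
Proof. by rewrite /in_rect => h1 h2 h3 h4 [/andP[h5 h6] /andP[h7 h8]]; split; apply/andP; split; lra. Qed.

Lemma closed_at_contl p q a b c d y : c <= y <= d ->
  (forall x, a <= x <= b -> closed_at p q (in_rect a b c d) x y) -> cont_on a b (p ^~ y).
Proof.
move=> ycd H; apply: cont_onP => x xab e e0.
have [k [l [m klm]]] := H x xab.
have [r r0 hr] := klm 1 ltr01.
have K0 : 0 < `|k| + 1 by rewrite ltr_wpDl.
exists (Num.min r (e / (`|k| + 1))); first by rewrite lt_min r0 divr_gt0.
move=> x' x'ab; rewrite lt_min => /andP[x'r x'e].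
have [|h _] := hr x' y (conj x'ab ycd) x'r; first by rewrite subrr normr0.
rewrite subrr normr0 mulr0 !addr0 mul1r in h.
have -> : p x' y - p x y = (p x' y - (p x y + k * (x' - x))) + k * (x' - x) by ring.
rewrite (le_trans (ler_normD _ _))// normrM.
rewrite (@le_trans _ _ ((`|k| + 1) * `|x' - x|)) //; first by rewrite mulrDl mul1r addrC lerD2l.
by rewrite -ler_pdivlMl // mulrC ltW.
Qed.

Lemma closed_at_contr p q a b c d x : a <= x <= b ->
  (forall y, c <= y <= d -> closed_at p q (in_rect a b c d) x y) -> cont_on c d (q x).
Proof.
move=> xab H; apply: cont_onP => y ycd e e0.
have [k [l [m klm]]] := H y ycd.
have [r r0 hr] := klm 1 ltr01.
have K0 : 0 < `|m| + 1 by rewrite ltr_wpDl.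
exists (Num.min r (e / (`|m| + 1))); first by rewrite lt_min r0 divr_gt0.
move=> y' y'cd; rewrite lt_min => /andP[y'r y'e].
have [|//|_ h] := hr x y' (conj xab y'cd); first by rewrite subrr normr0.
rewrite subrr normr0 mulr0 !add0r !addr0 mul1r in h.
have -> : q x y' - q x y = (q x y' - (q x y + m * (y' - y))) + m * (y' - y) by ring.
rewrite (le_trans (ler_normD _ _))// normrM.
rewrite (@le_trans _ _ ((`|m| + 1) * `|y' - y|)) //; first by rewrite mulrDl mul1r addrC lerD2l.
by rewrite -ler_pdivlMl // mulrC ltW.
Qed.

(** The form is exact, [l] being both mixed coefficients. It is the part of a closed form that can
    be subtracted near a point without changing the boundary integral. *)
Lemma rect_int_affine a b c d (p0 q0 k l m : R) : a <= b -> c <= d ->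
  rect_int (fun x y => p0 + k * x + l * y) (fun x y => q0 + l * x + m * y) a b c d = 0.
Proof.
move=> ab cd; rewrite /rect_int.
have E1 y : int a b (fun x => p0 + k * x + l * y) = (p0 + l * y) * (b - a) + k * ((b ^+ 2 - a ^+ 2) / 2).
  by rewrite -int_affine //; apply: eq_int => x _; ring.
rewrite !E1 !int_affine //; lra.
Qed.

Lemma rect_int_le p q p1 q1 a b c d e : a <= b -> c <= d ->
  (forall y, c <= y <= d -> cont_on a b (p ^~ y)) ->
  (forall x, a <= x <= b -> cont_on c d (q x)) ->
  (forall y, c <= y <= d -> cont_on a b (p1 ^~ y)) ->
  (forall x, a <= x <= b -> cont_on c d (q1 x)) ->
  rect_int p1 q1 a b c d = 0 ->
  (forall x y, in_rect a b c d x y -> `|p x y - p1 x y| <= e) ->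
  (forall x y, in_rect a b c d x y -> `|q x y - q1 x y| <= e) ->
  `|rect_int p q a b c d| <= 2 * e * ((b - a) + (d - c)).
Proof.
move=> ab cd cp cq cp1 cq1 h0 hp hq.
have cc : c <= c <= d by rewrite lexx. have dd : c <= d <= d by rewrite lexx cd.
have aa : a <= a <= b by rewrite lexx. have bb : a <= b <= b by rewrite lexx ab.
have -> : rect_int p q a b c d = (int a b (fun x => p x c - p1 x c) - int a b (fun x => p x d - p1 x d))
   + (int c d (fun y => q b y - q1 b y) - int c d (fun y => q a y - q1 a y)).
  rewrite !intB; [|by auto..].
  by move: h0; rewrite /rect_int => h0; lra.
have I1 y : c <= y <= d -> `|int a b (fun x => p x y - p1 x y)| <= e * (b - a).
  move=> hy; apply: int_abs_le => //; first by apply: cont_onD; [exact: cp|apply: cont_onN; exact: cp1].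
  by move=> x hx; exact: hp.
have I2 x : a <= x <= b -> `|int c d (fun y => q x y - q1 x y)| <= e * (d - c).
  move=> hx; apply: int_abs_le => //; first by apply: cont_onD; [exact: cq|apply: cont_onN; exact: cq1].
  by move=> y hy; exact: hq.
move: (I1 c cc) (I1 d dd) (I2 a aa) (I2 b bb); rewrite !ler_norml => /andP[u1 u2] /andP[u3 u4] /andP[u5 u6] /andP[u7 u8].
by apply/andP; split; lra.
Qed.

(** The integrals along the inner segments cancel. *)
Lemma rect_int_split p q a s b c t d : a <= s -> s <= b -> c <= t -> t <= d ->
  (forall y, c <= y <= d -> cont_on a b (p ^~ y)) ->
  (forall x, a <= x <= b -> cont_on c d (q x)) ->
  rect_int p q a b c d = rect_int p q a s c t + rect_int p q s b c t
    + (rect_int p q a s t d + rect_int p q s b t d).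
Proof.
move=> h1 h2 h3 h4 cp cq; rewrite /rect_int.
have E1 y : c <= y <= d -> int a b (p ^~ y) = int a s (p ^~ y) + int s b (p ^~ y).
  by move=> hy; apply: int_chasles => //; exact: cp.
have E2 x : a <= x <= b -> int c d (q x) = int c t (q x) + int t d (q x).
  by move=> hx; apply: int_chasles => //; exact: cq.
rewrite (E1 c) ?(E1 d) ?(E2 a) ?(E2 b) ?(lexx, le_trans h1 h2, le_trans h3 h4) //.
lra.
Qed.

Variables (p q : R -> R -> R) (a b c d : R).
Hypotheses (ab : a <= b) (cd : c <= d).
Hypothesis H : forall x y, in_rect a b c d x y -> closed_at p q (in_rect a b c d) x y.

Let sc (n : nat) : R := (2 ^+ n)^-1.
Let rI n x y := rect_int p q x (x + (b - a) * sc n) y (y + (d - c) * sc n).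
Let ok n x y := [/\ a <= x, x + (b - a) * sc n <= b, c <= y & y + (d - c) * sc n <= d].

Let sc_half n : sc n = 2 * sc n.+1.
Proof. by rewrite /sc exprS invfM mulrA divff ?mul1r // pnatr_eq0. Qed.

Let sc_ge0 n : 0 <= sc n.
Proof. by rewrite /sc invr_ge0 exprn_ge0. Qed.

Let cont_p y : c <= y <= d -> cont_on a b (p ^~ y).
Proof. by move=> hy; apply: (closed_at_contl hy) => x hx; exact: H. Qed.

Let cont_q x : a <= x <= b -> cont_on c d (q x).
Proof. by move=> hx; apply: (closed_at_contr hx) => y hy; exact: H. Qed.

Let step n x y : ok n x y -> exists x' y', [/\ ok n.+1 x' y', x <= x' /\ x' + (b - a) * sc n.+1 <= x + (b - a) * sc n,
   y <= y' /\ y' + (d - c) * sc n.+1 <= y + (d - c) * sc n & `|rI n x y| <= 4 * `|rI n.+1 x' y'| ].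
Proof.
move=> [h1 h2 h3 h4].
have ba : 0 <= (b - a) * sc n.+1 by rewrite mulr_ge0 // subr_ge0.
have dc : 0 <= (d - c) * sc n.+1 by rewrite mulr_ge0 // subr_ge0.
have Ex : (b - a) * sc n = 2 * ((b - a) * sc n.+1) by rewrite sc_half; ring.
have Ey : (d - c) * sc n = 2 * ((d - c) * sc n.+1) by rewrite sc_half; ring.
rewrite /ok /rI in h1 h2 h3 h4 *; rewrite Ex Ey in h2 h4 *.
set u := (b - a) * sc n.+1 in ba h2 Ex *; set v := (d - c) * sc n.+1 in dc h4 Ey *.
rewrite (@rect_int_split p q x (x + u) _ y (y + v)) ; [|lra..| |]; first last.
- by move=> x' hx'; apply: (@cont_on_sub _ c d); [lra|lra|apply: cont_q; lra].
- by move=> y' hy'; apply: (@cont_on_sub _ a b); [lra|lra|apply: cont_p; lra].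
rewrite (_ : x + 2 * u = x + u + u); last by ring.
rewrite (_ : y + 2 * v = y + v + v); last by ring.
have [e1 e2 e3 e4] : [/\ a <= x + u, x + u <= b, c <= y + v & y + v <= d] by split; lra.
have [e5 e6 e7 e8] : [/\ x + u + u <= b, y + v + v <= d, x <= x + u & y <= y + v] by split; lra.
have [e9 e10] : x + u <= x + u + u /\ y + v <= y + v + v by split; lra.
clear - h1 h2 h3 h4 e1 e2 e3 e4 e5 e6 e7 e8 e9 e10.
set A := rect_int _ _ x _ y _; set B := rect_int _ _ (x + u) _ y _.
set C := rect_int _ _ x _ (y + v) _; set D := rect_int _ _ (x + u) _ (y + v) _.
have tri : `|A + B + (C + D)| <= `|A| + `|B| + (`|C| + `|D|).
  by rewrite (le_trans (ler_normD _ _)) // lerD // ler_normD.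
pose M := `|A + B + (C + D)|.
have [h|hA] := leP M (4 * `|A|); first by exists x, y; split.
have [h|hB] := leP M (4 * `|B|); first by exists (x + u), y; split.
have [h|hC] := leP M (4 * `|C|); first by exists x, (y + v); split.
exists (x + u), (y + v); split => //.
by rewrite -/M; rewrite -/M in tri; lra.
Qed.

(** Goursat's bisection: by [step] some quarter carries at least a quarter of the integral. The
    nested rectangles meet in a point where the form is affine up to a small multiple of the
    distance, so their integrals are o(4^-n), while they are at least 4^-n times the original
    one. *)
Theorem goursat_rect : rect_int p q a b c d = 0.
Proof.
(* Outside [ok] the successor is a dummy, so that [choice] gives a total function to iterate. *)
have : forall w : nat * R * R, exists z : R * R, ok w.1.1 w.1.2 w.2 ->
   [/\ ok w.1.1.+1 z.1 z.2, w.1.2 <= z.1 /\ z.1 + (b - a) * sc w.1.1.+1 <= w.1.2 + (b - a) * sc w.1.1,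
   w.2 <= z.2 /\ z.2 + (d - c) * sc w.1.1.+1 <= w.2 + (d - c) * sc w.1.1
   & `|rI w.1.1 w.1.2 w.2| <= 4 * `|rI w.1.1.+1 z.1 z.2|].
  move=> [[n x] y] /=; have [hk|hk] := pselect (ok n x y); last by exists (0, 0).
  by have [x' [y' ?]] := step hk; exists (x', y').
move=> /choice[F hF].
pose s := fix s n := if n is n'.+1 then F (n', (s n').1, (s n').2) else (a, c).
have sok n : ok n (s n).1 (s n).2.
  elim: n => [|n ih] /=; last by have [] := hF (n, (s n).1, (s n).2) ih.
  by split => //=; rewrite /sc expr0 invr1 mulr1; lra.
have st n := hF (n, (s n).1, (s n).2) (sok n).
have big n : `|rect_int p q a b c d| <= 4 ^+ n * `|rI n (s n).1 (s n).2|.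
  elim: n => [|n ih].
    rewrite expr0 mul1r /rI /= /sc expr0 invr1 !mulr1.
    by rewrite (_ : a + (b - a) = b) 1?(_ : c + (d - c) = d) //; ring.
  apply: (le_trans ih); rewrite exprSr -mulrA ler_wpM2l ?exprn_ge0 //.
  by have [] := st n.
have nest (g w : nat -> R) : (forall n, 0 <= w n) -> (forall n, g n <= g n.+1) ->
    (forall n, g n.+1 + w n.+1 <= g n + w n) -> exists z, forall n, g n <= z <= g n + w n.
  move=> w0 /nondecreasing_seqP gi gd.
  have /nonincreasing_seqP gd' : forall n, (fun n => g n + w n) n.+1 <= (fun n => g n + w n) n by [].
  have up m n : g m <= g n + w n.
    have [mn|/ltnW nm] := leqP m n; first by rewrite (le_trans (gi _ _ mn)) // lerDl.
    by rewrite (le_trans _ (gd' _ _ nm)) // lerDl.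
  exists (sup (range g)) => n; apply/andP; split.
    by apply: ub_le_sup; [exists (g 0%N + w 0%N) => _ [m _ <-]; exact: up|exists n].
  by apply: ge_sup; [exists (g 0%N); exists 0%N|move=> _ [m _ <-]; exact: up].
have bn n : 0 <= (b - a) * sc n by rewrite mulr_ge0 // subr_ge0.
have dn n : 0 <= (d - c) * sc n by rewrite mulr_ge0 // subr_ge0.
have [x hx] := nest (fun n => (s n).1) (fun n => (b - a) * sc n) bn
  (fun n => let: And4 _ h _ _ := st n in h.1) (fun n => let: And4 _ h _ _ := st n in h.2).
have [y hy] := nest (fun n => (s n).2) (fun n => (d - c) * sc n) dn
  (fun n => let: And4 _ _ h _ := st n in h.1) (fun n => let: And4 _ _ h _ := st n in h.2).
have xy : in_rect a b c d x y.
  have [] := sok 0%N; move: (hx 0%N) (hy 0%N) => /andP[h1 h2] /andP[h3 h4] h5 h6 h7 h8.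
  by split; apply/andP; split; lra.
pose S := (b - a) + (d - c).
have S0 : 0 <= S by rewrite /S addr_ge0 // subr_ge0.
have scS n : (b - a) * sc n <= S * sc n /\ (d - c) * sc n <= S * sc n.
  by split; apply: ler_wpM2r => //; rewrite /S ?lerDl ?lerDr subr_ge0.
(* With [w = S * sc n], the error is at most [e * (w + w)] on a perimeter [2 * w], in total
   [4 * e * w ^+ 2]; the square of [sc n] cancels the factor [4 ^+ n] of [big]. *)
have key e : 0 < e -> `|rect_int p q a b c d| <= e * (4 * S * S).
  move=> e0; have [k [l [m klm]]] := H xy.
  have [r r0 hr] := klm e e0.
  have [n hn] : exists n, S * sc n < r.
    have [n hn] : exists n, S / r < 2 ^+ n.
      exists (Num.bound (S / r)); apply: lt_le_trans (archi_boundP _) _; first by rewrite divr_ge0 // ltW.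
      by rewrite -natrX ler_nat ltnW // ltn_expl.
    by exists n; rewrite /sc ltr_pdivrMr ?exprn_gt0 // -ltr_pdivrMl // mulrC.
  apply: (le_trans (big n)).
  have [h1 h2 h3 h4] := sok n; have [/andP[h5 h6] /andP[h7 h8]] := (hx n, hy n).
  have [scb scd] := scS n.
  pose w := S * sc n; rewrite -/w in hn scb scd.
  have near_n x' y' : in_rect (s n).1 ((s n).1 + (b - a) * sc n) (s n).2 ((s n).2 + (d - c) * sc n) x' y' ->
     [/\ in_rect a b c d x' y', `|x' - x| <= w & `|y' - y| <= w].
    move=> hin; split; first by apply: in_rect_sub hin.
      by case: hin => hin _; exact: dist_in_itv (hx n) hin scb.
    by case: hin => _ hin; exact: dist_in_itv (hy n) hin scd.
  have apx x' y' : in_rect (s n).1 ((s n).1 + (b - a) * sc n) (s n).2 ((s n).2 + (d - c) * sc n) x' y' ->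
      `|p x' y' - (p x y + k * (x' - x) + l * (y' - y))| <= e * (w + w) /\
      `|q x' y' - (q x y + l * (x' - x) + m * (y' - y))| <= e * (w + w).
    move=> /near_n[hin hxw hyw].
    have [hp hq] := hr x' y' hin (le_lt_trans hxw hn) (le_lt_trans hyw hn).
    have ew : e * (`|x' - x| + `|y' - y|) <= e * (w + w) by rewrite ler_pM2l // lerD.
    by split; exact: le_trans ew.
  have ncont (k0 k1 u v : R) : cont_on u v (fun z => k0 + k1 * z).
    by apply: cont_on_cont => z; apply: cvgD; [exact: cvg_cst|apply: cvgM; [exact: cvg_cst|exact: cvg_id]].
  have -> : 4 ^+ n * `|rI n (s n).1 (s n).2| = `|rI n (s n).1 (s n).2| / (sc n * sc n).
    rewrite mulrC /sc -invfM invrK -exprMn_comm; last by rewrite /GRing.comm mulrC.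
    by rewrite -natrM.
  have scn0 : 0 < sc n by rewrite /sc invr_gt0 exprn_gt0.
  rewrite ler_pdivrMr ?mulr_gt0 //.
  apply: (le_trans (@rect_int_le p q
     (fun x' y' => (p x y - k * x - l * y) + k * x' + l * y')
     (fun x' y' => (q x y - l * x - m * y) + l * x' + m * y') _ _ _ _ (e * (w + w)) _ _ _ _ _ _ _ _ _)).
  - by rewrite lerDl.
  - by rewrite lerDl.
  - by move=> y' /andP[hy1 hy2]; apply: (@cont_on_sub _ a b) => //; apply: cont_p; rewrite (le_trans h3) // (le_trans hy2).
  - by move=> x' /andP[hx1 hx2]; apply: (@cont_on_sub _ c d) => //; apply: cont_q; rewrite (le_trans h1) // (le_trans hx2).
  - move=> y' _; rewrite (_ : (fun x' => _) = (fun x' => (p x y - k * x - l * y + l * y') + k * x')) //.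
    by apply/funext => x'; ring.
  - by move=> x' _.
  - by apply: rect_int_affine; rewrite lerDl.
  - move=> x' y' /apx[h _]; rewrite (_ : _ - _ = p x' y' - (p x y + k * (x' - x) + l * (y' - y))) //; ring.
  - move=> x' y' /apx[_ h]; rewrite (_ : _ - _ = q x' y' - (q x y + l * (x' - x) + m * (y' - y))) //; ring.
  rewrite (_ : _ + _ - _ + (_ - _) = w); last by rewrite /w /S; ring.
  by rewrite /w le_eqVlt; apply/orP; left; apply/eqP; ring.
apply/eqP; rewrite -normr_le0; apply/ler_addgt0Pr => e e0; rewrite add0r.
have [Sz|Sn] := eqVneq S 0; first by have := key 1 ltr01; rewrite Sz !mulr0 => h; exact: le_trans h (ltW e0).
have S4 : 0 < 4 * S * S by rewrite !mulr_gt0 // lt_neqAle eq_sym Sn S0.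
by have := key (e / (4 * S * S)); rewrite divr_gt0 // => /(_ isT); rewrite divfK // gt_eqF.
Qed.

End Goursat.

(** * Complex derivatives *)

Section ComplexBasics.
Context {R : realType}.
Implicit Types (z w : R[i]) (f g : R[i] -> R[i]) (t : R).
Local Notation Re := complex.Re.
Local Notation Im := complex.Im.

(** The norm of [R[i]] takes its values in [R[i]]; this is the same modulus as a real number, within
    reach of the real order and [lra]. *)
Definition cabs z : R := Normc.normc z.

Lemma normc_cabs z : `|z| = (cabs z)%:C.
Proof. by rewrite normc_def /cabs; case: z. Qed.

Lemma cabs_ge0 z : 0 <= cabs z.
Proof. by case: z => a b; exact: sqrtr_ge0. Qed.

Lemma cabs_sqr z : cabs z ^+ 2 = Re z ^+ 2 + Im z ^+ 2.
Proof. by case: z => a b; rewrite sqr_sqrtr // addr_ge0 // sqr_ge0. Qed.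

Lemma cabsM z w : cabs (z * w) = cabs z * cabs w.
Proof. exact: Normc.normcM. Qed.

Lemma cabsV z : cabs z^-1 = (cabs z)^-1.
Proof. exact: Normc.normcV. Qed.

Lemma cabsD z w : cabs (z + w) <= cabs z + cabs w.
Proof. exact: le_normcD. Qed.

Lemma cabsN z : cabs (- z) = cabs z.
Proof. exact: normcN. Qed.

Lemma cabsB z w : cabs (z - w) <= cabs z + cabs w.
Proof. by rewrite -(cabsN w) cabsD. Qed.

Lemma cabs_distC z w : cabs (z - w) = cabs (w - z).
Proof. by rewrite -cabsN opprB. Qed.

Lemma cabs0 : cabs 0 = 0. Proof. exact: Normc.normc0. Qed.
Lemma cabs1 : cabs 1 = 1. Proof. exact: Normc.normc1. Qed.

Lemma cabs_eq0 z : (cabs z == 0) = (z == 0).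
Proof. by apply/eqP/eqP => [/Normc.eq0_normc //|->]; exact: cabs0. Qed.

Lemma cabs_gt0 z : (0 < cabs z) = (z != 0).
Proof. by rewrite lt_neqAle cabs_ge0 andbT eq_sym cabs_eq0. Qed.

Lemma cabs_real (x : R) : cabs x%:C = `|x|.
Proof. by rewrite /cabs /= expr0n addr0 sqrtr_sqr. Qed.

Lemma cabsX z n : cabs (z ^+ n) = cabs z ^+ n.
Proof. by elim: n => [|n ih]; rewrite ?expr0 ?cabs1 // !exprS cabsM ih. Qed.

Lemma cabs_Re z : `|Re z| <= cabs z.
Proof. by case: z => a b; rewrite /cabs /= -sqrtr_sqr ler_sqrt ?lerDl ?sqr_ge0 // addr_ge0 ?sqr_ge0. Qed.

Lemma cabs_Im z : `|Im z| <= cabs z.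
Proof. by case: z => a b; rewrite /cabs /= -sqrtr_sqr ler_sqrt ?lerDr ?sqr_ge0 // addr_ge0 ?sqr_ge0. Qed.

Lemma cabs_le z : cabs z <= `|Re z| + `|Im z|.
Proof.
rewrite [in leLHS](complexE z).
apply: (le_trans (cabsD _ _)); rewrite cabsM !cabs_real lerD2l.
by rewrite /cabs /= expr0n expr1n add0r sqrtr1 mul1r.
Qed.

Lemma cabs_conj z : cabs z^* = cabs z.
Proof. by case: z => a b; rewrite /cabs /= sqrrN. Qed.

Lemma cabs_sub_le z w : `|cabs z - cabs w| <= cabs (z - w).
Proof.
rewrite ler_norml; apply/andP; split.
  by have := cabsD (w - z) z; rewrite subrK cabs_distC; lra.
by have := cabsD (z - w) w; rewrite subrK; lra.
Qed.

Lemma mul_conj z : z * z^* = (cabs z ^+ 2)%:C.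
Proof. by rewrite -sqr_normc normc_cabs rmorphXn. Qed.

Lemma ReD z w : Re (z + w) = Re z + Re w. Proof. by case: z w => ? ? []. Qed.
Lemma ImD z w : Im (z + w) = Im z + Im w. Proof. by case: z w => ? ? []. Qed.
Lemma ReN z : Re (- z) = - Re z. Proof. by case: z. Qed.
Lemma ImN z : Im (- z) = - Im z. Proof. by case: z. Qed.
Lemma ReM z w : Re (z * w) = Re z * Re w - Im z * Im w. Proof. by case: z w => ? ? []. Qed.
Lemma ImM z w : Im (z * w) = Re z * Im w + Im z * Re w. Proof. by case: z w => ? ? []. Qed.
Lemma ReMr z (x : R) : Re (z * x%:C) = Re z * x. Proof. by rewrite ReM /= mulr0 subr0. Qed.
Lemma ImMr z (x : R) : Im (z * x%:C) = Im z * x. Proof. by rewrite ImM /= mulr0 add0r. Qed.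

Lemma diskE z : disk z <-> cabs z < 1.
Proof. by rewrite /disk /= normc_cabs (ltcR _ 1). Qed.

Lemma cisD s t : cis (s + t) = cis s * cis t.
Proof. by rewrite /cis cosD sinD; apply/eqP; rewrite eq_complex /= eqxx addrC eqxx. Qed.

Lemma cabs_cis t : cabs (cis t) = 1.
Proof. by rewrite /cabs /= cos2Dsin2 sqrtr1. Qed.

Lemma cis_neq0 t : cis t != 0.
Proof. by rewrite -cabs_gt0 cabs_cis. Qed.

Lemma cisD2pi t : cis (t + 2 * pi) = cis t.
Proof. by rewrite mulr_natl /cis cosD2pi sinD2pi. Qed.

Lemma conj_cis t : (cis t)^* = (cis t)^-1.
Proof.
apply: (@mulfI _ (cis t)); first exact: cis_neq0.
by rewrite divff ?cis_neq0 // mul_conj cabs_cis expr1n.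
Qed.

Lemma cabs_rcis (r t : R) : 0 <= r -> cabs (r%:C * cis t) = r.
Proof. by move=> r0; rewrite cabsM cabs_cis cabs_real mulr1 ger0_norm. Qed.

Lemma cexpD z w : cexp (z + w) = cexp z * cexp w.
Proof.
have E x : cexp x = (expR (Re x))%:C * cis (Im x) by [].
by rewrite !E ReD ImD expRD rmorphM cisD; ring.
Qed.

Lemma cexp0 : cexp (0 : R[i]) = 1.
Proof. by rewrite /cexp expR0 cos0 sin0 mulr1. Qed.

Lemma cabs_cexp z : cabs (cexp z) = expR (Re z).
Proof. by rewrite cabs_rcis // expR_ge0. Qed.

Lemma cexp_neq0 z : cexp z != 0.
Proof. by rewrite -cabs_gt0 cabs_cexp expR_gt0. Qed.

Lemma cexp_polar (x y : R) : cexp (x +i* y) = (expR x)%:C * cis y.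
Proof. by []. Qed.

Lemma cvg_cabsP T (F : set_system T) {FF : Filter F} (h : T -> R[i]) w :
  (h x : R[i]^o) @[x --> F] --> (w : R[i]^o) <->
  forall e : R, 0 < e -> \forall x \near F, cabs (w - h x) <= e.
Proof.
split=> [/(@cvgrPdist_le R[i] R[i]^o) H e e0|H].
  have := H e%:C; rewrite (ltcR 0) => /(_ e0).
  by apply: filterS => x; rewrite normc_cabs lecR.
apply/(@cvgrPdist_le R[i] R[i]^o) => e; rewrite ltcE /= => /andP[/eqP ie e0].
by apply: filterS (H _ e0) => x xe; rewrite normc_cabs lecE /= ie eqxx.
Qed.

Lemma cvg_complexP T (F : set_system T) {FF : Filter F} (h : T -> R[i]) w :
  (h x : R[i]^o) @[x --> F] --> (w : R[i]^o) <->
  Re (h x) @[x --> F] --> Re w /\ Im (h x) @[x --> F] --> Im w.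
Proof.
split=> [/cvg_cabsP H|[/cvgrPdist_le H1 /cvgrPdist_le H2]].
  split; apply/cvgrPdist_le => /= e /H; apply: filterS => x; apply: le_trans.
    by rewrite -ReN -ReD cabs_Re.
  by rewrite -ImN -ImD cabs_Im.
apply/cvg_cabsP => e e0; have e2 : 0 < e / 2 by rewrite divr_gt0.
apply: filterS2 (H1 _ e2) (H2 _ e2) => x h1 h2.
by rewrite (le_trans (cabs_le _)) // ReD ReN ImD ImN [leRHS]splitr lerD.
Qed.

Lemma cvg_cabs T (F : set_system T) {FF : Filter F} (h : T -> R[i]) w :
  (h x : R[i]^o) @[x --> F] --> (w : R[i]^o) -> cabs (h x) @[x --> F] --> cabs w.
Proof.
move=> /cvg_cabsP H; apply/cvgrPdist_le => /= e /H.
by apply: filterS => x; apply: le_trans; exact: cabs_sub_le.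
Qed.

Definition holo f z := derivable (f : R[i]^o -> R[i]^o) z 1.

(** Differentiability with the value of the derivative exposed and without division, so that [w = z]
    is no exception and remainder estimates apply directly. *)
Definition cder f z d := forall e : R, 0 < e -> exists2 r : R, 0 < r &
  forall w, cabs (w - z) < r -> cabs (f w - f z - d * (w - z)) <= e * cabs (w - z).

Lemma cder_near f z d : cder f z d -> forall e, 0 < e ->
  \forall h \near (0 : (R[i] : numFieldType))^', cabs (d - h^-1 * (f (h + z) - f z)) <= e.
Proof.
move=> H e e0; have [r r0 hr] := H _ e0.
apply/nbhs_ballP; exists r%:C; first by rewrite /= (ltcR 0).
move=> h; rewrite /ball /= sub0r normrN normc_cabs ltcR => hhr hn0.
have h0 : 0 < cabs h by rewrite cabs_gt0; exact: hn0.
rewrite -(ler_pM2r h0) -cabsM -cabsN.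
have := hr (h + z); rewrite addrK => /(_ hhr).
by congr (_ <= _); congr cabs; rewrite mulrBl opprB mulrAC mulVf ?mul1r.
Qed.

Lemma cder_holo f z d : cder f z d -> holo f z.
Proof.
move=> H; rewrite /holo /derivable.
apply/cvg_ex; exists d; apply/cvg_cabsP => e /(cder_near H); apply: filterS => h.
by rewrite /GRing.scale /= mulr1.
Qed.

Lemma cder_cderiv f z d : cder f z d -> cderiv f z = d.
Proof.
move=> H; rewrite /cderiv /derive1; apply: (@cvg_lim R[i]^o); first exact: norm_hausdorff.
by apply/cvg_cabsP => e /(cder_near H).
Qed.

Lemma holo_cder f z : holo f z -> cder f z (cderiv f z).
Proof.
rewrite /holo /derivable => hf e e0.
have E : cderiv f z = 'D_1 (f : R[i]^o -> R[i]^o) z by exact: (@derive1E R[i] R[i]^o f z).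
rewrite E {E}.
have /cvg_cabsP/(_ e e0)/nbhs_ballP := hf.
move=> [r]; rewrite /= ltcE /= => /andP[/eqP ir r0] hr.
exists (Re r) => // w wz.
have [->|wzN] := eqVneq w z; first by rewrite !subrr mulr0 subrr cabs0 mulr0.
have := hr (w - z); rewrite /ball /= sub0r normrN normc_cabs ltcE /= ir eqxx wz => /(_ isT).
rewrite subr_eq0 => /(_ wzN); rewrite /GRing.scale /= mulr1 subrK.
have h0 : 0 < cabs (w - z) by rewrite cabs_gt0 subr_eq0.
rewrite -(ler_pM2r h0) -cabsM -cabsN.
by congr (_ <= _); congr cabs; rewrite mulrBl opprB mulrAC mulVf ?mul1r ?subr_eq0.
Qed.

Lemma holo_continuous f z : holo f z ->
  (f w : R[i]^o) @[w --> (z : R[i]^o)] --> (f z : R[i]^o).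
Proof.
move=> /holo_cder H; apply/(@cvg_cabsP _ _ (nbhs_filter (z : R[i]^o))) => e e0.
have [r r0 hr] := H 1 ltr01; pose k := 1 + cabs (cderiv f z).
have k0 : 0 < k by rewrite ltr_wpDr ?cabs_ge0.
apply/nbhs_ballP; exists (Num.min r (e / k))%:C; first by rewrite /= (ltcR 0) lt_min r0 divr_gt0.
move=> w; rewrite /ball /= normc_cabs ltcR lt_min (cabs_distC z w) => /andP[wr we].
rewrite (cabs_distC (f z) (f w)).
have := cabsD (f w - f z - cderiv f z * (w - z)) (cderiv f z * (w - z)).
rewrite subrK cabsM => /le_trans; apply.
rewrite (le_trans (lerD (hr w wr) (lexx _))) // -mulrDl -ler_pdivlMl // mulrC.
exact: ltW.
Qed.

Lemma near_holo f g z (r : R) : 0 < r -> (forall w, cabs (w - z) < r -> f w = g w) ->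
  holo f z -> holo g z.
Proof.
move=> r0 fg /holo_cder H; apply: (@cder_holo _ _ (cderiv f z)) => e e0.
have [s s0 hs] := H e e0; exists (Num.min r s); first by rewrite lt_min r0.
move=> w; rewrite lt_min => /andP[wr ws]; rewrite -!fg //; first exact: hs.
by rewrite subrr cabs0.
Qed.

Lemma holo_cst (k : R[i]) z : holo (fun=> k) z.
Proof. exact: (@derivable_cst _ _ _ (k : R[i]^o)). Qed.

Lemma holo_id z : holo id z. Proof. exact: derivable_id. Qed.

Lemma holoD f g z : holo f z -> holo g z -> holo (fun w => f w + g w) z.
Proof. exact: (@derivableD _ _ _ (f : R[i]^o -> R[i]^o) g). Qed.

Lemma holoM f g z : holo f z -> holo g z -> holo (fun w => f w * g w) z.
Proof. exact: (@derivableM _ _ (f : R[i]^o -> R[i]^o) g). Qed.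

Lemma holoB f g z : holo f z -> holo g z -> holo (fun w => f w - g w) z.
Proof. exact: (@derivableB _ _ _ (f : R[i]^o -> R[i]^o) g). Qed.

Lemma holo_comp f g z : holo f z -> holo g (f z) -> holo (fun w => g (f w)) z.
Proof.
move=> /derivable1_diffP hf /derivable1_diffP hg; apply/derivable1_diffP.
exact: (differentiable_comp hf hg).
Qed.

Lemma holo_inv z : z != 0 -> holo (fun w => w^-1) z.
Proof.
move=> z0; have cz : 0 < cabs z by rewrite cabs_gt0.
apply: (@cder_holo _ _ (- z^-2)) => e e0.
exists (Num.min (cabs z / 2) (e * cabs z ^+ 3 / 2)).
  by rewrite lt_min !divr_gt0 // mulr_gt0 // exprn_gt0.
move=> w; rewrite lt_min => /andP[w1 w2].
have w3 : cabs z / 2 <= cabs w.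
  have := cabs_sub_le z w; rewrite cabs_distC ler_norml => /andP[_]; lra.
have w0 : w != 0 by rewrite -cabs_gt0; lra.
have -> : w^-1 - z^-1 - - z ^- 2 * (w - z) = (w - z) ^+ 2 / (z ^+ 2 * w) by field; rewrite z0 w0.
rewrite cabsM cabsV !cabsM -mulrA [leRHS]mulrC ler_wpM2l ?cabs_ge0 //.
rewrite ler_pdivrMr ?mulr_gt0 ?cabs_gt0 //.
have : e * (cabs z * cabs z) * (cabs z / 2) <= e * (cabs z * cabs z) * cabs w.
  by rewrite ler_wpM2l // !mulr_ge0 ?cabs_ge0 // ltW.
rewrite !exprS expr0 mulr1 in w2; lra.
Qed.

Lemma holoV f z : f z != 0 -> holo f z -> holo (fun w => (f w)^-1) z.
Proof. by move=> f0 hf; apply: (holo_comp hf); exact: holo_inv. Qed.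

(** By [cexpD] it is enough to treat the origin, where the first-order expansions of [expR], [cos]
    and [sin] are multiplied out. *)
Lemma cder_cexp z : cder (@cexp R) z (cexp z).
Proof.
have sm (f : R -> R) (d : R) : is_derive 0 (1 : R) f d -> forall e, 0 < e ->
    exists2 r, 0 < r & forall h, `|h| < r -> `|f h - f 0 - d * h| <= e * `|h|.
  move=> [df dE] e e0.
  have : h^-1 *: ((f \o shift 0) (h *: (1 : R)) - f 0) @[h --> 0^'] --> d.
    by rewrite -dE; exact: df.
  move=> /cvgrPdist_le/(_ e e0)/nbhs_ballP[r /= r0 hr]; exists r => // h hh.
  have [->|hn] := eqVneq h 0; first by rewrite subrr mulr0 subrr !normr0 mulr0.
  have := hr h; rewrite /ball /= sub0r normrN => /(_ hh hn).
  rewrite /GRing.scale /= mulr1 addr0 -(ler_pM2r (_ : 0 < `|h|)) ?normr_gt0 // -normrM.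
  by rewrite mulrBl mulrAC mulVf // mul1r distrC.
suff H0 : cder (@cexp R) (0 : R[i]) 1.
  move=> e e0; have e1 : 0 < e / cabs (cexp z) by rewrite divr_gt0 // cabs_gt0 cexp_neq0.
  have [r r0 hr] := H0 _ e1; exists r => // w wz.
  have := hr (w - z); rewrite subr0 cexp0 mul1r => /(_ wz).
  have -> : cexp w - cexp z - cexp z * (w - z) = cexp z * (cexp (w - z) - 1 - (w - z)).
    by rewrite !mulrBr -cexpD (addrC z) subrK mulr1.
  by move=> h; rewrite cabsM mulrC -ler_pdivlMr ?cabs_gt0 ?cexp_neq0 // (le_trans h) // mulrAC.
have he := sm _ _ (is_derive_expR 0); have hc := sm _ _ (is_derive_cos 0).
have hs := sm _ _ (is_derive_sin 0).
rewrite ?expR0 ?cos0 ?sin0 in he hc hs.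
move=> e e0.
(* The real and imaginary parts of the remainder will cost [4 * (k * s)] and [5 * (k * s)], so a
   tenth of [e] is enough. *)
pose k := Num.min 1 (e / 10).
have k0 : 0 < k by rewrite lt_min ltr01 divr_gt0.
have [k1 ke] : k <= 1 /\ k <= e / 10 by split; rewrite ge_min lexx ?orbT.
have [r1 r10 h1] := he k k0; have [r2 r20 h2] := hc k k0; have [r3 r30 h3] := hs k k0.
exists (Num.min r1 (Num.min r2 (Num.min r3 k))); first by rewrite lt_min r10 lt_min r20 lt_min r30; exact: k0.
move=> w; rewrite subr0 !lt_min cexp0 mul1r => /and4P[w1 w2 w3 w4].
have := h1 (Re w) (le_lt_trans (cabs_Re _) w1).
have := h2 (Im w) (le_lt_trans (cabs_Im _) w2).
have := h3 (Im w) (le_lt_trans (cabs_Im _) w3).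
rewrite mul1r !subr0 oppr0 mul0r subr0 mul1r.
have := cabs_Re w; have := cabs_Im w.
set a := Re w; set b := Im w; set s := cabs w in w4 *.
set E := expR a - 1 - a; set C := cos b - 1; set S := sin b - b.
have s0 : 0 <= s := cabs_ge0 w.
move=> hb ha hS hC hE.
have hS' : `|S| <= k * s by rewrite (le_trans hS) // ler_pM2l.
have hC' : `|C| <= k * s by rewrite (le_trans hC) // ler_pM2l.
have hE' : `|E| <= k * s by rewrite (le_trans hE) // ler_pM2l.
have -> : cexp w - 1 - w = (E + C + (a + E) * C) +i* (S + (a + E) * (b + S)).
  apply/eqP; rewrite eq_complex /E /C /S /a /b /cexp; case: (w) => x y /=; by apply/andP; split; apply/eqP; ring.
apply: (le_trans (cabs_le _)) => /=.
have ks : k * s <= s by rewrite ler_piMl.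
have aE : `|a + E| <= 2 * s by rewrite (le_trans (ler_normD _ _)) // mulr2n mulrDl mul1r lerD // (le_trans hE').
have bS : `|b + S| <= 2 * s by rewrite (le_trans (ler_normD _ _)) // mulr2n mulrDl mul1r lerD // (le_trans hS').
have p1 : `|(a + E) * C| <= 2 * (k * s).
  rewrite normrM (le_trans (ler_pM _ _ aE hC')) // -mulrA ler_pM2l // ler_piMl //; last lra.
  by rewrite mulr_ge0 // ltW.
have p2 : `|(a + E) * (b + S)| <= 4 * (k * s).
  rewrite normrM (le_trans (ler_pM _ _ aE bS)) //.
  rewrite (_ : 2 * s * (2 * s) = 4 * (s * s)); last by ring.
  by rewrite ler_pM2l // ler_wpM2r // le_min; case/andP: w4 => /ltW -> /ltW ->.
have q1 : `|E + C + (a + E) * C| <= 4 * (k * s).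
  rewrite (le_trans (ler_normD _ _)) // (le_trans (lerD (ler_normD _ _) (lexx _))) //.
  by rewrite (le_trans (lerD (lerD hE' hC') p1)) //; lra.
have q2 : `|S + (a + E) * (b + S)| <= 5 * (k * s).
  by rewrite (le_trans (ler_normD _ _)) // (le_trans (lerD hS' p2)) //; lra.
apply: (le_trans (lerD q1 q2)).
have : k * s <= e / 10 * s by rewrite ler_wpM2r.
have : 0 <= e * s by rewrite mulr_ge0 // ltW.
lra.
Qed.

Lemma holo_cexp z : holo (@cexp R) z. Proof. exact: cder_holo (cder_cexp z). Qed.

Lemma cvg_rcis (r t : R) : (r%:C * cis s : R[i]^o) @[s --> t] --> ((r%:C * cis t : R[i]) : R[i]^o).
Proof.
apply/cvg_complexP; rewrite ?ReM ?ImM /=.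
split; under eq_fun do rewrite ?ReM ?ImM /= ?mul0r ?subr0 ?addr0.
  by rewrite ?mul0r ?subr0; apply: cvgM; [exact: cvg_cst|exact: continuous_cos].
by rewrite ?mul0r ?addr0; apply: cvgM; [exact: cvg_cst|exact: continuous_sin].
Qed.

Lemma cvg_radius (r t : R) : (s%:C * cis t : R[i]^o) @[s --> r] --> ((r%:C * cis t : R[i]) : R[i]^o).
Proof.
apply/cvg_complexP; split; under eq_fun do rewrite ?ReM ?ImM /= ?mul0r ?subr0 ?addr0.
  by rewrite ReM /= mul0r subr0; apply: cvgM; [exact: cvg_id|exact: cvg_cst].
by rewrite ImM /= mul0r addr0; apply: cvgM; [exact: cvg_id|exact: cvg_cst].
Qed.

Lemma cvg_circle f (r t : R) : holo f (r%:C * cis t) ->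
  (f (r%:C * cis s) : R[i]^o) @[s --> t] --> (f (r%:C * cis t) : R[i]^o).
Proof. by move=> hf; apply: cvg_comp (holo_continuous hf); exact: cvg_rcis. Qed.

Lemma cvg_ray f (r t : R) : holo f (r%:C * cis t) ->
  (f (s%:C * cis t) : R[i]^o) @[s --> r] --> (f (r%:C * cis t) : R[i]^o).
Proof. by move=> hf; apply: cvg_comp (holo_continuous hf); exact: cvg_radius. Qed.

Lemma circle_continuous f (r : R) : 0 <= r -> (forall z, cabs z = r -> holo f z) ->
  continuous (fun t => Re (f (r%:C * cis t))) /\
  continuous (fun t => Im (f (r%:C * cis t))) /\
  continuous (fun t => cabs (f (r%:C * cis t))).
Proof.
move=> r0 hf.
have h t := @cvg_circle f r t (hf _ (cabs_rcis t r0)).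
by split; [|split] => t; [have /cvg_complexP[] := h t|have /cvg_complexP[] := h t|exact: (cvg_cabs (h t))].
Qed.

Lemma analytic_holo f z : analytic_disk f -> cabs z < 1 -> holo f z.
Proof. by move=> af /diskE; exact: af. Qed.

End ComplexBasics.

Opaque pi cos sin expR ln.

(** * The Poisson formula *)

Section Polar.
Context {R : realType}.
Implicit Types (z w : R[i]) (f g h q : R[i] -> R[i]) (t : R).
Local Notation Re := complex.Re.
Local Notation Im := complex.Im.

(** The coordinates log r and angle turn annuli into rectangles. The form is the real part of f(exp
    w) dw, and the Cauchy-Riemann equations make it closed. *)
Lemma polar_closed f (D : R -> R -> Prop) (x y : R) : holo f (cexp (x +i* y)) ->
  closed_at (fun x y => Re (f (cexp (x +i* y)))) (fun x y => - Im (f (cexp (x +i* y)))) D x y.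
Proof.
move=> hf; have /holo_cder := holo_comp (@holo_cexp R (x +i* y)) hf.
set d := cderiv _ _ => H.
exists (Re d), (- Im d), (- Re d) => e e0; have [r r0 hr] := H e e0.
exists (r / 2) => [|x' y' _ hx hy]; first by rewrite divr_gt0.
have le1 : cabs ((x' +i* y') - (x +i* y)) <= `|x' - x| + `|y' - y| by exact: cabs_le.
have lt1 : `|x' - x| + `|y' - y| < r by rewrite [ltRHS]splitr ltrD.
have := hr (x' +i* y') (le_lt_trans le1 lt1).
set E := _ - _ - _ => hE.
have {}hE : cabs E <= e * (`|x' - x| + `|y' - y|) by rewrite (le_trans hE) // ler_pM2l.
split; [apply: le_trans (le_trans (cabs_Re E) hE)|apply: le_trans (le_trans (cabs_Im E) hE)].
  rewrite le_eqVlt; apply/orP; left; apply/eqP; congr `|_|.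
  by rewrite /E !ReD !ReN ReM /=; ring.
rewrite -normrN le_eqVlt; apply/orP; left; apply/eqP; congr `|_|.
by rewrite /E !ImD !ImN ImM /=; ring.
Qed.

Lemma expR_ln_itv (r s x : R) : 0 < r -> 0 < s -> ln r <= x <= ln s -> r <= expR x <= s.
Proof.
move=> r0 s0 /andP[h1 h2]; apply/andP; split.
  by rewrite -(lnK r0) ler_expR.
by rewrite -(lnK s0) ler_expR.
Qed.

Lemma polar_rect f (r s a b : R) : 0 < r -> r <= s -> a <= b ->
  (forall z, r <= cabs z <= s -> holo f z) ->
  [/\ rect_int (fun x y => Re (f (cexp (x +i* y)))) (fun x y => - Im (f (cexp (x +i* y))))
        (ln r) (ln s) a b = 0,
    forall y, cont_on (ln r) (ln s) (fun x => Re (f (cexp (x +i* y)))) &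
    forall x, r <= x <= s -> cont_on a b (fun y => - Im (f (x%:C * cis y)))].
Proof.
move=> r0 rs ab hf; have s0 : 0 < s := lt_le_trans r0 rs.
have lrs : ln r <= ln s by rewrite ler_ln.
have C D x y : ln r <= x <= ln s -> closed_at (fun x y => Re (f (cexp (x +i* y))))
    (fun x y => - Im (f (cexp (x +i* y)))) D x y.
  by move=> hx; apply: polar_closed; apply: hf; rewrite cabs_cexp; exact: expR_ln_itv.
split; first by apply: goursat_rect => // x y [hx _]; exact: C.
  move=> y; have yy : y <= y <= y by rewrite lexx.
  apply: (@closed_at_contl R (fun x y => Re (f (cexp (x +i* y)))) (fun x y => - Im (f (cexp (x +i* y))))
    (ln r) (ln s) y y y yy) => x hx; exact: C.
move=> x /andP[h1 h2]; have x0 : 0 < x := lt_le_trans r0 h1.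
have -> : (fun y => - Im (f (x%:C * cis y))) = (fun y => - Im (f (cexp (ln x +i* y)))).
  by apply/funext => y; rewrite cexp_polar lnK.
have lx : ln x <= ln x <= ln x by rewrite lexx.
apply: (@closed_at_contr R (fun x y => Re (f (cexp (x +i* y)))) (fun x y => - Im (f (cexp (x +i* y))))
  (ln x) (ln x) a b (ln x) lx) => y hy.
by apply: C; rewrite !ler_ln ?h1.
Qed.

Let mulI f z : Re (f z) = - Im (- 'i%C * f z).
Proof. by rewrite ImM /=; ring. Qed.

(** Cauchy's theorem for [- 'i * f] in logarithmic coordinates: by [mulI] the vertical edges are the
    two arcs, and the two radial edges, each of length [ln s - ln r], bound their difference. *)
Lemma arc_int_sub f (r s a b M : R) : 0 < r -> r <= s -> a <= b ->
  (forall z, r <= cabs z <= s -> holo f z) ->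
  (forall z, r <= cabs z <= s -> cabs (f z) <= M) ->
  `|int a b (fun t => Re (f (s%:C * cis t))) - int a b (fun t => Re (f (r%:C * cis t)))|
    <= 2 * M * (ln s - ln r).
Proof.
move=> r0 rs ab hf fM; have s0 : 0 < s := lt_le_trans r0 rs.
have lrs : ln r <= ln s by rewrite ler_ln.
have hg z : r <= cabs z <= s -> holo (fun z => - 'i%C * f z) z.
  by move=> hz; apply: holoM; [exact: holo_cst|exact: hf].
have [/eqP H c1 _] := polar_rect r0 rs ab hg.
rewrite /rect_int addr_eq0 in H; move: H => /eqP H.
have E x : 0 < x -> int a b (fun t => Re (f (x%:C * cis t))) = int a b (fun t => - Im (- 'i%C * f (cexp (ln x +i* t)))).
  by move=> x0; apply: eq_int => t _; rewrite mulI cexp_polar lnK.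
rewrite (E _ s0) (E _ r0) -normrN -H.
have B y : `|int (ln r) (ln s) (fun x => Re (- 'i%C * f (cexp (x +i* y))))| <= M * (ln s - ln r).
  apply: int_abs_le => // x hx; rewrite (le_trans (cabs_Re _)) // cabsM cabsN.
  rewrite {1}/cabs /= expr0n expr1n add0r sqrtr1 mul1r; by apply: fM; rewrite cabs_cexp; exact: expR_ln_itv.
apply: (le_trans (ler_normB _ _)); apply: (le_trans (lerD (B a) (B b))).
by rewrite -mulrA mulr_natl mulr2n.
Qed.

(** Over a full turn the two radial edges coincide and cancel. *)
Lemma circle_int_const f (r s : R) : 0 < r -> r <= s ->
  (forall z, r <= cabs z <= s -> holo f z) ->
  int 0 (2 * pi) (fun t => Re (f (s%:C * cis t))) = int 0 (2 * pi) (fun t => Re (f (r%:C * cis t))).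
Proof.
move=> r0 rs hf; have s0 : 0 < s := lt_le_trans r0 rs.
have p0 : 0 <= 2 * pi :> R by rewrite mulr_ge0 // pi_ge0.
have hg z : r <= cabs z <= s -> holo (fun z => - 'i%C * f z) z.
  by move=> hz; apply: holoM; [exact: holo_cst|exact: hf].
have [H _ _] := polar_rect r0 rs p0 hg.
have E x : 0 < x -> int 0 (2 * pi) (fun t => Re (f (x%:C * cis t))) =
    int 0 (2 * pi) (fun t => - Im (- 'i%C * f (cexp (ln x +i* t)))).
  by move=> x0; apply: eq_int => t _; rewrite mulI cexp_polar lnK.
have E0 : int (ln r) (ln s) (fun x => Re (- 'i%C * f (cexp (x +i* 0)))) =
    int (ln r) (ln s) (fun x => Re (- 'i%C * f (cexp (x +i* (2 * pi))))).
  by apply: eq_int => x _; rewrite !cexp_polar -[2 * pi]add0r cisD2pi.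
move: H; rewrite /rect_int E0 -(E _ s0) -(E _ r0).
move: (int (ln r) _ _) (int 0 _ _) (int 0 _ _) => A B C; lra.
Qed.

(** The integral does not depend on the radius, which may therefore be shrunk until [f] is nearly
    constant. *)
Lemma mean_value f (r : R) : 0 < r -> (forall z, cabs z <= r -> holo f z) ->
  int 0 (2 * pi) (fun t => Re (f (r%:C * cis t))) = 2 * pi * Re (f 0).
Proof.
move=> r0 hf; have p0 : 0 <= 2 * pi :> R by rewrite mulr_ge0 // pi_ge0.
apply/eqP; rewrite -subr_eq0 -normr_le0; apply/ler_addgt0Pr => e e0; rewrite add0r.
have p1 : 0 < 2 * pi + 1 :> R by rewrite ltr_wpDl.
have h0 : holo f 0 by apply: hf; rewrite cabs0 ltW.
have /cvg_cabsP/(_ (e / (2 * pi + 1)) (divr_gt0 e0 p1))/nbhs_ballP[d] := holo_continuous h0.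
rewrite /= ltcE /= => /andP[/eqP id d0] hd.
pose s := Num.min r (complex.Re d / 2).
have s0 : 0 < s by rewrite lt_min r0 divr_gt0.
have sr : s <= r by rewrite ge_min lexx.
have hsr z : s <= cabs z <= r -> holo f z by move=> /andP[_]; exact: hf.
have E1 := @circle_int_const f s r s0 sr hsr.
rewrite E1.
have -> : 2 * pi * Re (f 0) = int 0 (2 * pi) (fun=> Re (f 0)) by rewrite int_cst // subr0 mulrC.
have cs : cont_on 0 (2 * pi) (fun t => Re (f (s%:C * cis t))).
  by apply: cont_on_cont; have [] := @circle_continuous _ f s (ltW s0) (fun z hz => hf z (eq_ind_r (fun x => x <= r) sr hz)).
rewrite -intB //; last exact: cont_on_cst.
apply: (le_trans (@int_abs_le _ _ _ _ (e / (2 * pi + 1)) p0 _ _)).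
- by apply: cont_onD => //; exact: cont_on_cst.
- move=> t _; rewrite -ReN -ReD (le_trans (cabs_Re _)) // cabs_distC; apply: hd.
  rewrite /ball /= sub0r normrN normc_cabs cabs_rcis ?(ltW s0) // ltcE /= id eqxx /=.
  by rewrite (@le_lt_trans _ _ (complex.Re d / 2)) // ?ge_min ?lexx ?orbT // ltr_pdivrMr // ltr_pMr // ltr1n.
- by rewrite subr0 mulrAC ler_pdivrMr // ler_pM2l // lerDl.
Qed.

End Polar.

Section PoissonFormula.
Context {R : realType}.
Implicit Types (z w : R[i]) (f g h q : R[i] -> R[i]) (t : R).
Local Notation Re := complex.Re.
Local Notation Im := complex.Im.

Lemma cont_const_left (m : R -> R) (c d k : R) : c < d -> (forall x, c < x < d -> m x = k) ->
  m x @[x --> c] --> m c -> m c = k.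
Proof.
move=> cd mk /cvgrPdist_le H; apply/eqP; rewrite -subr_eq0 -normr_le0.
apply/ler_addgt0Pr => e e0; rewrite add0r.
have /nbhs_ballP[r /= r0 hr] := H e e0.
pose x := c + Num.min (r / 2) ((d - c) / 2).
have m0 : 0 < Num.min (r / 2) ((d - c) / 2) by rewrite lt_min !divr_gt0 // subr_gt0.
have m1 : Num.min (r / 2) ((d - c) / 2) <= r / 2 by rewrite ge_min lexx.
have m2 : Num.min (r / 2) ((d - c) / 2) <= (d - c) / 2 by rewrite ge_min lexx orbT.
rewrite -(mk x); first by apply: hr; rewrite /ball /= distrC /x addrAC subrr add0r gtr0_norm //; lra.
by rewrite /x; apply/andP; split; lra.
Qed.

Lemma cont_const_right (m : R -> R) (c d k : R) : c < d -> (forall x, c < x < d -> m x = k) ->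
  m x @[x --> d] --> m d -> m d = k.
Proof.
move=> cd mk H.
have := @cont_const_left (fun x => m (- x)) (- d) (- c) k.
rewrite opprK; apply; first by rewrite ltrN2.
  by move=> x hx; apply: mk; lra.
have N : - x @[x --> - d] --> d by rewrite -[in X in _ --> X](opprK d); apply: cvgN; exact: cvg_id.
by exact: cvg_comp N H.
Qed.

Lemma circle_int_zero q z (s C : R) : 0 < s ->
  (forall w, cabs w < s -> (q v : R[i]^o) @[v --> (w : R[i]^o)] --> (q w : R[i]^o)) ->
  (forall w, cabs w < s -> w != z -> holo q w) ->
  (forall w, cabs w < s -> cabs (q w) <= C) ->
  forall r, 0 <= r < s -> int 0 (2 * pi) (fun t => Re (q (r%:C * cis t) * (r%:C * cis t))) = 0.
Proof.
move=> s0 cq hq qC.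
pose F (r t : R) := Re (q (r%:C * cis t) * (r%:C * cis t)).
have absr (r t : R) : cabs (r%:C * cis t) = `|r| by rewrite cabsM cabs_cis cabs_real mulr1.
have Fr (r t : R) : - s < r < s -> F x t @[x --> r] --> F r t.
  move=> hr; suff /cvg_complexP[] : (q (x%:C * cis t) * (x%:C * cis t) : R[i]^o) @[x --> r]
      --> ((q (r%:C * cis t) * (r%:C * cis t) : R[i]) : R[i]^o) by [].
  apply: cvgM; last exact: cvg_radius.
  apply: (cvg_comp _ _ (@cvg_radius R r t)).
  by apply: cq; rewrite absr ltr_norml.
have Ft (r : R) : - s < r < s -> continuous (F r).
  move=> hr t; suff /cvg_complexP[] : (q (r%:C * cis x) * (r%:C * cis x) : R[i]^o) @[x --> t]
      --> ((q (r%:C * cis t) * (r%:C * cis t) : R[i]) : R[i]^o) by [].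
  apply: cvgM; last exact: cvg_rcis.
  apply: (cvg_comp _ _ (@cvg_rcis R r t)).
  by apply: cq; rewrite absr ltr_norml.
pose m r := int 0 (2 * pi) (F r).
have cm r : - s < r < s -> m x @[x --> r] --> m r.
  move=> hr.
  have K := @continuity_under_integral R _ _ (@lebesgue_measure R) F `[0, 2 * pi]%classic
     ltac:(exact: measurable_itv) (- s) s _ _ (fun=> C * s) _ _ r.
  apply: K.
  - by move=> x; rewrite /= in_itv /= => hx; apply: cont_on_int; apply: cont_on_cont; exact: Ft.
  - by apply: aeW => t _ x; rewrite inE /= in_itv /=; exact: Fr.
  - by apply: cont_on_int; exact: cont_on_cst.
  - move=> x; rewrite /= in_itv /= => hx; apply: aeW => t _.
    rewrite (le_trans (cabs_Re _)) // cabsM absr ler_pM ?cabs_ge0 //.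
      by apply: qC; rewrite absr ltr_norml.
    by rewrite ltW // ltr_norml.
  - by rewrite inE /= in_itv.
have m0 : m 0 = 0.
  rewrite /m -[RHS](mul0r (2 * pi - 0)) -int_cst ?mulr_ge0 ?pi_ge0 //.
  by apply: eq_int => t _; rewrite /F mul0r mulr0.
have mc a b : 0 < a -> a <= b -> b < s -> ~ (a <= cabs z <= b) -> m b = m a.
  move=> a0 ab bs nz.
  apply: (@circle_int_const R (fun w => q w * w) a b) => // w /andP[h1 h2].
  apply: holoM; last exact: holo_id.
  apply: hq; first exact: le_lt_trans bs.
  by apply/eqP => wz; apply: nz; rewrite -wz h1.
have lt0 x : 0 <= x < s -> - s < x < s by move=> /andP[h1 ->]; rewrite andbT (lt_le_trans _ h1) // oppr_lt0.
have small x : 0 < x -> x < cabs z -> x < s -> m x = 0.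
  move=> x0 xz xs; rewrite -m0; symmetry; apply: (@cont_const_left m 0 x) => //.
    move=> y /andP[y0 yx]; symmetry; apply: mc => //; first exact: ltW.
    by move=> /andP[_]; rewrite leNgt xz.
  by apply: cm; apply: lt0; rewrite lexx.
move=> r /andP[r0 rs]; rewrite -/(m r).
move: r0; rewrite le_eqVlt => /predU1P[<-//|r0].
have [rz|zr|rz] := ltgtP r (cabs z); first exact: small.
- have mz : m (cabs z) = 0.
    have := cabs_ge0 z; rewrite le_eqVlt => /predU1P[<-//|z0].
    apply: (@cont_const_right m 0 (cabs z)) => //.
      by move=> x /andP[x0 xz]; apply: small => //; exact: lt_trans (lt_trans xz zr) rs.
    by apply: cm; apply: lt0; rewrite cabs_ge0 (lt_trans zr).
  rewrite -mz; symmetry; apply: (@cont_const_left m (cabs z) r) => //.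
    move=> x /andP[zx xr]; symmetry; apply: mc => //; [exact: le_lt_trans (cabs_ge0 z) zx|exact: ltW|].
    by move=> /andP[]; rewrite leNgt zx.
  by apply: cm; apply: lt0; rewrite cabs_ge0 (lt_trans zr).
- apply: (@cont_const_right m 0 r) => //.
    by move=> x /andP[x0 xr]; apply: small; [|rewrite -rz|exact: lt_trans rs].
  by apply: cm; apply: lt0; rewrite ltW.
Qed.

Definition poisson z t : R := (1 - cabs z ^+ 2) / cabs (cis t - z) ^+ 2.

Lemma cis_sub_gt z t : cabs z < 1 -> 1 - cabs z <= cabs (cis t - z).
Proof. by move=> z1; have := cabsD (cis t - z) z; rewrite subrK cabs_cis; lra. Qed.

Lemma cis_sub_neq0 z t : cabs z < 1 -> cis t - z != 0.
Proof. by move=> z1; rewrite -cabs_gt0 (lt_le_trans _ (cis_sub_gt t z1)) // subr_gt0. Qed.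

Lemma poisson_gt0 z t : cabs z < 1 -> 0 < poisson z t.
Proof.
move=> z1; rewrite divr_gt0 ?exprn_gt0 ?cabs_gt0 ?cis_sub_neq0 // subr_gt0.
by rewrite expr_lt1 // cabs_ge0.
Qed.

Lemma poissonE z t : cabs z < 1 -> (poisson z t)%:C =
  cis t / (cis t - z) * ((1 - cabs z ^+ 2)%:C / (1 - z^* * cis t)).
Proof.
move=> z1; have n0 := cis_sub_neq0 t z1.
have E : (cabs (cis t - z) ^+ 2)%:C = (cis t - z) * ((cis t)^-1 - z^*).
  by rewrite -mul_conj rmorphB /= conj_cis.
have n1 : (cis t)^-1 - z^* != 0 by rewrite -conj_cis -rmorphB conjc_eq0.
have -> : 1 - z^* * cis t = cis t * ((cis t)^-1 - z^*) by rewrite mulrBr divff ?cis_neq0 // mulrC.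
rewrite /poisson rmorphM fmorphV /= E.
by move: (_^-1 - _) n1 => v n1; field; rewrite cis_neq0 n0 n1.
Qed.

(* On the circle the Poisson kernel is [w / (w - z) * u w] with [u] holomorphic and [u z = 1].  The integral
   of the difference quotient of [f * u] at z over circles about 0 is independent of the radius on both
   sides of [cabs z], is continuous in the radius, and tends to 0 with it. *)
Lemma poisson_formula f (s M : R) z : 1 < s -> (forall w, cabs w < s -> holo f w) ->
  (forall w, cabs w < s -> cabs (f w) <= M) -> cabs z < 1 ->
  int 0 (2 * pi) (fun t => Re (f (cis t)) * poisson z t) = 2 * pi * Re (f z).
Proof.
move=> s1 hf fM z1; have z0 := cabs_ge0 z.
have M0 : 0 <= M by rewrite (le_trans (cabs_ge0 (f 0))) // fM // cabs0 (lt_trans ltr01).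
(* The second bound gives [cabs z * s' < 1], which keeps the pole 1 / z^* of [u] outside the disk of
   radius [s']. *)
pose s' := Num.min s (2 / (1 + cabs z)).
have s'1 : 1 < s' by rewrite lt_min s1 ltr_pdivlMr; lra.
have s's : s' <= s by rewrite ge_min lexx.
have s'z : cabs z * s' < 1.
  apply: (@le_lt_trans _ _ (cabs z * (2 / (1 + cabs z)))); first by rewrite ler_wpM2l // ge_min lexx orbT.
  by rewrite mulrA ltr_pdivrMr; lra.
pose k := 1 - cabs z * s'; have k0 : 0 < k by rewrite subr_gt0.
have den w : cabs w < s' -> k <= cabs (1 - z^* * w).
  move=> ws; have := cabsD (1 - z^* * w) (z^* * w); rewrite subrK cabs1 cabsM cabs_conj.
  have : cabs z * cabs w <= cabs z * s' by rewrite ler_wpM2l // ltW.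
  by rewrite /k; lra.
have den0 w : cabs w < s' -> 1 - z^* * w != 0.
  by move=> /den h; rewrite -cabs_gt0 (lt_le_trans k0).
pose u w := (1 - cabs z ^+ 2)%:C / (1 - z^* * w).
have hu w : cabs w < s' -> holo u w.
  move=> ws; apply: holoM; first exact: holo_cst.
  apply: holoV; first exact: den0.
  by apply: holoB; [exact: holo_cst|apply: holoM; [exact: holo_cst|exact: holo_id]].
pose h w := f w * u w.
have hh w : cabs w < s' -> holo h w.
  by move=> ws; apply: holoM; [apply: hf; exact: lt_le_trans s's|exact: hu].
pose N := M * ((1 + cabs z ^+ 2) / k).
have N0 : 0 <= N by rewrite mulr_ge0 // divr_ge0 ?(ltW k0) // addr_ge0 // sqr_ge0.
have hN w : cabs w < s' -> cabs (h w) <= N.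
  move=> ws; rewrite cabsM ler_pM ?cabs_ge0 //; first by apply: fM; exact: lt_le_trans s's.
  rewrite cabsM cabsV cabs_real ler_pM ?normr_ge0 ?invr_ge0 ?cabs_ge0 //.
    by rewrite (le_trans (ler_normB _ _)) // normr1 ger0_norm ?sqr_ge0.
  by rewrite lef_pV2 ?posrE ?den // (lt_le_trans k0) // den.
have zs : cabs z < s' := lt_trans z1 s'1.
pose q w := if w == z then cderiv h z else (h w - h z) / (w - z).
have qz : q z = cderiv h z by rewrite /q eqxx.
have hq w : cabs w < s' -> w != z -> holo q w.
  move=> ws wz; apply: (@near_holo _ (fun v => (h v - h z) / (v - z)) _ _ (cabs (w - z))).
  - by rewrite cabs_gt0 subr_eq0.
  - by move=> v vw; rewrite /q; case: eqP vw => // ->; rewrite cabs_distC ltxx.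
  - apply: holoM; first by apply: holoB; [exact: hh|exact: holo_cst].
    by apply: holoV; [rewrite subr_eq0|apply: holoB; [exact: holo_id|exact: holo_cst]].
have dz e : 0 < e -> exists2 d, 0 < d & forall w, cabs (w - z) < d -> cabs (q w - q z) <= e.
  move=> e0; have [d d0 hd] := holo_cder (hh z zs) e0; exists d => // w /hd.
  rewrite qz /q; case: eqP => [-> _|/eqP wz]; first by rewrite subrr cabs0 ltW.
  have wz0 : 0 < cabs (w - z) by rewrite cabs_gt0 subr_eq0.
  by move=> hw; rewrite -(ler_pM2r wz0) -cabsM mulrBl divfK ?subr_eq0.
have cq w : cabs w < s' -> (q v : R[i]^o) @[v --> (w : R[i]^o)] --> (q w : R[i]^o).
  move=> ws; have [->|wz] := eqVneq w z; last by apply: holo_continuous; exact: hq.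
  apply/(@cvg_cabsP _ _ _ (nbhs_filter (z : R[i]^o))) => e /dz[d d0 hd].
  apply/nbhs_ballP; exists d%:C; first by rewrite /= (ltcR 0).
  by move=> v; rewrite /ball /= normc_cabs ltcR (cabs_distC z v) (cabs_distC (q z)) => /hd.
have [d d0 hd] := dz 1 ltr01.
have qC w : cabs w < s' -> cabs (q w) <= (1 + cabs (q z)) + 2 * N / d.
  move=> ws; have [wd|wd] := ltP (cabs (w - z)) d.
    have := cabsD (q w - q z) (q z); rewrite subrK => /le_trans; apply.
    have N2 : 0 <= 2 * N / d by apply: divr_ge0; [apply: mulr_ge0|apply: ltW].
    by have := hd w wd; lra.
  have wz : w != z by apply: contraTneq wd => ->; rewrite subrr cabs0 -ltNge.
  rewrite /q (negbTE wz) cabsM cabsV -[leLHS]add0r lerD // ?addr_ge0 ?cabs_ge0 //.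
  rewrite ler_pM ?invr_ge0 ?cabs_ge0 // ?lef_pV2 ?posrE ?(lt_le_trans d0 wd) //.
  by rewrite (le_trans (cabsB _ _)) // (_ : 2 * N = N + N) ?lerD ?hN //; lra.
have Z := @circle_int_zero q z s' _ (lt_trans ltr01 s'1) cq hq qC 1.
rewrite ler01 s'1 in Z; have {}Z := Z isT.
have cis_s t : cabs (cis t) < s' by rewrite cabs_cis.
(* The subtracted term [h z * w / (w - z)] has a pole in the disk, but on the circle it is the
   conjugate of [(h z)^* / (1 - z^* * w)], which has none there; the real part of the latter is
   integrated by [mean_value]. *)
have E t : Re (q (1%:C * cis t) * (1%:C * cis t)) =
    Re (f (cis t)) * poisson z t - Re ((h z)^* / (1 - z^* * (1%:C * cis t))).
  have n0 := cis_sub_neq0 t z1.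
  have wz : cis t != z by rewrite -subr_eq0.
  rewrite mul1r /q (negbTE wz) -ReMr (poissonE t z1).
  have -> : (h z)^* / (1 - z^* * cis t) = (h z * (cis t / (cis t - z)))^*.
    have -> : (h z * (cis t / (cis t - z)))^* = (h z)^* * (cis t / (cis t - z))^* by exact: rmorphM.
    congr (_ * _).
    have -> : (cis t / (cis t - z))^* = (cis t)^* / (cis t - z)^* by rewrite -fmorphV -rmorphM.
    have -> : (cis t - z)^* = (cis t)^* - z^* by exact: rmorphB.
    by rewrite conj_cis -invfM mulrBr divff ?cis_neq0 // mulrC.
  have -> (v : R[i]) : Re v^* = Re v by case: v.
  rewrite -ReN -ReD; congr complex.Re; rewrite /h -/(u (cis t)); field.
  by rewrite n0.
have cf : cont_on 0 (2 * pi) (fun t => Re (f (cis t)) * poisson z t).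
  apply: cont_on_cont.
  have -> : (fun t => Re (f (cis t)) * poisson z t) = (fun t => Re ((fun w => h w * w / (w - z)) (1%:C * cis t))).
    apply/funext => t; rewrite mul1r -ReMr (poissonE t z1); congr complex.Re.
    by rewrite /h /u; ring.
  have [] // := @circle_continuous _ (fun w => h w * w / (w - z)) 1 ler01 _.
  move=> w w1; apply: holoM.
    by apply: holoM; [apply: hh; rewrite w1|exact: holo_id].
  apply: holoV; first by apply: contraTneq z1 => /eqP; rewrite subr_eq0 => /eqP <-; rewrite w1 ltxx.
  by apply: holoB; [exact: holo_id|exact: holo_cst].
pose g w := (h z)^* / (1 - z^* * w).
have hg w : cabs w <= 1 -> holo g w.
  move=> w1; apply: holoM; first exact: holo_cst.
  apply: holoV; first by apply: den0; exact: le_lt_trans w1 s'1.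
  by apply: holoB; [exact: holo_cst|apply: holoM; [exact: holo_cst|exact: holo_id]].
have cg : cont_on 0 (2 * pi) (fun t => Re (g (1%:C * cis t))).
  apply: cont_on_cont; have [] // := @circle_continuous _ g 1 ler01 _.
  by move=> w w1; apply: hg; rewrite w1.
have := Z; rewrite (eq_int (fun t _ => E t)) intB // => /eqP; rewrite subr_eq0 => /eqP ->.
rewrite (@mean_value R g 1) // /g mulr0 subr0 divr1.
congr (_ * _); rewrite /h /u.
have -> : 1 - z^* * z = (1 - cabs z ^+ 2)%:C by rewrite mulrC mul_conj rmorphB.
rewrite divff ?mulr1; first by case: (f z).
by rewrite -cabs_gt0 cabs_real normr_gt0 gt_eqF // subr_gt0 expr_lt1.
Qed.

Lemma poisson_int z : cabs z < 1 -> int 0 (2 * pi) (poisson z) = 2 * pi.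
Proof.
move=> z1; have P := @poisson_formula (fun=> 1) 2 1 z.
rewrite -[RHS]mulr1; apply: etrans (P _ _ _ z1); first by apply: eq_int => t _; rewrite mul1r.
- by rewrite ltr1n.
- by move=> w _; exact: holo_cst.
- by move=> w _; rewrite cabs1.
Qed.

Lemma poisson_formula_disk f (M r : R) z : analytic_disk f ->
  (forall w, disk w -> cabs (f w) <= M) -> 0 < r < 1 -> cabs z < 1 ->
  int 0 (2 * pi) (fun t => Re (f (r%:C * cis t)) * poisson z t) = 2 * pi * Re (f (r%:C * z)).
Proof.
move=> af fM /andP[r0 r1] z1.
have lt1 w : cabs w < r^-1 -> cabs (r%:C * w) < 1.
  by move=> h; rewrite cabsM cabs_real gtr0_norm // -ltr_pdivlMl // mulr1.
apply: (@poisson_formula (fun w => f (r%:C * w)) r^-1 M) => //; first by rewrite invf_gt1.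
  move=> w /lt1 h; apply: holo_comp; first by apply: holoM; [exact: holo_cst|exact: holo_id].
  exact: analytic_holo.
by move=> w /lt1/diskE; exact: fM.
Qed.

Lemma poisson_continuous z : cabs z < 1 -> continuous (poisson z).
Proof.
move=> z1 t; apply: cvgM; first exact: cvg_cst.
apply: cvgV; first by rewrite sqrf_eq0 cabs_eq0 cis_sub_neq0.
have c : cabs (cis s - z) @[s --> t] --> cabs (cis t - z).
  have hz w : cabs w = 1 -> holo (fun w => w - z) w by move=> _; apply: holoB; [exact: holo_id|exact: holo_cst].
  have [_ [_ c]] := circle_continuous ler01 hz.
  suff : {for t, continuous (fun s => cabs (cis s - z))} by [].
  have -> : (fun s => cabs (cis s - z)) = (fun s => cabs (1%:C * cis s - z)) by apply/funext => s; rewrite mul1r.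
  exact: c.
by rewrite expr2; apply: cvgM.
Qed.

Lemma poisson_le z t : cabs z < 1 -> poisson z t <= (1 + cabs z) / (1 - cabs z).
Proof.
move=> z1; have k0 : 0 < 1 - cabs z by rewrite subr_gt0.
have h := cis_sub_gt t z1; have c0 : 0 < cabs (cis t - z) := lt_le_trans k0 h.
rewrite /poisson ler_pdivrMr ?exprn_gt0 //.
have -> : 1 - cabs z ^+ 2 = (1 + cabs z) / (1 - cabs z) * (1 - cabs z) ^+ 2 by field; rewrite gt_eqF.
apply: ler_wpM2l; first by rewrite divr_ge0 ?(ltW k0) // addr_ge0 ?cabs_ge0.
by rewrite lerXn2r // nnegrE ltW.
Qed.

Lemma poisson_ge z t : cabs z < 1 -> (1 - cabs z) / (1 + cabs z) <= poisson z t.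
Proof.
move=> z1; have k0 : 0 < 1 + cabs z by rewrite ltr_wpDr ?cabs_ge0.
have h : cabs (cis t - z) <= 1 + cabs z by have := cabsB (cis t) z; rewrite cabs_cis.
have c0 : 0 < cabs (cis t - z) by rewrite cabs_gt0 cis_sub_neq0.
rewrite /poisson ler_pdivlMr ?exprn_gt0 //.
have -> : 1 - cabs z ^+ 2 = (1 - cabs z) / (1 + cabs z) * (1 + cabs z) ^+ 2 by field; rewrite gt_eqF.
apply: ler_wpM2l; first by rewrite divr_ge0 ?(ltW k0) // subr_ge0 ltW.
by rewrite lerXn2r // nnegrE ltW.
Qed.

End PoissonFormula.

(** * Radial limits of bounded functions *)

Section Lipschitz.
Context {R : realType}.
Local Notation mu := (@lebesgue_measure R).

(** Both measures are infima over the same interval covers, and each cover has Stieltjes length at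
    most [K] times its Lebesgue length. *)
Lemma lebesgue_stieltjes_le (g : cumulative R R) (K : R) : 0 <= K ->
  (forall x y, x <= y -> g y - g x <= K * (y - x)) ->
  forall A, (mu A = 0 -> lebesgue_stieltjes_measure g A = 0)%E.
Proof.
move=> K0 gK A A0; apply/eqP; rewrite eq_le; apply/andP; split; last exact: mu_ext_ge0.
apply/lee_addgt0Pr => e e0; rewrite add0e.
have e1 : 0 < e / (K + 1) by rewrite divr_gt0 // ltr_wpDl.
have E (f : cumulative R R) : lebesgue_stieltjes_measure f A =
  ereal_inf [set (\sum_(k <oo) wlength f (F k))%E | F in measurable_cover (A : set (ocitv_type R))] by [].
have [|x [F [mF AF] <-{x}]] := @lb_ereal_inf_adherent R
  [set (\sum_(k <oo) wlength idfun (F k))%E | F in measurable_cover (A : set (ocitv_type R))] _ e1.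
  by rewrite -(E idfun) -/(mu A) A0.
rewrite -(E idfun) -/(mu A) A0 add0e => Fe.
apply: (@le_trans _ _ (\sum_(k <oo) wlength g (F k))%E).
  by rewrite E; apply: ereal_inf_lbound; exists F.
apply: (@le_trans _ _ (\sum_(k <oo) (K%:E * wlength idfun (F k)))%E).
  apply: lee_nneseries => [n _ _|n _]; first exact: wlength_ge0.
  have [[a b] _ <-] := mF n.
  have [ab|ba] := leP a b; last by rewrite set_itv_ge ?wlength0 ?mule0 // bnd_simp -leNgt ltW.
  by rewrite !wlength_itv_bnd // -EFinM lee_fin gK.
rewrite nneseriesZl; last by move=> n _; exact: wlength_ge0.
apply: (@le_trans _ _ (K%:E * (e / (K + 1))%:E)%E); first by rewrite lee_wpmul2l // ?lee_fin // ltW.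
by rewrite -EFinM lee_fin mulrA ler_pdivrMr ?ltr_wpDl // mulrC ler_pM2l // lerDl.
Qed.

(** Adding [M * x] makes [V] nondecreasing, so that it defines a Stieltjes measure. The sum is still
    Lipschitz, with constant [2 * M]; hence the measure is absolutely continuous and Radon-Nikodym
    yields the density. *)
Lemma lipschitz_density (V : R -> R) (M L : R) : 0 <= L -> (forall x y, `|V x - V y| <= M * `|x - y|) ->
  exists h : R -> R, mu.-integrable setT (EFin \o h) /\
    forall x, 0 <= x <= L -> V x + M * x - V 0 = \int[mu]_(t in `]0, x]) h t.
Proof.
move=> L0 VM.
have M0 : 0 <= M by have := VM 1 0; rewrite subr0 normr1 mulr1; exact: le_trans.
pose gf x := V x + M * x.
have gnd : nondecreasing gf.
  move=> x y xy; have := VM y x; rewrite /gf (@ger0_norm _ (y - x)) ?subr_ge0 // ler_norml => /andP[h1 h2]; lra.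
have VC : continuous V.
  move=> x; apply/cvgrPdist_le => /= e e0.
  have e1 : 0 < e / (M + 1) by rewrite divr_gt0 // ltr_wpDl.
  apply/nbhs_ballP; exists (e / (M + 1)) => // y; rewrite /ball /= => xy.
  rewrite (le_trans (VM x y)) // (@le_trans _ _ ((M + 1) * `|x - y|)) //; first by rewrite ler_wpM2r // lerDl.
  by rewrite -ler_pdivlMl ?ltr_wpDl // mulrC ltW.
have grc : right_continuous gf.
  apply: right_continuousW => x; apply: cvgD; first exact: VC.
  by apply: cvgM; [exact: cvg_cst|exact: cvg_id].
pose G : cumulative R R := HB.pack gf (isCumulative.Build R _ R gf gnd grc).
have GE x y : x <= y -> G y - G x <= (2 * M) * (y - x).
  move=> xy; have := VM y x; rewrite /= /gf (@ger0_norm _ (y - x)) ?subr_ge0 // ler_norml => /andP[h1 h2]; lra.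
pose nu := lebesgue_stieltjes_measure G.
have nuI x y : x <= y -> nu `]x, y]%classic = (gf y - gf x)%:E.
  move=> xy; rewrite /nu /lebesgue_stieltjes_measure /measure_extension measurable_mu_extE /=.
    exact: (wlength_itv_bnd gf false false xy).
  exact: is_ocitv.
have mD : measurable (`]0, L]%classic : set (measurableTypeR R)) by exact: measurable_itv.
have nuD : (nu `]0%R, L]%classic < +oo)%E by rewrite nuI // ltry.
have dom : mfrestr mD nuD `<< mu.
  apply/null_content_dominatesP => A mA A0.
  apply: (@lebesgue_stieltjes_le G (2 * M)) => //; first by rewrite mulr_ge0.
  by apply/eqP; rewrite eq_le measure_ge0 andbT -A0 le_measure ?inE //; exact: measurableI.
have [h [h0 hfin hint hE]] := radon_nikodym_sigma_finite dom.
exists (fine \o h); split; first by apply: eq_integrable hint => // x _; rewrite /= fineK.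
move=> x /andP[x0 xL].
have hI : nu `]0, x]%classic = (\int[mu]_(t in `]0%R, x]) h t)%E.
  rewrite -hE; last exact: measurable_itv.
  rewrite /mfrestr /mrestr; congr (lebesgue_stieltjes_measure G _).
  rewrite setIidl // => y /=; rewrite !in_itv /= => /andP[-> yx]; exact: le_trans yx xL.
rewrite nuI // in hI; rewrite /Rintegral (_ : (\int[mu]_(t in `]0%R, x]) ((fine \o h) t)%:E)%E = (gf x - gf 0)%:E).
  by rewrite /= /gf mulr0 addr0.
by rewrite hI; apply: eq_integral => t _; rewrite /= fineK.
Qed.

Lemma lipschitz_derivable_ae (V : R -> R) (M L : R) :
  0 <= L -> (forall x y, `|V x - V y| <= M * `|x - y|) ->
  {ae mu, forall x, 0 < x < L -> derivable V x 1}.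
Proof.
move=> L0 VM; have [h [ih hV]] := lipschitz_density L0 VM.
have lh : locally_integrable [set: R] h.
  by have := integrable_locally measurableT ih; rewrite patch_setT.
have ih' y : mu.-integrable [set` Interval (BRight 0) (BRight y)] (EFin \o h).
  by apply: integrableS ih.
have := FTC1 ih' lh; apply: filterS; first exact: (ae_filter_ringOfSetsType mu).
move=> x /= H /andP[x0 xL].
have [|dF _] := H; first by rewrite lte_fin.
have dG : derivable (fun x : R => (\int[mu]_(t in `]0, x]) h t) + V 0 - M * x) x 1.
  apply: derivableB; first by apply: derivableD; [exact: dF|exact: derivable_cst].
  by apply: derivableM; [exact: derivable_cst|exact: derivable_id].
apply: near_eq_derivable dG; near=> y.
rewrite -hV ?subrK ?addrK //; apply/andP; split; apply/ltW; near: y; [exact: lt_nbhsr|exact: lt_nbhsl].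
Unshelve. all: by end_near. Qed.

End Lipschitz.

(** * Approximate identities and the Poisson kernel *)

Section Kernel.
Context {R : realType}.

Lemma left_nearP (P : R -> Prop) : (\forall r \near (1 : R)^'-, P r) <->
  exists2 d : R, 0 < d & forall r, 1 - d < r -> r < 1 -> P r.
Proof.
split=> [/nbhs_ballP[d /= d0 hd]|[d d0 hd]].
  exists d => // r r1 r2; apply: hd => //.
  by rewrite /ball /= gtr0_norm ?subr_gt0 //; lra.
apply/nbhs_ballP; exists d => //= r; rewrite /ball /= ltr_norml => /andP[h1 h2] h3.
by apply: hd => //; lra.
Qed.

Lemma cvg_leftP (f : R -> R) l : f r @[r --> (1 : R)^'-] --> l <->
  forall e, 0 < e -> exists2 d : R, 0 < d & forall r, 1 - d < r -> r < 1 -> `|l - f r| <= e.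
Proof.
split=> [/cvgrPdist_le H e e0|H].
  by apply/left_nearP; exact: H.
by apply/cvgrPdist_le => e e0; apply/left_nearP; exact: H.
Qed.

(** Positivity is asked only near [th]: besides the Poisson kernel P itself, this serves -(t - th)
    P'(t - th) / (2 pi), which becomes negative where |t - th| exceeds pi. *)
Lemma kernel_cvg (K : R -> R -> R) (v : R -> R) (a b th d0 : R) : a <= b -> 0 < d0 -> a <= th <= b ->
  (forall r, 0 < r -> r < 1 -> cont_on a b (K r)) ->
  (forall d e, 0 < d -> 0 < e -> \forall r \near (1 : R)^'-, forall t, a <= t <= b -> d <= `|t - th| -> `|K r t| <= e) ->
  (forall r t, 0 < r -> r < 1 -> a <= t <= b -> `|t - th| < d0 -> 0 <= K r t) ->
  int a b (K r) @[r --> (1 : R)^'-] --> (1 : R) ->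
  cont_on a b v ->
  int a b (fun t => K r t * v t) @[r --> (1 : R)^'-] --> v th.
Proof.
move=> ab d00 thab cK far nn /cvg_leftP iK cv; apply/cvg_leftP => e e0.
have [B0 [B0r hB0]] : \forall B \near +oo, forall t, a <= t <= b -> `|v t| <= B.
  have /compact_bounded : compact (v @` `[a, b]) by apply: continuous_compact => //; exact: segment_compact.
  move=> [B [Br hB]]; exists B; split => // x /hB H t tab; apply: H; exists t => //=.
pose B := Num.max 0 B0 + 1.
have B1 : 0 < B by rewrite ltr_wpDl // le_max lexx.
have vB t : a <= t <= b -> `|v t| <= B by apply: hB0; rewrite /B ltr_pwDr // le_max lexx orbT.
have [d1 d10 hd1] := cont_on_eps cv thab (divr_gt0 e0 (ltr0n R 8)).
pose d := Num.min d0 d1.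
have dp : 0 < d by rewrite lt_min d00.
pose w := b - a + 1; have w0 : 0 < w by rewrite /w; lra.
pose e2 := Num.min 1 (e / (4 * (2 * B + e) * w)).
have e20 : 0 < e2 by rewrite lt_min ltr01 divr_gt0 // !mulr_gt0 // addr_gt0 // mulr_gt0.
have e2w : (2 * B + e) * e2 * w <= e / 4.
  have : e2 <= e / (4 * (2 * B + e) * w) by rewrite ge_min lexx orbT.
  rewrite ler_pdivlMr; last by rewrite !mulr_gt0 // addr_gt0 // mulr_gt0.
  move=> h; rewrite ler_pdivlMr //; apply: le_trans h; rewrite le_eqVlt; apply/orP; left; apply/eqP; ring.
have /left_nearP[s1 s10 hs1] := far d e2 dp e20.
pose eta := Num.min 1 (e / (4 * B)).
have eta0 : 0 < eta by rewrite lt_min ltr01 divr_gt0 // mulr_gt0.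
have eta1 : eta <= 1 by rewrite ge_min lexx.
have etaB : B * eta <= e / 4.
  have : eta <= e / (4 * B) by rewrite ge_min lexx orbT.
  rewrite ler_pdivlMr ?mulr_gt0 // => h; rewrite ler_pdivlMr //; apply: le_trans h.
  rewrite le_eqVlt; apply/orP; left; apply/eqP; ring.
have [s2 s20 hs2] := iK eta eta0.
exists (Num.min 1 (Num.min s1 s2)); first by rewrite !lt_min ltr01 s10 s20.
move=> r rs r1.
have m1 : Num.min 1 (Num.min s1 s2) <= 1 by rewrite ge_min lexx.
have m2 : Num.min 1 (Num.min s1 s2) <= s1 by rewrite !ge_min lexx !orbT.
have m3 : Num.min 1 (Num.min s1 s2) <= s2 by rewrite !ge_min lexx !orbT.
have [r0 rs1 rs2] : [/\ 0 < r, 1 - s1 < r & 1 - s2 < r].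
  by clear - rs m1 m2 m3; split; lra.
have cKr := cK r r0 r1; have h2 := hs2 r rs2 r1.
have cKv : cont_on a b (fun t => K r t * v t) by apply: cont_onM.
have cKc : cont_on a b (fun t => v th * K r t) by apply: cont_onM => //; exact: cont_on_cst.
have -> : v th - int a b (fun t => K r t * v t) =
    v th * (1 - int a b (K r)) - int a b (fun t => K r t * v t - v th * K r t).
  by rewrite intB // intZ //; ring.
have c1 : cont_on a b (fun t => e / 8 * K r t + (2 * B + e) * e2).
  by apply: cont_onD; [apply: cont_onM => //|]; exact: cont_on_cst.
have c2 : cont_on a b (fun t => K r t * v t - v th * K r t) by apply: cont_onD => //; exact: cont_onN.
have Be : 0 <= (2 * B + e) * e2 by rewrite mulr_ge0 ?addr_ge0 ?mulr_ge0 // ltW.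
(* One bound for both regions: near [th] the oscillation of [v] gives [e / 8 * K r t]; away from it
   [K r t] may be as low as [- e2], which the summand [e * e2] makes up for. *)
have pt t : a <= t <= b -> `|K r t * v t - v th * K r t| <= e / 8 * K r t + (2 * B + e) * e2.
  move=> tab; rewrite (mulrC (v th)) -mulrBr normrM.
  have [td|td] := ltP `|t - th| d.
    have K0 : 0 <= K r t by apply: nn => //; rewrite (lt_le_trans td) // ge_min lexx.
    rewrite ger0_norm // mulrC.
    have hv : `|v t - v th| <= e / 8 by apply: hd1 => //; rewrite (lt_le_trans td) // ge_min lexx orbT.
    by have := ler_wpM2r K0 hv; lra.
  have Ke : `|K r t| <= e2 by apply: hs1.
  have vv : `|v t - v th| <= 2 * B.
    by rewrite (le_trans (ler_normB _ _)) // (le_trans (lerD (vB t tab) (vB th thab))) //; lra.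
  have p1 : `|K r t| * `|v t - v th| <= e2 * (2 * B) by rewrite ler_pM.
  move: Ke; rewrite ler_norml => /andP[Ke _].
  have p2 : e / 8 * - e2 <= e / 8 * K r t by rewrite ler_pM2l // divr_gt0.
  have p3 : 0 < e * e2 by rewrite mulr_gt0.
  by lra.
have I1 : `|int a b (fun t => K r t * v t - v th * K r t)| <= e / 8 * int a b (K r) + (2 * B + e) * e2 * (b - a).
  rewrite -[X in _ + X]int_cst // -intZ // -intD; [|apply: cont_onM => //; exact: cont_on_cst|exact: cont_on_cst].
  rewrite ler_norml; apply/andP; split.
    rewrite -intN //; apply: le_int => //; first exact: cont_onN.
    by move=> t /pt; rewrite ler_norml => /andP[].
  by apply: le_int => // t /pt; rewrite ler_norml => /andP[].
have I2 : `|v th * (1 - int a b (K r))| <= e / 4.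
  by rewrite normrM (le_trans _ etaB) // ler_pM // vB.
have I3 : (2 * B + e) * e2 * (b - a) <= e / 4.
  by apply: le_trans e2w; apply: ler_wpM2l => //; rewrite /w lerDl.
have I4 : e / 8 * int a b (K r) <= e / 4.
  have : int a b (K r) <= 2 by move: h2; rewrite ler_norml => /andP[]; lra.
  have e8 : 0 < e / 8 by rewrite divr_gt0.
  by move=> /(ler_wpM2l (ltW e8)); lra.
by rewrite (le_trans (ler_normB _ _)) // (le_trans (lerD I2 I1)) //; lra.
Qed.

Definition pois (r s : R) : R := (1 - r ^+ 2) / (1 + r ^+ 2 - 2 * r * cos s).
Definition dpois (r s : R) : R := - ((1 - r ^+ 2) * (2 * r * sin s) / (1 + r ^+ 2 - 2 * r * cos s) ^+ 2).

Lemma pois_den_gt (r s : R) : 0 <= r -> (1 - r) ^+ 2 <= 1 + r ^+ 2 - 2 * r * cos s.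
Proof.
move=> r0; have : r * cos s <= r * 1 by rewrite ler_wpM2l // cos_le1.
lra.
Qed.

Lemma pois_den_gt0 (r s : R) : 0 <= r < 1 -> 0 < 1 + r ^+ 2 - 2 * r * cos s.
Proof.
by move=> /andP[r0 r1]; rewrite (lt_le_trans _ (pois_den_gt s r0)) // exprn_gt0 // subr_gt0.
Qed.

Lemma poisson_pois (r th t : R) : 0 <= r -> poisson (r%:C * cis th) t = pois r (t - th).
Proof.
move=> r0; rewrite /poisson /pois cabs_rcis // cabs_sqr; congr (_ / _).
rewrite ReD ImD ReN ImN ReM ImM /= !mul0r subr0 addr0 cosB.
have := cos2Dsin2 t; have := cos2Dsin2 th; nra.
Qed.

Lemma is_derive_pois (r th t : R) : 0 <= r < 1 ->
  is_derive t 1 (fun t => pois r (t - th)) (dpois r (t - th)).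
Proof.
move=> r1; have D0 := pois_den_gt0 (t - th) r1.
have d1 : is_derive t 1 (fun t => 1 + r ^+ 2 - 2 * r * cos (t - th)) (2 * r * sin (t - th)).
  by apply: is_derive_eq; rewrite /GRing.scale /=; ring.
have d2 := @is_deriveV R (fun t => 1 + r ^+ 2 - 2 * r * cos (t - th)) t _ 1 (lt0r_neq0 D0) d1.
have d3 := @is_deriveM _ _ (cst (1 - r ^+ 2)) _ _ _ _ _ (is_derive_cst _ _ _) d2.
apply: is_derive_eq d3 _; rewrite /dpois /GRing.scale /= mulr0 addr0 -exprVn.
ring.
Qed.

Lemma cos_lt1 (s : R) : 0 < s < 2 * pi -> cos s < 1.
Proof.
move=> /andP[s0 s1]; have : 0 < sin (s / 2) by apply: sin_gt0_pi; lra.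
have E : cos s = 1 - 2 * sin (s / 2) ^+ 2.
  rewrite [in LHS](splitr s) cosD; have := cos2Dsin2 (s / 2); lra.
by move=> /(exprn_gt0 2); lra.
Qed.

Lemma dpois_continuous (r th : R) : 0 <= r < 1 -> continuous (fun t => dpois r (t - th)).
Proof.
move=> r01 t.
have h : (t - th) @[t --> t] --> t - th by apply: cvgB; [exact: cvg_id|exact: cvg_cst].
apply: cvgN; apply: cvgM.
  apply: cvgM; first exact: cvg_cst.
  apply: cvgM; first exact: cvg_cst.
  by apply: cvg_comp h _; exact: continuous_sin.
apply: cvgV; first by rewrite sqrf_eq0 gt_eqF // pois_den_gt0.
have c : 1 + r ^+ 2 - 2 * r * cos (t - th) @[t --> t] --> 1 + r ^+ 2 - 2 * r * cos (t - th).
  apply: cvgB; first exact: cvg_cst.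
  apply: cvgM; first exact: cvg_cst.
  by apply: cvg_comp h _; exact: continuous_cos.
by rewrite expr2; apply: cvgM.
Qed.

(** For [th] strictly inside the period, [t - th] stays within (-2 pi, 2 pi), where [cos] reaches 1
    only at 0; an endpoint would meet its copy at the other end. Compactness then gives [c]. *)
Lemma pois_den_far (th d : R) : 0 < d -> exists2 c : R, 0 < c &
  forall t, 0 <= t <= 2 * pi -> d <= `|t - th| -> 0 < th < 2 * pi -> c <= 1 - cos (t - th).
Proof.
move=> d0.
have lt1 s := @cos_lt1 s.
have cc : continuous (fun t => 1 - cos (t - th)).
  move=> t; apply: cvgB; first exact: cvg_cst.
  have : (t - th) @[t --> t] --> t - th by apply: cvgB; [exact: cvg_id|exact: cvg_cst].
  by move=> h; apply: cvg_comp h _; exact: continuous_cos.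
have mn a b : (forall t, a <= t <= b -> 0 < 1 - cos (t - th)) ->
    exists2 c, 0 < c & forall t, a <= t <= b -> c <= 1 - cos (t - th).
  move=> H; have [ab|ba] := leP a b; last by exists 1 => // t /andP[h1 h2]; lra.
  have [c cab hc] := EVT_min ab (continuous_subspaceT cc).
  exists (1 - cos (c - th)); first by apply: H; move: cab; rewrite in_itv.
  by move=> t tab; apply: hc; rewrite in_itv.
have [thI|nth] := boolP (0 < th < 2 * pi); last by exists 1.
have [c1 c10 h1] : exists2 c, 0 < c & forall t, 0 <= t <= th - d -> c <= 1 - cos (t - th).
  by apply: mn => t ht; rewrite -cosN opprB subr_gt0; apply: lt1; lra.
have [c2 c20 h2] : exists2 c, 0 < c & forall t, th + d <= t <= 2 * pi -> c <= 1 - cos (t - th).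
  by apply: mn => t ht; rewrite subr_gt0; apply: lt1; lra.
exists (Num.min c1 c2); first by rewrite lt_min c10.
move=> t ht; rewrite ler_normr => /orP[] h _; rewrite ge_min.
  by apply/orP; right; apply: h2; lra.
by apply/orP; left; apply: h1; lra.
Qed.

Lemma int_by_parts (F G f g : R -> R) (a b : R) : a < b ->
  (forall t : R, a <= t <= b -> is_derive t 1 F (f t)) -> (forall t : R, a <= t <= b -> is_derive t 1 G (g t)) ->
  cont_on a b f -> cont_on a b g ->
  int a b (fun t => F t * g t) = F b * G b - F a * G a - int a b (fun t => f t * G t).
Proof.
move=> ab dF dG cf cg; rewrite !intE.
have LR (H h : R -> R) : (forall t : R, a <= t <= b -> is_derive t 1 H (h t)) -> derivable_oo_LRcontinuous H a b.
  move=> dH; have cH t : a <= t <= b -> H x @[x --> t] --> H t.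
    by move=> /dH[d _]; apply/differentiable_continuous/derivable1_diffP.
  split.
  - by move=> t; rewrite in_itv /= => /andP[h1 h2]; case: (dH t) => //; rewrite !ltW.
  - by apply: cvg_at_right_filter; apply: cH; rewrite lexx ltW.
  - by apply: cvg_at_left_filter; apply: cH; rewrite lexx ltW.
have D (H h : R -> R) : (forall t : R, a <= t <= b -> is_derive t 1 H (h t)) -> {in `]a, b[, H^`()%classic =1 h}.
  by move=> dH t; rewrite in_itv /= => /andP[h1 h2]; rewrite derive1E; case: (dH t) => //; rewrite !ltW.
by apply: (Rintegration_by_parts ab cf _ _ cg); [exact: LR dF|exact: D|exact: LR dG|exact: D].
Qed.

(** Starting the integral at [a - 1] makes the derivative two-sided at [a]. *)
Lemma antiderivative (u : R -> R) (a : R) : continuous u ->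
  (forall t, a - 1 < t -> is_derive t 1 (fun t => int (a - 1) t u) (u t)) /\
  (forall x y, a <= x -> x <= y -> int x y u = int (a - 1) y u - int (a - 1) x u).
Proof.
move=> cu; split; last first.
  move=> x y ax xy; rewrite (@int_chasles _ (a - 1) x y) //; last exact: cont_on_cont.
    by ring.
  lra.
move=> t at'.
have [||||h1 h2] := @continuous_FTC1 R u (BLeft (a - 1)) t (t + 1).
- by rewrite ltrDl.
- by apply: cont_on_int; exact: cont_on_cont.
- exact: at'.
- exact: cu.
have E : (fun t => int (a - 1) t u) = (fun x => \int[lebesgue_measure]_(t in [set` Interval (BLeft (a - 1)) (BRight x)]) (u t)).
  by apply/funext => x; rewrite intE.
by rewrite E; split; [exact: h1|rewrite -derive1E; exact: h2].
Qed.

End Kernel.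

(** * Fatou's theorem for bounded analytic functions *)

Section Fatou.
Context {R : realType}.
Implicit Types (f : R[i] -> R[i]) (t : R).
Local Notation Re := complex.Re.
Local Notation Im := complex.Im.
Local Notation mu := (@lebesgue_measure R).

(** A sequence of radii, as dominated convergence requires; the offset 2 keeps [rad 0] positive, so
    that [ln (rad n)] is meaningful. *)
Definition rad (n : nat) : R := 1 - (n.+2%:R)^-1.

Lemma rad_gt0 n : 0 < rad n.
Proof. by rewrite /rad subr_gt0 invf_lt1 // ltr1n. Qed.

Lemma rad_lt1 n : rad n < 1.
Proof. by rewrite /rad ltrBlDr ltrDl invr_gt0. Qed.

Lemma rad_nd n m : (n <= m)%N -> rad n <= rad m.
Proof. by move=> nm; rewrite /rad lerD2l lerN2 lef_pV2 ?posrE // ler_nat !ltnS. Qed.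

Lemma rad_cvg : rad n @[n --> \oo] --> (1 : R).
Proof.
rewrite -[X in _ --> X](subr0 1); apply: cvgB; first exact: cvg_cst.
have := @cvg_harmonic R; rewrite -(cvg_shiftS) /=.
exact.
Qed.

Lemma ln_rad_cvg : ln (rad n) @[n --> \oo] --> (0 : R).
Proof. by rewrite -(@ln1 R); apply: cvg_comp rad_cvg _; apply: continuous_ln; exact: ltr01. Qed.

Lemma ln_rad_le0 n : ln (rad n) <= 0.
Proof. by rewrite -(@ln1 R) ler_ln ?posrE ?rad_gt0 // ltW // rad_lt1. Qed.

(** By [arc_int_sub] the arc integrals are Cauchy in the radius r with error -2 M ln r, uniformly in
    the arc, and each of them is Lipschitz with constant [M]. *)
Lemma arc_limit f (M : R) : analytic_disk f -> (forall z, disk z -> cabs (f z) <= M) ->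
  exists V : R -> R, (forall x y, `|V x - V y| <= M * `|x - y|) /\
    forall n t, 0 <= t <= 2 * pi ->
      `|V t - int 0 t (fun s => Re (f ((rad n)%:C * cis s)))| <= - (2 * M * ln (rad n)).
Proof.
move=> af fM.
have M0 : 0 <= M by rewrite (le_trans (cabs_ge0 (f 0))) // fM //; apply/diskE; rewrite cabs0.
have p0 : 0 <= 2 * pi :> R by rewrite mulr_ge0 // pi_ge0.
(* Clamping to the period makes the limit Lipschitz on the whole line, as [lipschitz_derivable_ae]
   expects. *)
pose cl (x : R) := Num.max 0 (Num.min x (2 * pi)).
have cl_itv x : 0 <= cl x <= 2 * pi.
  by rewrite /cl le_max lexx /= ge_max p0 ge_min lexx orbT.
have cl_id t : 0 <= t <= 2 * pi -> cl t = t.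
  by move=> /andP[h1 h2]; rewrite /cl min_l // max_r.
have cl_nd x y : x <= y -> cl x <= cl y /\ cl y - cl x <= y - x.
  by rewrite /cl /Num.max /Num.min => xy; split; repeat case: ifPn => //; rewrite -?leNgt => *; lra.
pose u n t := Re (f ((rad n)%:C * cis t)).
have cu n : continuous (u n).
  have [] // := @circle_continuous _ f (rad n) (ltW (rad_gt0 n)).
  by move=> z zr; apply: analytic_holo => //; rewrite zr rad_lt1.
have uM n t : `|u n t| <= M.
  by rewrite (le_trans (cabs_Re _)) // fM //; apply/diskE; rewrite cabs_rcis ?rad_lt1 // ltW // rad_gt0.
pose W n x := int 0 (cl x) (u n).
have WL n x y : x <= y -> `|W n y - W n x| <= M * (y - x).
  move=> /cl_nd[h1 h2]; have /andP[cx0 cx1] := cl_itv x; have /andP[cy0 cy1] := cl_itv y.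
  rewrite /W (@int_chasles _ 0 (cl x) (cl y)) //; last by apply: cont_on_cont; exact: cu.
  rewrite addrC addKr (le_trans (@int_abs_le _ _ _ _ M h1 _ _)) //; first by apply: cont_on_cont; exact: cu.
  by rewrite ler_wpM2l.
have Wmn n m x : (n <= m)%N -> `|W m x - W n x| <= 2 * M * (ln (rad m) - ln (rad n)).
  move=> nm; have /andP[cx0 cx1] := cl_itv x.
  apply: (@arc_int_sub _ f (rad n) (rad m) 0 (cl x) M (rad_gt0 n) (rad_nd nm) cx0) => z /andP[_ zr].
    by apply: analytic_holo => //; rewrite (le_lt_trans zr) // rad_lt1.
  by apply: fM; apply/diskE; rewrite (le_lt_trans zr) // rad_lt1.
(* Each element will be a lower bound of the limit; taking the supremum as the limit gives the
   two-sided estimate [VW] at once. *)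
pose A x := [set W n x + 2 * M * ln (rad n) | n in [set: nat]].
have M2 : 0 <= 2 * M by rewrite mulr_ge0.
have Aub n x : ubound (A x) (W n x - 2 * M * ln (rad n)).
  move=> _ [m _ <-]; have lm := mulr_ge0_le0 M2 (ln_rad_le0 m); have ln0 := mulr_ge0_le0 M2 (ln_rad_le0 n).
  have [nm|/ltnW mn] := leqP n m.
    have := Wmn n m x nm; rewrite ler_norml mulrBr => /andP[_]; lra.
  have := Wmn m n x mn; rewrite ler_norml mulrBr => /andP[]; lra.
have A0 x : A x !=set0 by exists (W 0%N x + 2 * M * ln (rad 0)), 0%N.
pose V x := sup (A x).
have VW n x : `|V x - W n x| <= - (2 * M * ln (rad n)).
  have h1 : V x <= W n x - 2 * M * ln (rad n) by apply: ge_sup; [exact: A0|exact: Aub].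
  have h2 : W n x + 2 * M * ln (rad n) <= V x.
    by apply: ub_le_sup; [exists (W n x - 2 * M * ln (rad n)); exact: Aub|exists n].
  by rewrite ler_norml; apply/andP; split; lra.
exists V; split; last first.
  by move=> n t ht; rewrite -{2}(cl_id t ht); exact: VW.
have VL x y : x <= y -> `|V y - V x| <= M * (y - x).
  move=> xy; apply/ler_addgt0Pr => e e0.
  have : 4 * M * ln (rad n) @[n --> \oo] --> 4 * M * 0 by apply: cvgMl_tmp; exact: ln_rad_cvg.
  rewrite mulr0 => /cvgrPdist_le/(_ e e0)[N _ /(_ N (leqnn N))] /=; rewrite sub0r normrN => he.
  have := VW N x; have := VW N y; have := WL N x y xy; have := ler_norm (- (4 * M * ln (rad N))).
  rewrite normrN !ler_norml => h0 /andP[h1 h2] /andP[h3 h4] /andP[h5 h6].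
  move: (V x) (V y) (W N x) (W N y) (ln (rad N)) h0 h1 h2 h3 h4 h5 h6 he.
  by clear => vx vy wx wy l h0 h1 h2 h3 h4 h5 h6 he; apply/andP; split; lra.
move=> x y; have [xy|/ltW yx] := leP x y.
  by rewrite distrC (distrC x) (ger0_norm (_ : 0 <= y - x)) ?subr_ge0 //; exact: VL.
by rewrite (ger0_norm (_ : 0 <= x - y)) ?subr_ge0 //; exact: VL.
Qed.

Lemma poisson_arc f (M : R) (V : R -> R) (r th : R) : analytic_disk f -> (forall z, disk z -> cabs (f z) <= M) ->
  (forall x y, `|V x - V y| <= M * `|x - y|) ->
  (forall n t, 0 <= t <= 2 * pi ->
      `|V t - int 0 t (fun s => Re (f ((rad n)%:C * cis s)))| <= - (2 * M * ln (rad n))) ->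
  0 < r < 1 ->
  2 * pi * Re (f (r%:C * cis th)) =
    pois r (2 * pi - th) * V (2 * pi) - int 0 (2 * pi) (fun t => dpois r (t - th) * V t).
Proof.
move=> af fM VL VW /andP[r0 r1].
have r01 : 0 <= r < 1 by rewrite ltW.
have p0 : 0 < 2 * pi :> R by rewrite mulr_gt0 // pi_gt0.
have M0 : 0 <= M by rewrite (le_trans (cabs_ge0 (f 0))) // fM //; apply/diskE; rewrite cabs0.
pose u n t := Re (f ((rad n)%:C * cis t)).
have cu n : continuous (u n).
  have [] // := @circle_continuous _ f (rad n) (ltW (rad_gt0 n)).
  by move=> z zr; apply: analytic_holo => //; rewrite zr rad_lt1.
pose P t := pois r (t - th); pose dP t := dpois r (t - th).
have dPP t : is_derive t 1 P (dP t) by exact: is_derive_pois.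
have cdP : continuous dP by exact: dpois_continuous.
have cV : cont_on 0 (2 * pi) V.
  apply: cont_onP => x _ e e0; exists (e / (M + 1)); first by rewrite divr_gt0 // ltr_wpDl.
  move=> y _ yx; rewrite (le_trans (VL y x)) // (@le_trans _ _ ((M + 1) * `|y - x|)) //.
    by rewrite ler_wpM2r // lerDl.
  by rewrite -ler_pdivlMl ?ltr_wpDl // mulrC ltW.
have cdPV : cont_on 0 (2 * pi) (fun t => dP t * V t) by apply: cont_onM => //; exact: cont_on_cont.
have [K K0 hK] : exists2 K, 0 <= K & forall t, 0 <= t <= 2 * pi -> `|dP t| <= K.
  have cn : {within `[0, 2 * pi], continuous (fun t => `|dP t|)}.
    by apply: continuous_subspaceT => t; apply: cvg_norm; exact: cdP.
  have [c cI hc] := EVT_max (ltW p0) cn.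
  by exists `|dP c| => // t ht; apply: hc; rewrite in_itv.
pose RHS := P (2 * pi) * V (2 * pi) - int 0 (2 * pi) (fun t => dP t * V t).
pose C := `|P (2 * pi)| + K * (2 * pi).
have main n : `|2 * pi * Re (f ((rad n)%:C * (r%:C * cis th))) - RHS| <= C * - (2 * M * ln (rad n)).
  have z1 : cabs (r%:C * cis th) < 1 by rewrite cabs_rcis // ltW.
  have rn : 0 < rad n < 1 by rewrite rad_gt0 rad_lt1.
  rewrite -(@poisson_formula_disk _ f M (rad n) _ af fM rn z1).
  have [A1 A2] := @antiderivative _ (u n) 0 (cu n).
  pose G t := int (0 - 1) t (u n) - int (0 - 1) 0 (u n).
  have dG t : 0 <= t <= 2 * pi -> is_derive t 1 G (u n t).
    move=> /andP[t0 _]; have d := A1 t (lt_le_trans (_ : 0 - 1 < 0) t0).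
    rewrite -[u n t]subr0; apply: (is_deriveB (d _) (is_derive_cst (int (0 - 1) 0 (u n)) t 1)).
    by rewrite sub0r ltrN10.
  have GE t : 0 <= t <= 2 * pi -> G t = int 0 t (u n) by move=> /andP[t0 _]; rewrite (A2 0 t).
  have cG : cont_on 0 (2 * pi) G.
    apply: derivable_within_continuous => t; rewrite in_itv /= => /dG[d _]; exact: d.
  have cG' : cont_on 0 (2 * pi) (fun t => dP t * G t) by apply: cont_onM => //; exact: cont_on_cont.
  have -> : int 0 (2 * pi) (fun t => Re (f ((rad n)%:C * cis t)) * poisson (r%:C * cis th) t) =
      int 0 (2 * pi) (fun t => P t * u n t).
    by apply: eq_int => t _; rewrite poisson_pois ?(ltW r0) // mulrC.
  have ibp := @int_by_parts _ P G dP (u n) 0 (2 * pi) p0 (fun t _ => dPP t) dG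
     (cont_on_cont cdP) (cont_on_cont (cu n)).
  rewrite ibp GE ?lexx ?(ltW p0) // (GE 0) ?lexx ?(ltW p0) // intxx mulr0 subr0 /RHS.
  have pp : (0 : R) <= 2 * pi <= 2 * (pi : R) by rewrite (ltW p0) /=.
  have E : forall a b c d : R, a - b - (c - d) = (a - c) + (d - b) by move=> *; ring.
  rewrite /C E -mulrBr -intB // (le_trans (ler_normD _ _)) // [leRHS]mulrDl lerD //.
    by rewrite normrM ler_wpM2l // distrC; exact: VW.
  rewrite mulrAC.
  rewrite (le_trans (@int_abs_le _ _ _ _ (K * - (2 * M * ln (rad n))) (ltW p0) _ _)) ?subr0 //.
    by apply: cont_onD => //; exact: cont_onN.
  move=> t ht; rewrite -mulrBr normrM ler_pM // ?hK // GE //; exact: VW.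
have lim1 : 2 * pi * Re (f ((rad n)%:C * (r%:C * cis th))) @[n --> \oo] --> 2 * pi * Re (f (r%:C * cis th)).
  apply: cvgMl_tmp.
  have E n : (rad n)%:C * (r%:C * cis th) = (rad n * r)%:C * cis th by rewrite rmorphM mulrA.
  under eq_fun do rewrite E.
  have c1 : rad n * r @[n --> \oo] --> r by rewrite -[X in _ --> X]mul1r; apply: cvgMr_tmp; exact: rad_cvg.
  have hr : holo f (r%:C * cis th) by apply: analytic_holo => //; rewrite cabs_rcis // ltW.
  have [c2 _] := (cvg_complexP _ _).1 (@cvg_ray _ f r th hr).
  exact: cvg_comp c1 c2.
have lim2 : 2 * pi * Re (f ((rad n)%:C * (r%:C * cis th))) @[n --> \oo] --> RHS.
  apply/cvgrPdist_le => e e0.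
  have : C * - (2 * M * ln (rad n)) @[n --> \oo] --> C * - (2 * M * 0).
    by apply: cvgMl_tmp; apply: cvgN; apply: cvgMl_tmp; exact: ln_rad_cvg.
  rewrite mulr0 oppr0 mulr0 => /cvgrPdist_le/(_ e e0); apply: filterS => n /=.
  rewrite sub0r normrN => h; by rewrite distrC (le_trans (main n)) // (le_trans _ h) // ler_norm.
exact: (cvg_unique _ lim1 lim2).
Qed.

Lemma pois_cvg0 (s : R) : 0 < s < 2 * pi -> pois r s @[r --> (1 : R)^'-] --> (0 : R).
Proof.
move=> /andP[s0 s1].
have D : 1 + 1 ^+ 2 - 2 * 1 * cos s != 0 :> R.
  have := @cos_lt1 _ s; rewrite s0 s1 => /(_ isT) h; rewrite expr1n mulr1; apply/eqP; lra.
rewrite -(_ : pois 1 s = 0); last by rewrite /pois expr1n subrr mul0r.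
apply: cvg_at_left_filter; apply: cvgM.
  by apply: cvgB; [exact: cvg_cst|apply: (@exprn_continuous _ 2)].
apply: cvgV => //; apply: cvgB; first by apply: cvgD; [exact: cvg_cst|apply: (@exprn_continuous _ 2)].
apply: cvgM; last exact: cvg_cst.
by apply: cvgM; [exact: cvg_cst|exact: cvg_id].
Qed.

Lemma left_eq_cvg (g h : R -> R) (l : R) : (forall r, 0 < r < 1 -> g r = h r) ->
  h r @[r --> (1 : R)^'-] --> l -> g r @[r --> (1 : R)^'-] --> l.
Proof.
move=> E; apply: cvg_trans; apply: near_eq_cvg; apply/left_nearP; exists 1 => // r.
by rewrite subrr => r0 r1; rewrite E // r0.
Qed.

(* The integrals of [Re f (r * _)] over arcs converge as r tends to 1 to a Lipschitz function V;
   integrating the Poisson formula by parts, [Re f] has the radial limit [V'] wherever V is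
   differentiable. *)
Lemma radial_limit_Re_ae f (M : R) : analytic_disk f -> (forall z, disk z -> cabs (f z) <= M) ->
  {ae mu, forall t, 0 < t < 2 * pi -> exists l : R, Re (f (r%:C * cis t)) @[r --> (1 : R)^'-] --> l}.
Proof.
move=> af fM; have [V [VL VW]] := arc_limit af fM.
have p0 : 0 < 2 * pi :> R by rewrite mulr_gt0 // pi_gt0.
have p2 : 2 * pi != 0 :> R by rewrite gt_eqF.
have := lipschitz_derivable_ae (ltW p0) VL; apply: filterS; first exact: (ae_filter_ringOfSetsType mu).
move=> th dV thI; have {}dV := dV thI; move: (thI) => /andP[th0 th1].
have thI' : 0 <= th <= 2 * pi by rewrite !ltW.
(* [v] is the difference quotient of [V] at [th], completed by the derivative. The factor [t - th],
   moved into [K], turns the derivative of the Poisson kernel into an approximate identity. *)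
pose K r t := - dpois r (t - th) * (t - th) / (2 * pi).
pose v t := if t == th then V^`()%classic th else (V t - V th) / (t - th).
have cdp r := @dpois_continuous R r th.
have cid : continuous (fun t : R => t - th).
  by move=> t; apply: cvgB; [exact: cvg_id|exact: cvg_cst].
have cK r : 0 <= r < 1 -> continuous (K r).
  move=> r01 t; apply: cvgM; last exact: cvg_cst.
  by apply: cvgM; [apply: cvgN; exact: cdp|exact: cid].
have VE t : v t * (t - th) = V t - V th.
  rewrite /v; case: eqP => [->|/eqP h]; first by rewrite !subrr mulr0.
  by rewrite divfK // subr_eq0.
have cV : continuous V.
  move=> x; apply/cvgrPdist_le => /= e e0.
  have M0 : 0 <= M by have := VL 1 0; rewrite subr0 normr1 mulr1; exact: le_trans.
  have e1 : 0 < e / (M + 1) by rewrite divr_gt0 // ltr_wpDl.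
  apply/nbhs_ballP; exists (e / (M + 1)) => // y; rewrite /ball /= => xy.
  rewrite (le_trans (VL x y)) // (@le_trans _ _ ((M + 1) * `|x - y|)) //; first by rewrite ler_wpM2r // lerDl.
  by rewrite -ler_pdivlMl ?ltr_wpDl // mulrC ltW.
have cv : cont_on 0 (2 * pi) v.
  apply: cont_on_cont => t; have [->|tth] := eqVneq t th; last first.
    have : {for t, continuous (fun t => (V t - V th) / (t - th))}.
      apply: cvgM; first by apply: cvgB; [exact: cV|exact: cvg_cst].
      by apply: cvgV; [rewrite subr_eq0|exact: cid].
    move=> H; rewrite /continuous_at {2}/v (negbTE tth); apply: cvg_trans H.
    apply: near_eq_cvg; rewrite /v; apply/nbhs_ballP; exists `|t - th|; first by rewrite /= normr_gt0 subr_eq0.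
    by move=> x; rewrite /ball /= => tx; rewrite ifN //; apply: contraTneq tx => ->; rewrite ltxx.
  have : h^-1 *: ((V \o shift th) (h *: (1 : R)) - V th) @[h --> 0^'] --> V^`()%classic th.
    by rewrite derive1E; exact: dV.
  move=> /cvgrPdist_le H; apply/cvgrPdist_le => e e0.
  have /nbhs_ballP[d /= d0 hd] := H e e0; apply/nbhs_ballP; exists d => //= x.
  rewrite /ball /= {1}/v eqxx distrC => xth; rewrite /v; case: eqP => [_|/eqP h]; first by rewrite subrr normr0 ltW.
  have := hd (x - th); rewrite /ball /= sub0r normrN => /(_ xth).
  rewrite subr_eq0 => /(_ h); rewrite /GRing.scale /= mulr1 subrK mulrC.
  exact.
have Kv r : 0 < r < 1 -> Re (f (r%:C * cis th)) =
    (2 * pi)^-1 * pois r (2 * pi - th) * (V (2 * pi)- V th) + (2 * pi)^-1 * pois r th * V th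
      + int 0 (2 * pi) (fun t => K r t * v t).
  move=> r01; have r01' : 0 <= r < 1 by case/andP: r01 => /ltW ->.
  apply: (mulfI p2); rewrite (poisson_arc th af fM VL VW r01).
  have c1 : cont_on 0 (2 * pi) (fun t => dpois r (t - th) * V t).
    by apply: cont_on_cont => t; apply: cvgM; [exact: cdp|exact: cV].
  have c2 : cont_on 0 (2 * pi) (fun t => dpois r (t - th) * V th).
    by apply: cont_on_cont => t; apply: cvgM; [exact: cdp|exact: cvg_cst].
  have E1 : int 0 (2 * pi) (fun t => K r t * v t) =
     (2 * pi)^-1 * - (int 0 (2 * pi) (fun t => dpois r (t - th) * V t) - int 0 (2 * pi) (fun t => dpois r (t - th) * V th)).
    rewrite -intB // -intN; last by apply: cont_onD => //; exact: cont_onN.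
    rewrite -intZ; last by apply: cont_onN; apply: cont_onD => //; exact: cont_onN.
    apply: eq_int => t _; rewrite -mulrBr -VE /K; move: (2 * pi) p2 => c c0; field; exact: c0.
  have E2 : int 0 (2 * pi) (fun t => dpois r (t - th) * V th) = V th * (pois r (2 * pi - th) - pois r th).
    have := @int_by_parts _ (fun=> 1) (fun t => pois r (t - th)) (fun=> 0) (fun t => dpois r (t - th)) 0 (2 * pi) p0
      (fun t _ => is_derive_cst _ _ _) (fun t _ => is_derive_pois th t r01') (@cont_on_cst _ _ _ 0) (cont_on_cont (cdp r r01')).
    rewrite !mul1r sub0r (_ : pois r (- th) = pois r th); last by rewrite /pois cosN.
    have -> : int 0 (2 * pi) (fun t => 0 * pois r (t - th)) = 0.
      by rewrite -[RHS](mul0r (2 * pi - 0)) -int_cst ?(ltW p0) //; apply: eq_int => t _; rewrite mul0r.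
    rewrite subr0 => <-; rewrite -intZ.
      by apply: eq_int => t _; rewrite mul1r mulrC.
    by apply: cont_on_cont => t; apply: cvgM; [exact: cvg_cst|exact: cdp].
  rewrite E1 E2; move: (pois r (2 * pi - th)) (pois r th) (V (2 * pi)) (V th) (int 0 (2 * pi) _) => A B C D I.
  by move: (2 * pi) p2 => c c0; field; exact: c0.
exists ((2 * pi)^-1 * 0 * (V (2 * pi) - V th) + (2 * pi)^-1 * 0 * V th + v th).
have sub : 0 < 2 * pi - th < 2 * pi by apply/andP; split; lra.
have C : (2 * pi)^-1 * pois r (2 * pi - th) * (V (2 * pi)- V th) + (2 * pi)^-1 * pois r th * V th
      + int 0 (2 * pi) (fun t => K r t * v t) @[r --> (1 : R)^'-] -->
   (2 * pi)^-1 * 0 * (V (2 * pi) - V th) + (2 * pi)^-1 * 0 * V th + v th.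
  apply: cvgD.
    apply: cvgD; apply: cvgMr_tmp; apply: cvgMl_tmp; exact: pois_cvg0.
  apply: (@kernel_cvg _ K v 0 (2 * pi) th 1) => //; first exact: ltW.
  - by move=> r r0 r1; apply: cont_on_cont; apply: cK; rewrite ltW.
  - move=> d e d0 e0.
    have [c c0 hc] := @pois_den_far R th d d0.
    apply/left_nearP; exists (Num.min (1 / 2) (e * c ^+ 2 / 4)).
      by rewrite lt_min !divr_gt0 // mulr_gt0 // exprn_gt0.
    move=> r rm r1 t ht td.
    have m1 : Num.min (1 / 2) (e * c ^+ 2 / 4) <= 1 / 2 by rewrite ge_min lexx.
    have m2 : Num.min (1 / 2) (e * c ^+ 2 / 4) <= e * c ^+ 2 / 4 by rewrite ge_min lexx orbT.
    have [r2 r3] : 1 / 2 < r /\ 4 * (1 - r) <= e * c ^+ 2 by clear - rm m1 m2; split; lra.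
    have r0 : 0 < r by clear - r2; lra.
    have hct := hc t ht td thI.
    have Dc : c <= 1 + r ^+ 2 - 2 * r * cos (t - th).
      have : 1 / 2 * (1 - cos (t - th)) <= r * (1 - cos (t - th)).
        by rewrite ler_wpM2r ?(ltW r2) // subr_ge0 cos_le1.
      by have := sqr_ge0 (1 - r); clear - hct; rewrite !expr2; lra.
    have D2 : c ^+ 2 <= (1 + r ^+ 2 - 2 * r * cos (t - th)) ^+ 2.
      by rewrite lerXn2r // nnegrE ?(ltW c0) // (le_trans (ltW c0)).
    have num : `|(1 - r ^+ 2) * (2 * r * sin (t - th))| <= 4 * (1 - r).
      have s1 : `|sin (t - th)| <= 1 by rewrite ler_norml sin_geN1 sin_le1.
      have q0 : 0 <= 1 - r ^+ 2 by rewrite subr_ge0 expr_le1 // ltW.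
      rewrite !normrM (ger0_norm q0) (ger0_norm (ltW r0)) ger0_norm //.
      have q1 : 2 * r * `|sin (t - th)| <= 2 * r * 1 by rewrite ler_pM2l // mulr_gt0.
      rewrite (le_trans (ler_wpM2l q0 q1)) // mulr1.
      have : 0 <= (1 - r) * (2 - r * (1 + r)).
        rewrite mulr_ge0 //; clear - r0 r1; first lra.
        have : r * (1 + r) <= 1 * (1 + r) by rewrite ler_wpM2r; lra.
        by lra.
      by clear; rewrite expr2; lra.
    have tth : `|t - th| <= 2 * pi by case/andP: ht => ? ?; rewrite ler_norml; apply/andP; split; lra.
    rewrite /K /dpois opprK normrM normrM normrM normfV normfV (ger0_norm (sqr_ge0 _)) (gtr0_norm p0).
    rewrite ler_pdivrMr // ler_pM //; first by rewrite divr_ge0 ?normr_ge0 ?sqr_ge0.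
    rewrite ler_pdivrMr ?(lt_le_trans _ D2) ?exprn_gt0 //.
    by rewrite (le_trans num) // (le_trans r3) // ler_pM2l.
  - move=> r t r0 r1 ht td; rewrite /K /dpois divr_ge0 ?(ltW p0) // opprK mulrAC divr_ge0 //; last first.
      by rewrite sqr_ge0.
    rewrite -!mulrA mulr_ge0 //; first by rewrite subr_ge0 expr_le1 // ltW.
    rewrite mulr_ge0 // mulr_ge0 ?(ltW r0) //.
    have p1 : 1 <= pi :> R by rewrite (le_trans _ (@pi_ge2 R)) // ler1n.
    move: td; rewrite ltr_norml => /andP[t1 t2].
    have [s0|s0] := leP 0 (t - th).
      by rewrite mulr_ge0 // sin_ge0_pi // s0 /= (le_trans (ltW t2)).
    rewrite -mulrNN -sinN mulr_ge0 //; last by rewrite oppr_ge0 ltW.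
    by rewrite sin_ge0_pi // oppr_ge0 (ltW s0) /= (le_trans _ p1) // lerNl ltW.
  (* Integrating by parts against [t - th] returns the Poisson integral [2 * pi], together with
     boundary terms that vanish as [r] tends to 1. *)
  - have E r : 0 < r < 1 -> int 0 (2 * pi) (K r) =
        1 - (2 * pi)^-1 * ((2 * pi - th) * pois r (2 * pi - th) + th * pois r th).
      move=> r01; have r01' : 0 <= r < 1 by case/andP: r01 => /ltW ->.
      have ibp := @int_by_parts _ (fun t => t - th) (fun t => pois r (t - th)) (fun=> 1) (fun t => dpois r (t - th)) 0 (2 * pi) p0
        _ (fun t _ => is_derive_pois th t r01') (@cont_on_cst _ _ _ 1) (cont_on_cont (cdp r r01')).
      have {}ibp := ibp (fun t _ => is_derive_shift t 1 (- th)).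
      have c3 : cont_on 0 (2 * pi) (fun t => (t - th) * dpois r (t - th)).
        by apply: cont_on_cont => t; apply: cvgM; [exact: cid|exact: cdp].
      have -> : int 0 (2 * pi) (K r) = - (2 * pi)^-1 * int 0 (2 * pi) (fun t => (t - th) * dpois r (t - th)).
        rewrite -intZ //; apply: eq_int => t _; rewrite /K; move: (2 * pi) p2 => c c0; field; exact: c0.
      rewrite ibp sub0r (_ : pois r (- th) = pois r th); last by rewrite /pois cosN.
      have -> : int 0 (2 * pi) (fun t => 1 * pois r (t - th)) = 2 * pi.
        have z1 : cabs (r%:C * cis th) < 1 by rewrite cabs_rcis; case/andP: r01' => //.
        apply: etrans (poisson_int z1); apply: eq_int => t _; rewrite mul1r poisson_pois //.
        by case/andP: r01'.
      by move: (2 * pi) p2 => c c0; field; exact: c0.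
    apply: (left_eq_cvg E).
    rewrite -[X in _ --> X](_ : 1 - (2 * pi)^-1 * ((2 * pi - th) * 0 + th * 0) = 1); last by rewrite !mulr0 addr0 mulr0 subr0.
    apply: cvgB; first exact: cvg_cst.
    by apply: cvgMl_tmp; apply: cvgD; apply: cvgMl_tmp; exact: pois_cvg0.
exact: (left_eq_cvg Kv C).
Qed.

Lemma radial_limit_ae f (M : R) : analytic_disk f -> (forall z, disk z -> cabs (f z) <= M) ->
  {ae mu, forall t, 0 < t < 2 * pi -> exists w : R[i], (f (r%:C * cis t) : R[i]^o) @[r --> (1 : R)^'-] --> (w : R[i]^o)}.
Proof.
move=> af fM; have h1 := radial_limit_Re_ae af fM.
have h2 : {ae mu, forall t, 0 < t < 2 * pi -> exists l : R, Re (- 'i%C * f (r%:C * cis t)) @[r --> (1 : R)^'-] --> l}.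
  apply: (@radial_limit_Re_ae (fun z => - 'i%C * f z) M).
    by move=> z dz; apply: holoM; [exact: holo_cst|exact: af].
  by move=> z dz; rewrite cabsM cabsN {1}/cabs /= expr0n expr1n add0r sqrtr1 mul1r; exact: fM.
move: h1 h2; apply: filterS2; first exact: (ae_filter_ringOfSetsType mu).
move=> t H1 H2 tI; have [a ha] := H1 tI; have [b hb] := H2 tI.
exists (a +i* b); apply/cvg_complexP; split => //=.
have E (z : R[i]) : Im z = Re (- 'i%C * z) by rewrite ReM /=; ring.
by under eq_fun do rewrite E.
Qed.

End Fatou.

(** * Schwarz integrals *)

Section Schwarz.
Context {R : realType} d {T : measurableType d} {mu : {measure set T -> \bar R}} {D : set T}.
Hypothesis mD : measurable D.
Local Notation Re := complex.Re.
Local Notation Im := complex.Im.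
Variables (tau : T -> R[i]) (u : T -> R).
Hypothesis tau1 : forall x, cabs (tau x) = 1.
Hypothesis iu : mu.-integrable D (EFin \o u).
Hypothesis mtau : forall g : R[i] -> R[i], (forall z, cabs z = 1 -> holo g z) ->
  measurable_fun D (fun x => Re (g (tau x))).

(** The measure, and the map [tau] from its space to the circle, are abstract so that one
    computation serves the Schwarz integral ([cis] on an interval) and the Martin series (counting
    measure on [nat]). *)
Definition cint (g : T -> R[i]) : R[i] :=
  Rintegral mu D (fun x => Re (g x)) +i* Rintegral mu D (fun x => Im (g x)).

Let Ku (g : R[i] -> R[i]) x := g (tau x) * (u x)%:C.

Lemma integrable_bounded_mul (v : T -> R) C : measurable_fun D v -> (forall x, `|v x| <= C) ->
  mu.-integrable D (EFin \o (fun x => v x * u x)).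
Proof.
move=> mv vC.
have iC : mu.-integrable D (fun x => C%:E * (u x)%:E)%E by apply: integrableZl.
apply: le_integrable iC => //.
  apply/measurable_EFinP; apply: measurable_funM => //.
  by apply/measurable_EFinP; exact: measurable_int iu.
move=> x Dx /=; rewrite !lee_fin !normrM.
by apply: ler_wpM2r => //; apply: le_trans (vC x) (ler_norm _).
Qed.

Definition bdd_circle (g : R[i] -> R[i]) := (forall z, cabs z = 1 -> holo g z) /\
  exists C, forall z, cabs z = 1 -> cabs (g z) <= C.

Lemma cint_Re g : bdd_circle g -> mu.-integrable D (EFin \o (fun x => Re (g (tau x)) * u x)).
Proof.
move=> [hg [C gC]]; apply: (@integrable_bounded_mul _ C); first exact: mtau.
by move=> x; rewrite (le_trans (cabs_Re _)) // gC.
Qed.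

Lemma cint_Im g : bdd_circle g -> mu.-integrable D (EFin \o (fun x => Im (g (tau x)) * u x)).
Proof.
move=> [hg [C gC]]; apply: (@integrable_bounded_mul _ C).
  have E : (fun x => Im (g (tau x))) = (fun x => Re (- 'i%C * g (tau x))).
    by apply/funext => x; rewrite ReM /=; ring.
  rewrite E; apply: (mtau (g := fun z => - 'i%C * g z)) => z z1.
  by apply: holoM; [exact: holo_cst|exact: hg].
by move=> x; rewrite (le_trans (cabs_Im _)) // gC.
Qed.

Lemma cintE g : cint (Ku g) =
  \int[mu]_(x in D) (Re (g (tau x)) * u x) +i* \int[mu]_(x in D) (Im (g (tau x)) * u x).
Proof.
rewrite /cint /Ku; congr (_ +i* _); apply: eq_Rintegral => x _ /=; first by rewrite ReMr.
by rewrite ImMr.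
Qed.

Lemma cint_comb g h k (w : R[i]) : bdd_circle g -> bdd_circle h -> bdd_circle k ->
  cint (Ku g) - cint (Ku h) - cint (Ku k) * w = cint (Ku (fun z => g z - h z - k z * w)).
Proof.
move=> bg bh bk; rewrite !cintE.
have E1 : (fun x => Re (g (tau x) - h (tau x) - k (tau x) * w) * u x) = (fun x =>
   (Re (g (tau x)) * u x - Re (h (tau x)) * u x) - (Re (k (tau x)) * u x * Re w - Im (k (tau x)) * u x * Im w)).
  by apply/funext => x; rewrite !(ReD, ReN, ReM); ring.
have E2 : (fun x => Im (g (tau x) - h (tau x) - k (tau x) * w) * u x) = (fun x =>
   (Im (g (tau x)) * u x - Im (h (tau x)) * u x) - (Re (k (tau x)) * u x * Im w + Im (k (tau x)) * u x * Re w)).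
  by apply/funext => x; rewrite !(ImD, ImN, ImM); ring.
have I1 c : mu.-integrable D (EFin \o (fun x => Re (k (tau x)) * u x * c)).
  by have := integrableZr mD c (cint_Re bk); apply: eq_integrable => // x _ /=; rewrite EFinM.
have I2 c : mu.-integrable D (EFin \o (fun x => Im (k (tau x)) * u x * c)).
  by have := integrableZr mD c (cint_Im bk); apply: eq_integrable => // x _ /=; rewrite EFinM.
have igh1 := integrableB mD (cint_Re bg) (cint_Re bh); have igh2 := integrableB mD (cint_Im bg) (cint_Im bh).
have J1 : mu.-integrable D (EFin \o (fun x => Re (k (tau x)) * u x * Re w - Im (k (tau x)) * u x * Im w)).
  exact: (integrableB mD (I1 _) (I2 _)).
have J2 : mu.-integrable D (EFin \o (fun x => Re (k (tau x)) * u x * Im w + Im (k (tau x)) * u x * Re w)).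
  exact: (integrableD mD (I1 _) (I2 _)).
rewrite E1 E2 (RintegralB mD igh1 J1) (RintegralB mD igh2 J2).
rewrite (RintegralB mD (cint_Re bg) (cint_Re bh)) (RintegralB mD (cint_Im bg) (cint_Im bh)).
rewrite (RintegralB mD (I1 _) (I2 _)) (RintegralD mD (I1 _) (I2 _)).
rewrite !(RintegralZr _ mD) ?cint_Re ?cint_Im //.
by apply/eqP; rewrite eq_complex !(ReD, ReN, ReM, ImD, ImN, ImM) /= !eqxx.
Qed.

Lemma cint_le g C : bdd_circle g -> 0 <= C -> (forall z, cabs z = 1 -> cabs (g z) <= C) ->
  cabs (cint (Ku g)) <= 2 * C * \int[mu]_(x in D) `|u x|.
Proof.
move=> bg C0 gC; rewrite cintE (le_trans (cabs_le _)) //= mulr2n !mulrDl mul1r.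
have iau : mu.-integrable D (EFin \o (fun x => `|u x|)) by exact: integrable_norm iu.
have iCu : mu.-integrable D (EFin \o (fun x => C * `|u x|)).
  by have := integrableZl mD C iau; apply: eq_integrable => // x _ /=; rewrite EFinM.
have B (v : T -> R) : mu.-integrable D (EFin \o (fun x => v x * u x)) -> (forall x, `|v x| <= C) ->
    `|\int[mu]_(x in D) (v x * u x)| <= C * \int[mu]_(x in D) `|u x|.
  move=> iv vC; rewrite (le_trans (le_normr_Rintegral mD iv)) // -RintegralZl //.
  apply: le_Rintegral => //; first exact: integrable_norm iv.
  by move=> x _; rewrite normrM ler_wpM2r.
apply: lerD; apply: B; [exact: cint_Re| |exact: cint_Im|]; move=> x.
  by rewrite (le_trans (cabs_Re _)) // gC.
by rewrite (le_trans (cabs_Im _)) // gC.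
Qed.

(** A remainder that is quadratic in [w - z], uniformly over the circle, passes through the integral
    as it stands. *)
Lemma cint_cder (k k1 : R[i] -> R[i] -> R[i]) (z : R[i]) (r C : R) : 0 < r -> 0 <= C ->
  (forall w, cabs (w - z) < r -> bdd_circle (k w)) -> bdd_circle (k1 z) ->
  (forall t w, cabs t = 1 -> cabs (w - z) < r ->
     cabs (k w t - k z t - k1 z t * (w - z)) <= C * cabs (w - z) ^+ 2) ->
  cder (fun w => cint (Ku (k w))) z (cint (Ku (k1 z))).
Proof.
move=> r0 C0 bk bk1 H e e0.
pose N := \int[mu]_(x in D) `|u x|.
have N0 : 0 <= N by apply: Rintegral_ge0.
have q0 : 0 < 2 * C * N + 1 by rewrite ltr_wpDl // !mulr_ge0.
exists (Num.min r (e / (2 * C * N + 1))); first by rewrite lt_min r0 divr_gt0.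
move=> w; rewrite lt_min => /andP[wr we].
have zr : cabs (z - z) < r by rewrite subrr cabs0.
rewrite (cint_comb _ (bk w wr) (bk z zr) bk1).
have b : bdd_circle (fun t => k w t - k z t - k1 z t * (w - z)).
  split; last by exists (C * cabs (w - z) ^+ 2) => t t1; exact: H.
  move=> t t1; apply: holoB; last by apply: holoM; [exact: bk1.1|exact: holo_cst].
  by apply: holoB; [exact: (bk w wr).1|exact: (bk z zr).1].
have c0 := cabs_ge0 (w - z).
have Cw : 0 <= C * cabs (w - z) ^+ 2 by rewrite mulr_ge0 // sqr_ge0.
rewrite (le_trans (cint_le b Cw (fun t t1 => H t w t1 wr))) // -/N.
have : (2 * C * N + 1) * cabs (w - z) <= e by rewrite -ler_pdivlMl // mulrC ltW.
move=> h; have := ler_wpM2r c0 h; have := mulr_ge0 c0 c0.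
by rewrite expr2; lra.
Qed.

Lemma circle_dist (z t : R[i]) : cabs t = 1 -> 1 - cabs z <= cabs (t - z).
Proof. by move=> t1; have := cabsD (t - z) z; rewrite subrK t1; lra. Qed.

Lemma circle_neq (z t : R[i]) : cabs z < 1 -> cabs t = 1 -> t - z != 0.
Proof. by move=> z1 t1; rewrite -cabs_gt0 (lt_le_trans _ (circle_dist z t1)) // subr_gt0. Qed.

(** The Herglotz kernel; [dschw] and [d2schw] are its first two derivatives in [z]. *)
Definition schw (z t : R[i]) := (t + z) / (t - z).
Definition dschw (z t : R[i]) := 2 * t / (t - z) ^+ 2.
Definition d2schw (z t : R[i]) := 4 * t / (t - z) ^+ 3.

Lemma bdd_circle_ratio (n : nat) (p : R[i] -> R[i]) (z : R[i]) (C : R) : cabs z < 1 ->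
  (forall w, holo p w) -> (forall t, cabs t = 1 -> cabs (p t) <= C) ->
  bdd_circle (fun t => p t / (t - z) ^+ n).
Proof.
move=> z1 hp pC; have k0 : 0 < 1 - cabs z by rewrite subr_gt0.
split.
  move=> t t1; apply: holoM; first exact: hp.
  apply: holoV; first by rewrite expf_neq0 // circle_neq.
  elim: n => [|n ih]; first by rewrite /holo; exact: holo_cst.
  have -> : (fun w => (w - z) ^+ n.+1) = (fun w => (w - z) * (w - z) ^+ n) by apply/funext => w; rewrite exprS.
  have h1 : holo (fun w => w - z) t by apply: holoB; [exact: holo_id|exact: holo_cst].
  exact: (holoM h1 ih).
exists (C * ((1 - cabs z) ^+ n)^-1) => t t1; rewrite cabsM cabsV cabsX ler_pM ?cabs_ge0 ?invr_ge0 ?exprn_ge0 ?cabs_ge0 ?pC //.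
rewrite lef_pV2 ?posrE ?exprn_gt0 ?cabs_gt0 ?circle_neq //.
by rewrite lerXn2r // ?nnegrE ?cabs_ge0 ?(ltW k0) // circle_dist.
Qed.

Lemma bdd_schw z : cabs z < 1 -> bdd_circle (schw z).
Proof.
move=> z1; have -> : schw z = fun t => (t + z) / (t - z) ^+ 1 by apply/funext => t; rewrite expr1.
apply: (@bdd_circle_ratio 1 (fun t => t + z) z 2) => //.
  by move=> w; apply: holoD; [exact: holo_id|exact: holo_cst].
by move=> t t1; rewrite (le_trans (cabsD _ _)) // t1; lra.
Qed.

Lemma bdd_dschw z : cabs z < 1 -> bdd_circle (dschw z).
Proof.
move=> z1; apply: (@bdd_circle_ratio 2 (fun t => 2 * t) z (cabs 2)) => //.
  by move=> w; apply: holoM; [exact: holo_cst|exact: holo_id].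
by move=> t t1; rewrite cabsM t1 mulr1.
Qed.

Lemma bdd_d2schw z : cabs z < 1 -> bdd_circle (d2schw z).
Proof.
move=> z1; apply: (@bdd_circle_ratio 3 (fun t => 4 * t) z (cabs 4)) => //.
  by move=> w; apply: holoM; [exact: holo_cst|exact: holo_id].
by move=> t t1; rewrite cabsM t1 mulr1.
Qed.

Let near_disk (z w : R[i]) : cabs z < 1 -> cabs (w - z) < (1 - cabs z) / 2 ->
  cabs w < 1 /\ (1 - cabs z) / 2 <= 1 - cabs w.
Proof.
move=> z1 wz; have := cabsD (w - z) z; rewrite subrK => h; split; lra.
Qed.

Lemma schwarz_cder z : cabs z < 1 ->
  cder (fun w => cint (Ku (schw w))) z (cint (Ku (dschw z))).
Proof.
move=> z1; have k0 : 0 < (1 - cabs z) / 2 by rewrite divr_gt0 // subr_gt0.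
pose k := (1 - cabs z) / 2.
apply: (@cint_cder schw dschw z k (cabs 2 / k ^+ 3)) => //.
- by rewrite divr_ge0 ?cabs_ge0 // exprn_ge0 // ltW.
- by move=> w /(near_disk z1)[w1 _]; exact: bdd_schw.
- exact: bdd_dschw.
move=> t w t1 wz; have [w1 kw] := near_disk z1 wz.
have n1 := circle_neq z1 t1; have n2 := circle_neq w1 t1.
have -> : schw w t - schw z t - dschw z t * (w - z) = 2 * t * (w - z) ^+ 2 / ((t - w) * (t - z) ^+ 2).
  by rewrite /schw /dschw; field; rewrite n1 n2.
rewrite cabsM cabsM cabsM t1 mulr1 cabsX cabsV mulrAC ler_wpM2r ?exprn_ge0 ?cabs_ge0 //.
rewrite ler_wpM2l ?cabs_ge0 // lef_pV2 ?posrE ?exprn_gt0 ?cabs_gt0 ?mulf_neq0 ?expf_neq0 //.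
rewrite cabsM cabsX exprS ler_pM ?exprn_ge0 ?(ltW k0) //; first exact: le_trans kw (circle_dist w t1).
rewrite lerXn2r // ?nnegrE ?cabs_ge0 ?(ltW k0) // (le_trans _ (circle_dist z t1)) // /k.
lra.
Qed.

Lemma dschwarz_cder z : cabs z < 1 ->
  cder (fun w => cint (Ku (dschw w))) z (cint (Ku (d2schw z))).
Proof.
move=> z1; have k0 : 0 < (1 - cabs z) / 2 by rewrite divr_gt0 // subr_gt0.
pose k := (1 - cabs z) / 2.
(* In the exact remainder the five factors of the denominator have modulus at least [k], and
   [(t - w) * 3 + (w - z)] has modulus at most 7, rounded up to 10. *)
apply: (@cint_cder dschw d2schw z k (cabs 2 * 10 / k ^+ 5)) => //.
- by rewrite divr_ge0 ?(mulr_ge0 (cabs_ge0 _)) // exprn_ge0 // ltW.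
- by move=> w /(near_disk z1)[w1 _]; exact: bdd_dschw.
- exact: bdd_d2schw.
move=> t w t1 wz; have [w1 kw] := near_disk z1 wz.
have n1 := circle_neq z1 t1; have n2 := circle_neq w1 t1.
have -> : dschw w t - dschw z t - d2schw z t * (w - z) =
    2 * t * (w - z) ^+ 2 * ((t - w) * 3 + (w - z)) / ((t - w) ^+ 2 * (t - z) ^+ 3).
  by rewrite /d2schw /dschw; field; rewrite n1 n2.
have -> : cabs (2 * t * (w - z) ^+ 2 * ((t - w) * 3 + (w - z)) / ((t - w) ^+ 2 * (t - z) ^+ 3)) =
   cabs 2 * cabs ((t - w) * 3 + (w - z)) / cabs ((t - w) ^+ 2 * (t - z) ^+ 3) * cabs (w - z) ^+ 2.
  by rewrite !(cabsM _ _^-1) cabsV !(cabsM _ ((t - w) * 3 + _)) (cabsM (2 * t)) (cabsM 2 t) t1 cabsX; ring.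
rewrite ler_wpM2r ?exprn_ge0 ?cabs_ge0 // ler_pM ?mulr_ge0 ?invr_ge0 ?cabs_ge0 //.
  rewrite ler_wpM2l ?cabs_ge0 // (le_trans (cabsD _ _)) // cabsM.
  have -> : cabs (3 : R[i]) = 3.
    by rewrite -[3]/((3 : R)%:C) || rewrite (_ : (3 : R[i]) = (3 : R)%:C) ?cabs_real ?ger0_norm // rmorph_nat.
  have wz' : cabs (w - z) < 1 by have := cabs_ge0 z; rewrite /k in wz; lra.
  by have := cabsB t w; rewrite t1; lra.
rewrite lef_pV2 ?posrE ?exprn_gt0 ?cabs_gt0 ?mulf_neq0 ?expf_neq0 //.
rewrite cabsM !cabsX (exprD _ 2 3) ler_pM ?exprn_ge0 ?(ltW k0) //.
  by rewrite lerXn2r // ?nnegrE ?cabs_ge0 ?(ltW k0) // (le_trans kw) // circle_dist.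
rewrite lerXn2r // ?nnegrE ?cabs_ge0 ?(ltW k0) // (le_trans _ (circle_dist z t1)) // /k.
lra.
Qed.

End Schwarz.

Lemma Re_schw_circle {R : realType} (z t : R[i]) : cabs z < 1 -> cabs t = 1 ->
  complex.Re (schw z t) = (1 - cabs z ^+ 2) / cabs (t - z) ^+ 2.
Proof.
move=> z1 t1; have n0 := circle_neq z1 t1.
have -> : schw z t = (t + z) * (t - z)^* * ((cabs (t - z) ^+ 2)^-1)%:C.
  rewrite /schw -mulrA; congr (_ * _).
  have -> : ((cabs (t - z) ^+ 2)^-1)%:C = ((cabs (t - z) ^+ 2)%:C)^-1 by exact: fmorphV.
  by rewrite -mul_conj invfM mulrCA divff ?mulr1 // conjc_eq0.
rewrite ReMr; congr (_ / _).
have := cabs_sqr t; rewrite t1 expr1n => ->; rewrite cabs_sqr.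
by rewrite ReM; case: (t) => c s; case: (z) => a b /=; ring.
Qed.

(** * Outer functions and the subharmonicity of log |g| *)

Section LogSubharmonic.
Context {R : realType}.
Implicit Types (f g : R[i] -> R[i]) (t : R) (z : R[i]).
Local Notation Re := complex.Re.
Local Notation Im := complex.Im.
Local Notation mu := (@lebesgue_measure R).

Definition circ : set R := `[0, 2 * pi]%classic.

Lemma circP t : circ t <-> 0 <= t <= 2 * pi.
Proof. by rewrite /circ /= in_itv. Qed.

Lemma measurable_circ : measurable circ. Proof. exact: measurable_itv. Qed.

Lemma measurable_circL : (R.-ocitv.-measurable).-sigma.-measurable circ.
Proof. exact: measurable_circ. Qed.

Let p0 : 0 < 2 * pi :> R. Proof. by rewrite mulr_gt0 // pi_gt0. Qed.

Lemma ae_imply d (T : measurableType d) (nu : {measure set T -> \bar R}) (P Q : T -> Prop) :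
  (forall x, P x -> Q x) -> {ae nu, forall x, P x} -> {ae nu, forall x, Q x}.
Proof.
by move=> PQ [A [mA A0 sA]]; exists A; split=> // x /= nQ; apply: sA => /= /PQ.
Qed.

Lemma ae_and d (T : measurableType d) (nu : {measure set T -> \bar R}) (P Q : T -> Prop) :
  {ae nu, forall x, P x} -> {ae nu, forall x, Q x} -> {ae nu, forall x, P x /\ Q x}.
Proof.
move=> hP hQ; have := negligibleU hP hQ; apply: negligibleS => x /= /not_andP.
by case=> h; [left|right].
Qed.

Lemma rad_left : rad n @[n --> \oo] --> (1 : R)^'-.
Proof.
move=> P /left_nearP[d d0 H].
have /cvgrPdist_lt /(_ _ d0) := rad_cvg (R := R).
apply: filterS => n; rewrite ltr_norml => /andP[_ h]; apply: H; last exact: rad_lt1.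
by rewrite ltrBlDr -ltrBlDl.
Qed.

Lemma rad_seq_cvg g z : holo g z -> (g ((rad n)%:C * z) : R[i]^o) @[n --> \oo] --> (g z : R[i]^o).
Proof.
move=> /holo_continuous gz; apply: cvg_comp gz.
apply/cvg_complexP; have c (a : R) : rad n * a @[n --> \oo] --> a.
  by rewrite -[X in _ --> X]mul1r; apply: cvgMr_tmp; exact: rad_cvg.
by split; [under eq_cvg do rewrite mulrC ReMr mulrC|under eq_cvg do rewrite mulrC ImMr mulrC]; exact: c.
Qed.

Lemma dominated_Rintegral d (T : measurableType d) (nu : {measure set T -> \bar R}) (D : set T) (F : nat -> T -> R) (h k : T -> R) :
  measurable D -> (forall n, measurable_fun D (F n)) -> measurable_fun D h -> nu.-integrable D (EFin \o k) ->
  {ae nu, forall x, D x -> F n x @[n --> \oo] --> h x} ->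
  {ae nu, forall x, forall n, D x -> `|F n x| <= k x} ->
  nu.-integrable D (EFin \o h) /\
  \int[nu]_(x in D) F n x @[n --> \oo] --> \int[nu]_(x in D) h x.
Proof.
move=> mD mF mh ik Fh Fk.
have [|||//||ih _ C] := @dominated_convergence _ _ _ nu D mD (fun n => EFin \o F n) (EFin \o h) (EFin \o k).
- by move=> n; apply/measurable_EFinP.
- by apply/measurable_EFinP.
- apply: ae_imply Fh.
  by move=> x H Dx; apply: cvg_EFin; [exact: nearW|exact: H].
- apply: ae_imply Fk.
  by move=> x H n Dx; rewrite /= lee_fin; exact: H.
split=> //; apply: fine_cvg; rewrite fineK; first exact: C.
exact: integrable_fin_num.
Qed.

Lemma ae_circ (P : R -> Prop) : {ae mu, forall t, 0 < t < 2 * pi -> P t} ->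
  {ae mu, forall t, circ t -> P t}.
Proof.
have neq (a : R) : {ae mu, forall t, t != a}.
  exists [set a]; split; [exact: measurable_set1|exact: lebesgue_measure_set1|].
  by move=> t /= /negP; rewrite negbK => /eqP.
move=> H; have h1 := neq 0; have h2 := neq (2 * pi).
apply: ae_imply (ae_and H (ae_and h1 h2)).
move=> t [{}H [t0 t1]] /circP/andP[a b]; apply: H; apply/andP; split.
  by rewrite lt_neqAle a eq_sym t0.
by rewrite lt_neqAle b t1.
Qed.

Lemma integrable_circ_bounded (h : R -> R) C : measurable_fun circ h -> (forall t, circ t -> `|h t| <= C) ->
  mu.-integrable circ (EFin \o h).
Proof.
move=> mh hC.
have iC : mu.-integrable circ (EFin \o (fun=> C)) by apply: cont_on_int; exact: cont_on_cst.
apply: le_integrable iC => //; first exact: measurable_circ.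
  by apply/measurable_EFinP.
by move=> t ct /=; rewrite lee_fin (le_trans (hC t ct)) // ler_norm.
Qed.

Lemma integrable_circB (g h : R -> R) : mu.-integrable circ (EFin \o g) -> mu.-integrable circ (EFin \o h) ->
  mu.-integrable circ (EFin \o (fun t => g t - h t)).
Proof. by move=> ig ih; exact: (integrableB measurable_circL ig ih). Qed.

Lemma integrable_circZ (a : R) (g : R -> R) : mu.-integrable circ (EFin \o g) ->
  mu.-integrable circ (EFin \o (fun t => a * g t)).
Proof.
move=> ig; have := integrableZl measurable_circL a ig; apply: eq_integrable; first exact: measurable_circL.
by move=> x _ /=; rewrite EFinM.
Qed.

Lemma integrable_circ_cst (a : R) : mu.-integrable circ (EFin \o (fun=> a)).
Proof. by apply: cont_on_int; exact: cont_on_cst. Qed.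

Lemma integrable_poissonM z (u : R -> R) : cabs z < 1 -> mu.-integrable circ (EFin \o u) ->
  mu.-integrable circ (EFin \o (fun t => poisson z t * u t)).
Proof.
move=> z1 iu; pose C := (1 + cabs z) / (1 - cabs z).
have iC : mu.-integrable circ (fun x => C%:E * (u x)%:E)%E by apply: integrableZl => //; exact: measurable_circ.
apply: le_integrable iC => //; first exact: measurable_circ.
  apply/measurable_EFinP; apply: measurable_funM => //.
    by apply: measurable_funTS; apply: continuous_measurable_fun; exact: poisson_continuous.
  by apply/measurable_EFinP; exact: measurable_int iu.
move=> t _ /=; rewrite lee_fin (normrM (poisson z t)) (normrM C) ler_wpM2r //.
have := ler_norm C; have := poisson_le t z1; have := poisson_gt0 t z1; rewrite -/C.
by move: (poisson z t) => p h1 h2; rewrite (gtr0_norm h1); exact: le_trans.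
Qed.

Definition schwarz_int (u : R -> R) (z : R[i]) : R[i] :=
  ((2 * pi)^-1)%:C * cintegral circ (fun t => (cis t + z) / (cis t - z) * (u t)%:C).

Lemma measurable_cis (g : R[i] -> R[i]) : (forall z, cabs z = 1 -> holo g z) ->
  measurable_fun circ (fun t => Re (g (cis t))).
Proof.
move=> hg; apply: measurable_funTS; apply: continuous_measurable_fun.
have [c _] := circle_continuous ler01 hg.
have -> : (fun t => Re (g (cis t))) = (fun t => Re (g (1%:C * cis t))) by apply/funext => t; rewrite mul1r.
exact: c.
Qed.

Lemma schwarz_int_holo u z : mu.-integrable circ (EFin \o u) -> cabs z < 1 -> holo (schwarz_int u) z.
Proof.
move=> iu z1; apply: holoM; first exact: holo_cst.
apply: cder_holo.
exact: (@schwarz_cder R _ (measurableTypeR R) mu circ measurable_circ (@cis R) u (@cabs_cis R) iu measurable_cis z z1).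
Qed.

Lemma Re_schw z t : cabs z < 1 -> Re ((cis t + z) / (cis t - z)) = poisson z t.
Proof. by move=> z1; rewrite -/(schw z (cis t)) Re_schw_circle ?cabs_cis. Qed.

Lemma Re_schwarz_int u z : mu.-integrable circ (EFin \o u) -> cabs z < 1 ->
  Re (schwarz_int u z) = (2 * pi)^-1 * \int[mu]_(t in circ) (poisson z t * u t).
Proof.
move=> iu z1; rewrite /schwarz_int mulrC ReMr mulrC; congr (_ * _).
by rewrite /cintegral /=; apply: eq_Rintegral => t _; rewrite ReMr Re_schw.
Qed.

Lemma cabs_exp_schwarz u z : mu.-integrable circ (EFin \o u) -> cabs z < 1 ->
  cabs (cexp (schwarz_int u z)) = expR ((2 * pi)^-1 * \int[mu]_(t in circ) (poisson z t * u t)).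
Proof. by move=> iu z1; rewrite cabs_cexp Re_schwarz_int. Qed.

Lemma poisson_le_int u z (C : R) : mu.-integrable circ (EFin \o u) -> cabs z < 1 ->
  (forall t, circ t -> u t <= C) -> (2 * pi)^-1 * \int[mu]_(t in circ) (poisson z t * u t) <= C.
Proof.
move=> iu z1 uC; rewrite mulrC ler_pdivrMr // mulrC -(poisson_int z1) mulrC.
rewrite -intZ; last by apply: cont_on_cont; exact: poisson_continuous.
rewrite intE; apply: le_Rintegral => //.
- exact: measurable_circ.
- exact: integrable_poissonM.
- apply: cont_on_int; apply: cont_onM; first exact: cont_on_cst.
  by apply: cont_on_cont; exact: poisson_continuous.
- by move=> t ct; rewrite mulrC ler_wpM2r ?uC // ltW // poisson_gt0.
Qed.

Lemma poisson_kernel_cvg (v : R -> R) th : 0 < th < 2 * pi -> cont_on 0 (2 * pi) v ->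
  (2 * pi)^-1 * int 0 (2 * pi) (fun t => poisson (r%:C * cis th) t * v t) @[r --> (1 : R)^'-] --> v th.
Proof.
move=> thI cv; case/andP: (thI) => th0 th1.
have z1 (r : R) : 0 < r -> r < 1 -> cabs (r%:C * cis th) < 1 by move=> r0 r1; rewrite cabs_rcis // ltW.
pose K (r t : R) := (2 * pi)^-1 * poisson (r%:C * cis th) t.
have cP (r : R) : 0 < r -> r < 1 -> cont_on 0 (2 * pi) (poisson (r%:C * cis th)).
  by move=> r0 r1; apply: cont_on_cont; apply: poisson_continuous; exact: z1.
apply: (@left_eq_cvg _ _ (fun r => int 0 (2 * pi) (fun t => K r t * v t))).
  move=> r /andP[r0 r1]; rewrite -intZ; last by apply: cont_onM => //; exact: cP.
  by apply: eq_int => t _; rewrite /K mulrA.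
apply: (@kernel_cvg _ K v 0 (2 * pi) th 1) => //.
- exact: ltW.
- by rewrite !ltW.
- by move=> r r0 r1; apply: cont_onM; [exact: cont_on_cst|exact: cP].
- move=> d e d0 e0; have [c c0 hc] := @pois_den_far R th d d0.
  have p20 : (2 * pi)^-1 > 0 :> R by rewrite invr_gt0.
  apply/left_nearP; exists (Num.min (1 / 2) (e * c / 2 * (2 * pi))).
    rewrite lt_min divr_gt0 //= (mulr_gt0 _ p0) // divr_gt0 //; exact: mulr_gt0.
  move=> r rm r1 t ht td.
  have m1 : Num.min (1 / 2) (e * c / 2 * (2 * pi)) <= 1 / 2 by rewrite ge_min lexx.
  have m2 : Num.min (1 / 2) (e * c / 2 * (2 * pi)) <= e * c / 2 * (2 * pi) by rewrite ge_min lexx orbT.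
  have r2 : 1 / 2 < r by lra.
  have r0 : 0 < r by lra.
  have r3 : 2 * (1 - r) <= e * c * (2 * pi) by lra.
  have hct := hc t ht td thI.
  have Dc : c <= 1 + r ^+ 2 - 2 * r * cos (t - th).
    have : 1 / 2 * (1 - cos (t - th)) <= r * (1 - cos (t - th)).
      by rewrite ler_wpM2r ?(ltW r2) // subr_ge0 cos_le1.
    by have := sqr_ge0 (1 - r); rewrite !expr2; lra.
  rewrite /K (poisson_pois th t (ltW r0)) /pois ger0_norm; last first.
    apply: mulr_ge0; first exact: ltW.
    apply: divr_ge0; last exact: le_trans (ltW c0) Dc.
    by rewrite subr_ge0 expr_le1 // ltW.
  rewrite mulrC ler_pdivrMr // ler_pdivrMr ?(lt_le_trans c0) //.
  have q1 : 1 - r ^+ 2 <= 2 * (1 - r).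
    by rewrite -subr_ge0 (_ : _ - _ = (1 - r) ^+ 2) ?sqr_ge0 //; ring.
  rewrite (le_trans q1) // (le_trans r3) // mulrAC ler_pM2l //.
  by rewrite mulr_gt0.
- by move=> r t r0 r1 _ _; rewrite /K mulr_ge0 ?invr_ge0 ?(ltW p0) // ltW // poisson_gt0 // z1.
- apply: (@left_eq_cvg _ _ (fun=> 1)); last exact: cvg_cst.
  move=> r /andP[r0 r1]; rewrite intZ; last exact: cP.
  by rewrite poisson_int ?z1 // mulVf // gt_eqF.
Qed.

(* Dividing [g (r * _)] by the outer function of boundary modulus [max |g (r * _)| e] leaves a bounded
   function whose radial limits have modulus at most 1. *)
Lemma log_subharmonic g (M r e : R) z : analytic_disk g -> (forall w, disk w -> cabs (g w) <= M) ->
  0 < r < 1 -> 0 < e -> cabs z < 1 ->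
  cabs (g (r%:C * z)) <= expR ((2 * pi)^-1 *
    \int[mu]_(t in circ) (poisson z t * ln (Num.max (cabs (g (r%:C * cis t))) e))).
Proof.
move=> ag gM /andP[r0 r1] e0 z1.
pose G t := cabs (g (r%:C * cis t)); pose v t := ln (Num.max (G t) e).
have mx0 t : 0 < Num.max (G t) e by rewrite lt_max e0 orbT.
have cG : continuous G.
  have [_ [_ c]] := @circle_continuous _ g r (ltW r0) (fun z hz => analytic_holo ag (eq_ind_r (fun x => x < 1) r1 hz)).
  exact: c.
have cv : continuous v.
  move=> t; apply: continuous_comp; last by apply: continuous_ln; exact: mx0.
  by apply: continuous_max; [exact: cG|exact: cvg_cst].
have iv : mu.-integrable circ (EFin \o v) by apply: cont_on_int; exact: cont_on_cont.
have vge t : - v t <= - ln e by rewrite lerN2 ler_ln ?posrE // le_max lexx orbT.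
have inv : mu.-integrable circ (EFin \o (fun t => - v t)).
  by apply: cont_on_int; apply: cont_onN; exact: cont_on_cont.
pose A w := cexp (schwarz_int (fun t => - v t) w).
pose h w := g (r%:C * w) * A w.
have rz w : cabs w < 1 -> cabs (r%:C * w) < 1.
  by move=> w1; rewrite cabsM cabs_real gtr0_norm // mulr_ilt1 // ?cabs_ge0 // ltW.
have M0 : 0 <= M by rewrite (le_trans (cabs_ge0 (g 0))) // gM //; apply/diskE; rewrite cabs0.
have ah : analytic_disk h.
  move=> w /diskE w1; apply: holoM.
    apply: holo_comp; first by apply: holoM; [exact: holo_cst|exact: holo_id].
    by apply: analytic_holo => //; exact: rz.
  by apply: holo_comp; [exact: schwarz_int_holo|exact: holo_cexp].
have Aabs w : cabs w < 1 -> cabs (A w) = expR ((2 * pi)^-1 * \int[mu]_(t in circ) (poisson w t * (- v t))).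
  by move=> w1; rewrite /A cabs_exp_schwarz.
have hM w : disk w -> cabs (h w) <= M * expR (- ln e).
  move=> /diskE w1; rewrite /h cabsM ler_pM ?cabs_ge0 //; first by apply: gM; apply/diskE; exact: rz.
  by rewrite Aabs // ler_expR; apply: poisson_le_int => // t _; exact: vge.
suff h1 : cabs (h z) <= 1.
  have IN : (2 * pi)^-1 * \int[mu]_(t in circ) (poisson z t * (- v t)) =
      - ((2 * pi)^-1 * \int[mu]_(t in circ) (poisson z t * v t)).
    rewrite -mulrN; congr (_ * _); rewrite -mulN1r -RintegralZl; [|exact: measurable_circ|exact: integrable_poissonM].
    by apply: eq_Rintegral => t _; rewrite mulN1r mulrN.
  move: h1; rewrite /h cabsM Aabs // IN expRN ler_pdivrMr ?expR_gt0 // mul1r.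
  by [].
have [->|hz0] := eqVneq (h z) 0; first by rewrite cabs0.
(* Rotating [h] so that its value at [z] is positive turns [cabs (h z)] into a real part, to which
   the Poisson formula applies. *)
pose c : R[i] := (h z)^* / (cabs (h z))%:C.
have chz : 0 < cabs (h z) by rewrite cabs_gt0.
have c1 : cabs c = 1 by rewrite /c cabsM cabsV cabs_conj cabs_real gtr0_norm // divff // gt_eqF.
have cz : c * h z = (cabs (h z))%:C.
  rewrite /c mulrAC (mulrC _ (h z)) mul_conj -fmorphV -rmorphM; congr (_%:C).
  by rewrite expr2 mulfK // gt_eqF.
have ach : analytic_disk (fun w => c * h w).
  by move=> w dw; apply: holoM; [exact: holo_cst|exact: ah].
have chM w : disk w -> cabs (c * h w) <= M * expR (- ln e) by move=> /hM; rewrite (cabsM c) c1 mul1r.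
pose l t := G t / Num.max (G t) e.
have l1 t : 0 <= l t <= 1.
  by rewrite /l divr_ge0 ?cabs_ge0 ?(ltW (mx0 t)) //= ler_pdivrMr // mul1r le_max lexx.
pose C := (1 + cabs z) / (1 - cabs z) * (M * expR (- ln e)).
have ch n : continuous (fun t => cabs (h ((rad n)%:C * cis t))).
  have hr w : cabs w = rad n -> holo h w by move=> wr; apply: analytic_holo => //; rewrite wr rad_lt1.
  by have [_ [_ c']] := circle_continuous (ltW (rad_gt0 n)) hr.
have cP := poisson_continuous z1.
have DCT := @dominated_Rintegral _ _ mu circ (fun n t => cabs (h ((rad n)%:C * cis t)) * poisson z t) (fun t => l t * poisson z t) (fun=> C).
have [|||||_ L] := DCT measurable_circ.
- move=> n; apply: measurable_funTS; apply: continuous_measurable_fun => t.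
  by apply: cvgM; [exact: ch|exact: cP].
- apply: measurable_funTS; apply: continuous_measurable_fun => t.
  apply: cvgM; last exact: cP.
  apply: cvgM; first exact: cG.
  apply: cvgV; first by rewrite gt_eqF.
  by apply: continuous_max; [exact: cG|exact: cvg_cst].
- by apply: cont_on_int; exact: cont_on_cst.
- apply: ae_circ; apply: aeW => t thI.
  apply: cvgMr_tmp.
  have hE (s : R) : 0 < s < 1 -> cabs (h (s%:C * cis t)) = cabs (g ((r * s)%:C * cis t)) *
      expR ((2 * pi)^-1 * int 0 (2 * pi) (fun x => poisson (s%:C * cis t) x * (- v x))).
    move=> /andP[s0 s1]; rewrite /h cabsM Aabs ?cabs_rcis ?(ltW s0) // intE.
    by rewrite rmorphM mulrA.
  have c2 : cabs (h (s%:C * cis t)) @[s --> (1 : R)^'-] --> l t.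
    apply: (left_eq_cvg hE); apply: cvgM.
      apply: cvg_at_left_filter.
      have c3 : r * s @[s --> (1 : R)] --> r by rewrite -[X in _ --> X]mulr1; apply: cvgMl_tmp; exact: cvg_id.
      have hr : holo g (r%:C * cis t) by apply: analytic_holo => //; rewrite cabs_rcis // ltW.
      have c4 := @cvg_cabs R R (nbhs r) (nbhs_filter r) _ _ (cvg_ray hr).
      exact: (cvg_comp (fun s => r * s) (fun x => cabs (g (x%:C * cis t))) c3 c4).
    have -> : (Num.max (G t) e)^-1 = expR (- v t) by rewrite expRN lnK ?posrE.
    have c5 : cont_on 0 (2 * pi) (fun x => - v x) by apply: cont_onN; exact: cont_on_cont.
    have c6 := poisson_kernel_cvg thI c5.
    by apply: cvg_comp c6 _; exact: continuous_expR.
  exact: cvg_comp rad_left c2.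
- apply: aeW => t n _; have pp := ltW (poisson_gt0 t z1).
  rewrite ger0_norm; last exact: mulr_ge0 (cabs_ge0 _) pp.
  rewrite /C mulrC; apply: ler_pM (pp) (cabs_ge0 _) (poisson_le t z1) _.
  by apply: hM; apply/diskE; rewrite cabs_rcis ?rad_lt1 // ltW // rad_gt0.
have lim1 : 2 * pi * Re (c * h ((rad n)%:C * z)) @[n --> \oo] --> 2 * pi * cabs (h z).
  apply: cvgMl_tmp.
  have -> : cabs (h z) = Re (c * h z) by rewrite cz.
  have hz : holo (fun s => c * h s) z by apply: ach; apply/diskE.
  by have [] := (cvg_complexP _ _).1 (rad_seq_cvg hz).
have le1 n : 2 * pi * Re (c * h ((rad n)%:C * z)) <=
   \int[mu]_(x in circ) (cabs (h ((rad n)%:C * cis x)) * poisson z x).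
  have rn : 0 < (rad n : R) < 1 by rewrite rad_gt0 rad_lt1.
  rewrite -(poisson_formula_disk ach chM rn z1).
  have hr w : cabs w = rad n -> holo (fun w => c * h w) w by move=> wr; apply: analytic_holo => //; rewrite wr rad_lt1.
  have [c8 _] := circle_continuous (ltW (rad_gt0 n)) hr.
  have -> : \int[mu]_(x in circ) (cabs (h ((rad n)%:C * cis x)) * poisson z x) =
    int 0 (2 * pi) (fun x => cabs (h ((rad n)%:C * cis x)) * poisson z x) by rewrite intE.
  apply: le_int.
  - by apply: cont_on_cont => t; apply: cvgM; [exact: c8|exact: cP].
  - by apply: cont_on_cont => t; apply: cvgM; [exact: ch|exact: cP].
  - move=> t _; rewrite ler_wpM2r ?(ltW (poisson_gt0 _ _)) //.
    by rewrite (le_trans (ler_norm _)) // (le_trans (cabs_Re _)) // (cabsM c) c1 mul1r.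
have : 2 * pi * cabs (h z) <= \int[mu]_(x in circ) (l x * poisson z x).
  by apply: ler_cvg_to lim1 L _; exact: nearW.
move=> /le_trans K; have : 2 * pi * cabs (h z) <= 2 * pi; last by rewrite -[leRHS]mulr1 ler_pM2l.
apply: K; rewrite -(poisson_int z1) intE.
have cl : continuous l.
  move=> t; apply: cvgM; first exact: cG.
  apply: cvgV; first by rewrite gt_eqF.
  by apply: continuous_max; [exact: cG|exact: cvg_cst].
apply: le_Rintegral => //.
- exact: measurable_circ.
- by apply: cont_on_int; apply: cont_on_cont => t; apply: cvgM; [exact: cl|exact: cP].
- by apply: cont_on_int; exact: cont_on_cont.
- by move=> t _; rewrite ler_piMl ?(ltW (poisson_gt0 _ _)) //; case/andP: (l1 t).
Qed.

End LogSubharmonic.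

(** * The logarithm of the boundary modulus *)

(** Monotone convergence. The supremum may be infinite on a null set, hence the extended real values
    of [H]. *)
Lemma integrable_sup d (T : measurableType d) (R : realType) (nu : {measure set T -> \bar R}) (D : set T)
    (h : nat -> T -> R) (C : R) : measurable D ->
  (forall n, nu.-integrable D (EFin \o h n)) -> (forall n x, D x -> 0 <= h n x) ->
  (forall n m x, (n <= m)%N -> D x -> h n x <= h m x) ->
  (forall n, \int[nu]_(x in D) h n x <= C) ->
  exists2 H : T -> \bar R, nu.-integrable D H & forall n x, D x -> ((h n x)%:E <= H x)%E.
Proof.
move=> mD ih h0 hnd hC; pose H x := limn (fun n => (h n x)%:E).
have cH x : D x -> (h n x)%:E @[n --> \oo] --> H x.
  move=> Dx; apply: ereal_nondecreasing_is_cvgn => n m nm.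
  by rewrite lee_fin hnd.
have Hge n x : D x -> ((h n x)%:E <= H x)%E.
  move=> Dx; apply: lime_ge; first exact: cH.
  by exists n => // m /= nm; rewrite lee_fin hnd.
have mh n : measurable_fun D (EFin \o h n) by exact: measurable_int (ih n).
exists H => //; apply/integrableP; split.
  apply: (emeasurable_fun_cvg (fun n => EFin \o h n)) => //.
apply: (@le_lt_trans _ _ C%:E); last by rewrite ltry.
have -> : (\int[nu]_(x in D) `|H x| = \int[nu]_(x in D) H x)%E.
  apply: eq_integral => x; rewrite inE => Dx; rewrite gee0_abs //.
  by apply: le_trans (Hge 0%N x Dx); rewrite lee_fin h0.
rewrite /H (monotone_convergence nu mD mh); last 2 first.
- by move=> n x Dx; rewrite lee_fin h0.
- by move=> x Dx n m nm; rewrite lee_fin hnd.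
apply: lime_le.
  apply: ereal_nondecreasing_is_cvgn => n m nm; apply: ge0_le_integral => //.
  - by move=> x Dx; rewrite lee_fin h0.
  - by move=> x Dx; rewrite lee_fin hnd.
apply: nearW => n; rewrite -[leLHS]fineK; last exact: integrable_fin_num.
by rewrite lee_fin; exact: hC.
Qed.

Section BoundaryLog.
Context {R : realType}.
Local Notation Re := complex.Re.
Local Notation Im := complex.Im.
Local Notation mu := (@lebesgue_measure R).
Variables (g : R[i] -> R[i]) (M : R) (N : R -> R) (z0 : R[i]).
Hypothesis ag : analytic_disk g.
Hypothesis gM : forall w, disk w -> cabs (g w) <= M.
Hypothesis mN : measurable_fun (@circ R) N.
Hypothesis N0M : forall t, 0 <= N t <= M.
Hypothesis gN : {ae mu, forall t, circ t -> cabs (g ((rad n)%:C * cis t)) @[n --> \oo] --> N t}.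
Hypothesis z01 : cabs z0 < 1.
Hypothesis gz0 : g z0 != 0.

Let p0 : 0 < 2 * pi :> R. Proof. by rewrite mulr_gt0 // pi_gt0. Qed.

(** At least 1, so that [ln B] bounds the logarithm of [N] and of every truncation level
    [e <= 1]. *)
Let B := M + 1.

Let B1 : 1 <= B.
Proof. by have /andP[a b] := N0M 0; rewrite /B lerDr (le_trans a b). Qed.

Let lnmax (e x : R) : 0 < e <= 1 -> 0 <= x <= M -> ln e <= ln (Num.max x e) <= ln B.
Proof.
move=> /andP[e0 e1] /andP[x0 xM].
have m0 : 0 < Num.max x e by rewrite lt_max e0 orbT.
have B0 : 0 < B by apply: lt_le_trans B1.
rewrite !ler_ln ?posrE // le_max lexx orbT /= ge_max (le_trans e1 B1) andbT (le_trans xM) //.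
by rewrite /B lerDl.
Qed.

Let lnmax_abs (e x : R) : 0 < e <= 1 -> 0 <= x <= M -> `|ln (Num.max x e)| <= ln B - ln e.
Proof.
move=> he hx; have /andP[a b] := lnmax he hx; case/andP: he => e0 e1.
have le0 : ln e <= 0 by rewrite -ln1 ler_ln ?posrE.
have lB : 0 <= ln B by rewrite ln_ge0.
by rewrite ler_norml; apply/andP; split; lra.
Qed.

Let mlnmax e : measurable_fun (@circ R) (fun t => ln (Num.max (N t) e)).
Proof. by apply: measurableT_comp => //; apply: measurable_maxr. Qed.

Let ilnmax e : 0 < e <= 1 -> mu.-integrable circ (EFin \o (fun t => ln (Num.max (N t) e))).
Proof.
move=> he; apply: (@integrable_circ_bounded _ _ (ln B - ln e)) => //.
by move=> t _; apply: lnmax_abs.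
Qed.

(** This is [log_subharmonic] on the radii [rad n], carried to the circle by dominated convergence:
    truncation at [e] keeps the logarithms bounded. *)
Let log_le_max e z : 0 < e <= 1 -> cabs z < 1 ->
  cabs (g z) <= expR ((2 * pi)^-1 * \int[mu]_(t in circ) (poisson z t * ln (Num.max (N t) e))).
Proof.
move=> he z1; case/andP: (he) => e0 e1; pose C := (1 + cabs z) / (1 - cabs z) * (ln B - ln e).
have cP := poisson_continuous z1.
have cg n : continuous (fun t => ln (Num.max (cabs (g ((rad n)%:C * cis t))) e)).
  have hr w : cabs w = rad n -> holo g w by move=> wr; apply: analytic_holo => //; rewrite wr rad_lt1.
  have [_ [_ c]] := circle_continuous (ltW (rad_gt0 n)) hr.
  move=> t; apply: continuous_comp.
    by apply: continuous_max; [exact: c|exact: cvg_cst].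
  by apply: continuous_ln; rewrite lt_max e0 orbT.
have DCT := @dominated_Rintegral _ _ _ mu circ (fun n t => poisson z t * ln (Num.max (cabs (g ((rad n)%:C * cis t))) e))
  (fun t => poisson z t * ln (Num.max (N t) e)) (fun=> C).
have ml := mlnmax e.
have [|||||_ L] := DCT measurable_circ.
- move=> n; apply: measurable_funTS; apply: continuous_measurable_fun => t.
  by apply: cvgM; [exact: cP|exact: cg].
- apply: measurable_funM => //.
  by apply: measurable_funTS; exact: continuous_measurable_fun.
- by apply: cont_on_int; exact: cont_on_cst.
- apply: ae_imply gN => t ht ct; apply: cvgMl_tmp.
  apply: (@cvg_comp _ _ _ (fun n => Num.max (cabs (g ((rad n)%:C * cis t))) e) (@ln R)); last first.
    by apply: continuous_ln; rewrite lt_max e0 orbT.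
  apply: (@cvg_comp _ _ _ _ (fun y : R => Num.max y e)); first exact: ht.
  by apply: (@continuous_max R R id (cst e)); [exact: cvg_id|exact: cvg_cst].
- apply: aeW => t n _; have pp := ltW (poisson_gt0 t z1).
  rewrite (normrM (poisson z t)) /C (ger0_norm pp); apply: ler_pM (pp) (normr_ge0 _) (poisson_le t z1) _.
  apply: lnmax_abs => //; rewrite cabs_ge0 gM //; apply/diskE.
  by rewrite cabs_rcis ?rad_lt1 // ltW // rad_gt0.
have L2 : expR ((2 * pi)^-1 * \int[mu]_(t in circ) (poisson z t * ln (Num.max (cabs (g ((rad n)%:C * cis t))) e)))
   @[n --> \oo] --> expR ((2 * pi)^-1 * \int[mu]_(t in circ) (poisson z t * ln (Num.max (N t) e))).
  apply: (@cvg_comp _ _ _ _ (@expR R)); last exact: continuous_expR.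
  by apply: cvgMl_tmp; exact: L.
have /(_ eventually_filter) L1 := cvg_cabs (rad_seq_cvg (analytic_holo ag z1)).
apply: ler_cvg_to L1 L2 _; apply: nearW => n.
by apply: (log_subharmonic ag gM) => //; rewrite rad_gt0 rad_lt1.
Qed.

Let e_ (k : nat) : R := k.+1%:R^-1.

Let e_I k : 0 < e_ k <= 1.
Proof. by rewrite invr_gt0 ltr0n /= invf_le1 ?ltr0n // ler1n. Qed.

Let e_nd k l : (k <= l)%N -> e_ l <= e_ k.
Proof. by move=> kl; rewrite lef_pV2 ?posrE ?ltr0n // ler_nat. Qed.

Let h k t := ln B - ln (Num.max (N t) (e_ k)).

Let ih k : mu.-integrable circ (EFin \o h k).
Proof.
exact: integrable_circB (integrable_circ_cst _) (ilnmax (e_I k)).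
Qed.

Let h0 k t : 0 <= h k t.
Proof. by rewrite subr_ge0; have /andP[] := lnmax (e_I k) (N0M t). Qed.

(** By [log_le_max] at the point [z0], where [g] does not vanish, the Poisson integrals of all [h n]
    are bounded in terms of [ln B - ln (cabs (g z0))]. The Poisson kernel at [z0] is at least [q],
    so the plain integrals are bounded too. *)
Let hint : exists2 H : R -> \bar R, mu.-integrable circ H & forall n x, circ x -> ((h n x)%:E <= H x)%E.
Proof.
pose q := (1 - cabs z0) / (1 + cabs z0).
have q0 : 0 < q by rewrite divr_gt0 ?subr_gt0 // ltr_wpDr ?cabs_ge0.
pose C := 2 * pi * (ln B - ln (cabs (g z0))) / q.
apply: (@integrable_sup _ (measurableTypeR R) R mu circ h C measurable_circ ih) => //.
  move=> n m x nm _; rewrite /h lerD2l lerN2 ler_ln ?posrE; last 2 first.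
  - by rewrite lt_max; case/andP: (e_I m) => ->; rewrite orbT.
  - by rewrite lt_max; case/andP: (e_I n) => ->; rewrite orbT.
  by rewrite ge_max le_max lexx /= le_max e_nd ?orbT.
move=> n; rewrite ler_pdivlMr // mulrC -RintegralZl; [|exact: measurable_circ|exact: ih].
have L := log_le_max (e_I n) z01; rewrite -ler_ln ?posrE ?expR_gt0 ?cabs_gt0 // expRK in L.
have iP := integrable_poissonM z01 (ih n).
have E : \int[mu]_(t in circ) (poisson z0 t * h n t) =
   2 * pi * ln B - \int[mu]_(t in circ) (poisson z0 t * ln (Num.max (N t) (e_ n))).
  have -> : 2 * pi * ln B = \int[mu]_(t in circ) (poisson z0 t * ln B).
    rewrite -(poisson_int z01) intE RintegralZr //; first exact: measurable_circ.
    by apply: cont_on_int; apply: cont_on_cont; exact: poisson_continuous.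
  rewrite -RintegralB; [|exact: measurable_circ| |exact: integrable_poissonM z01 (ilnmax (e_I n))].
    by apply: eq_Rintegral => t _; rewrite /h mulrBr.
  apply: integrable_poissonM => //; apply: cont_on_int; exact: cont_on_cst.
apply: (@le_trans _ _ (\int[mu]_(t in circ) (poisson z0 t * h n t))).
  apply: le_Rintegral => //; first exact: measurable_circ.
    exact: integrable_circZ (ih n).
  by move=> t _; rewrite ler_wpM2r // poisson_ge.
rewrite E /= mulrBr lerD2l lerN2 -ler_pdivlMl //.
Qed.

(** Where [N] vanishes, [h n] grows like the logarithm of n, against the finite value of [H].
    Integrability of [ln (N t)] cannot express this, because [ln 0] is 0 by convention. *)
Lemma boundary_log_pos : {ae mu, forall t, circ t -> 0 < N t}.
Proof.
have [H iH hH] := hint; have A := integrable_ae measurable_circL iH; apply: ae_imply A => t fH ct.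
have /andP[Nt0 _] := N0M t; rewrite lt_neqAle Nt0 andbT eq_sym; apply/negP => /eqP E.
have := fH ct; case: (H t) (fun n => hH n t ct) => // x hx _.
have [n hn] : exists n : nat, expR (x - ln B) < n.+1%:R.
  by exists (Num.truncn (expR (x - ln B))); rewrite truncnS_gt.
have := hx n; rewrite lee_fin /h E max_r; last by case/andP: (e_I n) => /ltW.
rewrite /e_ lnV ?posrE ?ltr0n // opprK -lerBrDl leNgt => /negP; apply.
by rewrite -ltr_expR lnK ?posrE ?ltr0n.
Qed.

Lemma boundary_log_integrable : mu.-integrable circ (EFin \o (fun t => ln (N t))).
Proof.
have [H iH hH] := hint.
have iHB : mu.-integrable circ (fun t => H t + (ln B)%:E)%E.
  apply: integrableD => //; first exact: measurable_circ.
  by apply: cont_on_int; exact: cont_on_cst.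
apply: le_integrable iHB; first exact: measurable_circ.
  by apply/measurable_EFinP; apply: measurableT_comp.
have lB : 0 <= ln B by rewrite ln_ge0.
move=> t ct /=; have /andP[Nt0 NtM] := N0M t.
have H0 : (0 <= H t)%E by apply: le_trans (hH 0%N t ct); rewrite lee_fin.
rewrite (@gee0_abs _ (_ + _)%E); last by rewrite adde_ge0.
(* At a zero of [N] the default value of [ln] makes the bound trivial. *)
move: Nt0; rewrite le_eqVlt => /orP[/eqP <-|Nt0].
  by rewrite ln0 // normr0 adde_ge0.
have [n hn] : exists n : nat, (N t)^-1 < n.+1%:R by exists (Num.truncn (N t)^-1); rewrite truncnS_gt.
have eN : e_ n <= N t by rewrite /e_ -[leRHS]invrK lef_pV2 ?posrE ?invr_gt0 ?ltr0n // ltW.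
have := hH n t ct; rewrite /h max_l // => h1.
have /andP[_ h2] := lnmax (e_I n) (N0M t); rewrite max_l // in h2.
apply: (@le_trans _ _ ((ln B - ln (N t))%:E + (ln B)%:E)%E); last by rewrite leeD2r.
by rewrite -EFinD lee_fin ler_norml; apply/andP; split; lra.
Qed.

(** Jensen's inequality, from [log_le_max] as the truncation level tends to 0. Since the levels are
    at most 1, truncation never increases the absolute value of [ln (N t)], which therefore
    dominates. *)
Lemma boundary_log_le z : cabs z < 1 -> g z != 0 ->
  ln (cabs (g z)) <= (2 * pi)^-1 * \int[mu]_(t in circ) (poisson z t * ln (N t)).
Proof.
move=> z1 gz; have cP := poisson_continuous z1.
pose C := (1 + cabs z) / (1 - cabs z).
have C0 : 0 <= C by apply: divr_ge0; [rewrite addr_ge0 ?cabs_ge0|rewrite subr_ge0 ltW].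
have DCT := @dominated_Rintegral _ _ _ mu circ (fun n t => poisson z t * ln (Num.max (N t) (e_ n)))
  (fun t => poisson z t * ln (N t)) (fun t => C * (`|ln (N t)|)).
have mP : measurable_fun (@circ R) (poisson z).
  by apply: measurable_funTS; exact: continuous_measurable_fun.
have [|||||_ L] := DCT measurable_circ.
- by move=> n; have ml := mlnmax (e_ n); apply: measurable_funM.
- have ml : measurable_fun circ (fun t => ln (N t)) by apply: measurableT_comp.
  by apply: measurable_funM.
- apply: integrable_circZ; exact: integrable_norm boundary_log_integrable.
- apply: ae_imply boundary_log_pos => t Np ct; apply: cvgMl_tmp.
  apply: cvg_near_cst.
  exists (Num.truncn (N t)^-1) => // n /= hn.
  rewrite max_l // /e_ -[leRHS]invrK lef_pV2 ?posrE ?invr_gt0 ?ltr0n ?Np //.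
  by rewrite (le_trans (ltW (truncnS_gt _))) // ler_nat ltnS.
- apply: ae_imply boundary_log_pos => t Np n ct; have {}Np := Np ct.
  have pp := ltW (poisson_gt0 t z1).
  rewrite (normrM (poisson z t)) (ger0_norm pp); apply: ler_pM (pp) (normr_ge0 _) (poisson_le t z1) _.
  have /andP[e0 e1] := e_I n.
  rewrite /Num.max; case: ltP => // Ne.
  have l0 : ln (e_ n) <= 0 by rewrite -ln1 ler_ln ?posrE.
  have l1 : ln (N t) <= ln (e_ n) by rewrite ler_ln ?posrE // ltW.
  by rewrite !ler0_norm ?lerN2 // (le_trans l1).
have L2 : (2 * pi)^-1 * \int[mu]_(t in circ) (poisson z t * ln (Num.max (N t) (e_ n)))
   @[n --> \oo] --> (2 * pi)^-1 * \int[mu]_(t in circ) (poisson z t * ln (N t)).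
  by apply: cvgMl_tmp; exact: L.
apply: ler_cvg_to (cvg_cst _) L2 _; apply: nearW => n.
by have := log_le_max (e_I n) z1; rewrite -ler_ln ?posrE ?expR_gt0 ?cabs_gt0 // expRK.
Qed.

End BoundaryLog.

(** * Translation of null sets and periodic properties *)

Section Periodic.
Context {R : realType}.
Local Notation mu := (@lebesgue_measure R).

(* Every covering of A by intervals translates to one of the same total length. *)
Lemma lebesgue_shift_null (a : R) (A : set R) : mu A = 0%E -> mu [set x | A (x - a)] = 0%E.
Proof.
move=> A0; apply/eqP; rewrite eq_le; apply/andP; split; last exact: mu_ext_ge0.
apply/lee_addgt0Pr => e e0; rewrite add0e.
have E (B : set R) : mu B = ereal_inf [set (\sum_(k <oo) wlength idfun (F k))%E |
  F in measurable_cover (B : set (ocitv_type R))] by [].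
have [|x [F [mF AF] <-{x}]] := @lb_ereal_inf_adherent R
  [set (\sum_(k <oo) wlength idfun (F k))%E | F in measurable_cover (A : set (ocitv_type R))] _ e0.
  by rewrite -(E A) A0.
rewrite -(E A) A0 add0e => Fe; apply: le_trans (ltW Fe).
rewrite E; apply: ereal_inf_lbound.
exists (fun k => [set x | F k (x - a)]).
  split.
    move=> n; have [[u v] _ <-] := mF n; exists (u + a, v + a) => //=.
    by apply/seteqP; split=> x /=; rewrite !in_itv /= ltrBrDr lerBlDr.
  by move=> x /= /AF[n _ Fn]; exists n.
apply: eq_eseriesr => n _; have [[u v] _ <-] := mF n.
have -> : [set x : R | `]u, v]%classic (x - a)] = `]u + a, v + a]%classic.
  by apply/seteqP; split=> x /=; rewrite !in_itv /= ltrBrDr lerBlDr.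
have [uv|vu] := leP u v.
  by rewrite !wlength_itv_bnd ?lerD2r //=; congr EFin; ring.
rewrite !set_itv_ge ?wlength0 // bnd_simp -leNgt ?lerD2r; exact: ltW.
Qed.

Lemma ae_shift (a : R) (P : R -> Prop) : {ae mu, forall x, P x} -> {ae mu, forall x, P (x - a)}.
Proof.
move=> [A [mA A0 PA]]; exists [set x | A (x - a)]; split.
- have mf : measurable_fun setT (fun x : R => x - a).
    by apply: continuous_measurable_fun => x; apply: cvgB; [exact: cvg_id|exact: cvg_cst].
  by have := mf measurableT _ mA; rewrite setTI.
- exact: lebesgue_shift_null.
- by move=> x /= h; apply: PA.
Qed.

(** [inner] speaks of all real angles, the estimates of one period; the countably many translates of
    the exceptional set still form a null set. *)
Lemma ae_periodic (p : R) (P : R -> Prop) : 0 < p -> (forall x, P (x + p) -> P x) -> (forall x, P x -> P (x + p)) ->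
  {ae mu, forall x, 0 <= x <= p -> P x} -> {ae mu, forall x, P x}.
Proof.
move=> p0 P1 P2 h.
have Pn x n : P (x + n%:R * p) <-> P x.
  elim: n => [|n ih]; first by rewrite mul0r addr0.
  by rewrite -addn1 natrD mulrDl mul1r addrA; split=> [/P1/ih|/ih/P2].
have h1 : {ae mu, forall x, forall n : nat, 0 <= x - n%:R * p <= p -> P (x - n%:R * p)}.
  by apply: ae_foralln => n; exact: ae_shift (n%:R * p) _ h.
have h2 : {ae mu, forall x, forall n : nat, 0 <= x - (- (n%:R * p)) <= p -> P (x - (- (n%:R * p)))}.
  by apply: ae_foralln => n; exact: ae_shift (- (n%:R * p)) _ h.
apply: ae_imply (ae_and h1 h2) => x [{}h1 {}h2].
pose k := Num.floor (x / p).
have k1 : k%:~R * p <= x by rewrite -ler_pdivlMr // floor_le.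
have k2 : x <= k%:~R * p + p.
  have -> : k%:~R * p + p = (k + 1)%:~R * p by rewrite intrD mulrDl mul1r.
  by rewrite -ler_pdivrMr // ltW // floorD1_gt.
move: k1 k2; case: k => n k1 k2.
  have := h1 n; rewrite -pmulrn in k1 k2; rewrite subr_ge0 k1 lerBlDl k2 => /(_ isT) h3.
  by have := (Pn (x - n%:R * p) n).2 h3; rewrite subrK.
have e : (Negz n)%:~R = - n.+1%:R :> R by rewrite NegzE mulrNz.
have := h2 n.+1; rewrite e mulNr in k1 k2; rewrite subr_ge0 k1 lerBlDl k2 => /(_ isT).
by rewrite opprK => /Pn.
Qed.

End Periodic.

(** * Boundary moduli of bounded functions *)

Section Radial.
Context {R : realType}.
Local Notation mu := (@lebesgue_measure R).

(** The upper limit along [rad] is measurable, and clamping it to [0, M] makes the bounds valid at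
    every angle, including those without a radial limit. *)
Lemma radial_modulus (g : R[i] -> R[i]) (M : R) : analytic_disk g -> (forall w, disk w -> cabs (g w) <= M) ->
  exists N : R -> R, [/\ measurable_fun (@circ R) N, forall t, 0 <= N t <= M &
    {ae mu, forall t, circ t -> exists2 w : R[i],
      (g (r%:C * cis t) : R[i]^o) @[r --> (1 : R)^'-] --> (w : R[i]^o) & N t = cabs w}].
Proof.
move=> ag gM; have M0 : 0 <= M by rewrite (le_trans (cabs_ge0 (g 0))) // gM //; apply/diskE; rewrite cabs0.
pose G n t := cabs (g ((rad n)%:C * cis t)).
have rd n t : disk ((rad n)%:C * cis t : R[i]).
  by apply/diskE; rewrite cabs_rcis ?rad_lt1 // ltW // rad_gt0.
pose L t := limn_sup (fun n => G n t).
have mL : measurable_fun (@circ R) L.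
  apply: measurable_fun_limn_sup.
  - by move=> t _; exists M => _ [n _ <-]; exact: gM.
  - by move=> t _; exists 0 => _ [n _ <-]; exact: cabs_ge0.
  - move=> n; apply: measurable_funTS; apply: continuous_measurable_fun.
    have hr w : cabs w = rad n -> holo g w by move=> wr; apply: analytic_holo => //; rewrite wr rad_lt1.
    by have [_ [_ c]] := circle_continuous (ltW (rad_gt0 n)) hr.
exists (fun t => Num.max 0 (Num.min M (L t))); split.
- by apply: measurable_maxr => //; apply: measurable_minr.
- by move=> t; rewrite le_max lexx /= ge_max M0 ge_min lexx.
apply: ae_circ; apply: ae_imply (radial_limit_ae ag gM) => t ht t2; have [w gw] := ht t2; exists w => //.
have c1 : G n t @[n --> \oo] --> cabs w.
  apply: (@cvg_comp _ _ _ (@rad R) (fun r => cabs (g (r%:C * cis t))) _ _ _ rad_left).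
  exact: cvg_cabs gw.
have -> : L t = cabs w by exact: (cvg_limn_inf_sup c1).2.
have wM : cabs w <= M by apply: ler_cvg_to c1 (cvg_cst M) _; apply: nearW => n; exact: gM.
by rewrite min_r // max_r // cabs_ge0.
Qed.

Lemma ae_eq0_int_le0 (h : R -> R) : mu.-integrable circ (EFin \o h) ->
  {ae mu, forall t, circ t -> 0 <= h t} -> \int[mu]_(t in circ) h t <= 0 ->
  {ae mu, forall t, circ t -> h t = 0}.
Proof.
move=> ih h0 hle; have mh := measurable_int _ ih.
have E : (\int[mu]_(t in circ) `|(h t)%:E| = \int[mu]_(t in circ) (h t)%:E)%E.
  apply: ae_eq_integral; [exact: measurable_circL|exact: measurableT_comp|exact: mh|].
  by apply: ae_imply h0 => t h0 ct; rewrite gee0_abs // lee_fin h0.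
have Z : (\int[mu]_(t in circ) `|(h t)%:E| = 0)%E.
  apply/eqP; rewrite eq_le integral_ge0 ?andbT; last by move=> t _; exact: abse_ge0.
  rewrite E -[leLHS]fineK; last by apply: integrable_fin_num ih; exact: measurable_circL.
  by rewrite lee_fin.
have := (ae_eq_integral_abs mu measurable_circL mh).1 Z.
by apply: ae_imply => t h1 ct; have [] := h1 ct.
Qed.

Lemma ae_circ_exists (P : R -> Prop) : {ae mu, forall t, circ t -> P t} -> exists2 t, circ t & P t.
Proof.
move=> [A [mA A0 PA]]; apply: contrapT => nP.
have cA : circ `<=` A by move=> t ct; apply: PA => /= h; apply: nP; exists t => //; exact: h.
have : (mu circ <= 0)%E by rewrite -A0; apply: le_measure => //; rewrite inE //; exact: measurable_circL.
rewrite /circ lebesgue_measure_itv /= lte_fin mulr_gt0 ?pi_gt0 //= -EFinB lee_fin subr0.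
by rewrite leNgt mulr_gt0 ?pi_gt0.
Qed.

End Radial.

(** * The Martin function as a series *)

Section Enumeration.
Import finmap.
Context {R : realType}.
Local Notation nu := (@counting nat R).

Lemma measurable_nat d (U : measurableType d) (f : nat -> U) : measurable_fun setT f.
Proof. by []. Qed.

(** For each [k] only finitely many terms are at least [k.+1%:R^-1]. *)
Lemma countable_support (I : choiceType) (D : set I) (S : I -> R) :
  (forall g, D g -> 0 <= S g) -> (\esum_(g in D) (S g)%:E < +oo)%E ->
  countable [set g | D g /\ 0 < S g].
Proof.
move=> S0 Soo; pose A k : set I := [set g | D g /\ k.+1%:R^-1 <= S g].
apply: (@sub_countable _ _ _ (\bigcup_k A k)).
  apply: subset_card_le => g [Dg Sg]; exists (Num.truncn (S g)^-1) => //; split => //.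
  rewrite -[leRHS]invrK lef_pV2 ?posrE ?invr_gt0 // ltW //; exact: truncnS_gt.
apply: bigcup_countable; first exact: countableP.
move=> k _; apply: finite_set_countable; apply: contrapT => infA.
have fE : (\esum_(g in D) (S g)%:E \is a fin_num)%E.
  by rewrite ge0_fin_numE //; apply: esum_ge0 => g Dg; rewrite lee_fin S0.
pose s := fine (\esum_(g in D) (S g)%:E)%E.
pose n := (Num.truncn (s * k.+1%:R)).+1.
have [B BA nB] := infinite_set_fset n infA.
have : ((n%:R / k.+1%:R)%:E <= \esum_(g in D) (S g)%:E)%E.
  apply: esum_ge; exists [set` B]; first by split; [exact: finite_fset|move=> g /BA []].
  rewrite fsbig_finite ?finite_fset //= set_fsetK.
  rewrite sumEFin lee_fin.
  apply: (@le_trans _ _ (\sum_(i <- B) k.+1%:R^-1)).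
    by rewrite big_const_seq count_predT iter_addr_0 -[leRHS]mulr_natl ler_wpM2r // ler_nat.
  rewrite !big_seq; apply: ler_sum => g gB.
  by have [_] := BA g gB.
rewrite -(fineK fE) lee_fin -/s ler_pdivrMr ?ltr0n // leNgt truncnS_gt //.
Qed.

Lemma integral_counting_pt (k : nat) (a : R) :
  nu.-integrable setT (EFin \o (fun n => if n == k then a else 0)) /\
  \int[nu]_(n in setT) (if n == k then a else 0) = a.
Proof.
have E : (fun n => if n == k then a else 0) = (fun=> a) \_ [set k].
  by apply/funext => n; rewrite patchE in_set1.
have c1 : nu [set k] = 1%E by rewrite /counting asboolT //= fset_set1 cardfs1.
have m1 : measurable [set k] by [].
rewrite E; split.
  rewrite -restrict_EFin -integrable_mkcond //.
  apply/integrableP; split=> //=.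
  by rewrite integral_cst //= c1 mule1 ltry.
by rewrite -Rintegral_mkcond Rintegral_cst //= c1 mulr1.
Qed.

(** Moves the sum over [D] to an integral for the counting measure on [nat]. [e] enumerates the
    terms of positive weight; at the remaining indices [c] is 0 and [e] takes the default [i0]. Once
    a finite set contains the first N enumerated terms, the error is at most a constant times the
    tail of [c]. *)
Lemma unconditional_sum (I : choiceType) (i0 : I) (D : set I) (S : I -> R) :
  (forall g, D g -> 0 <= S g) -> (\esum_(g in D) (S g)%:E < +oo)%E ->
  exists (e : nat -> I) (c : nat -> R),
  [/\ forall n, 0 <= c n, nu.-integrable setT (EFin \o c),
      forall n, c n != 0 -> D (e n),
      forall g, D g -> 0 < S g -> exists k, e k = g /\ c k = S g &
      forall (phi : I -> R) (K : R), (forall g, D g -> `|phi g| <= K) ->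
        summability.partial_sum (fun g => if g \in D then phi g * S g else 0) A
          @[A --> summability.totally] -->
        \int[nu]_(n in setT) (phi (e n) * c n)].
Proof.
move=> S0 Soo; have /countable_injP[f injf] := countable_support S0 Soo.
set G := [set g | D g /\ 0 < S g] in injf.
pose ex n := `[< exists2 g, G g & f g = n >].
pose e n := xget i0 [set g | G g /\ f g = n].
pose c n := if ex n then S (e n) else 0.
have eP n : ex n -> G (e n) /\ f (e n) = n.
  move=> /asboolP[g Gg gn]; have := xgetPex i0 (ex_intro (fun g => G g /\ f g = n) g (conj Gg gn)).
  exact.
have ef g : G g -> ex (f g) /\ e (f g) = g.
  move=> Gg; have x : ex (f g) by apply/asboolP; exists g.
  by split=> //; have [Ge fe] := eP _ x; apply: injf; rewrite // mem_set.
have c0 n : 0 <= c n by rewrite /c; case: ifP => // /eP[[Dg _] _]; exact: S0.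
have cD n : c n != 0 -> ex n by rewrite /c; case: ifP => //; rewrite eqxx.
have ic : nu.-integrable setT (EFin \o c).
  apply/integrableP; split=> //.
  have -> : (\int[nu]_(x in setT) `|(EFin \o c) x| = \int[nu]_(x in setT) (c x)%:E)%E.
    by apply: eq_integral => n _ /=; rewrite ger0_norm.
  rewrite ge0_integral_count; last by move=> n; rewrite lee_fin.
  rewrite nneseries_esumT; last by move=> n; rewrite lee_fin.
  have -> : (\esum_(i in setT) (c i)%:E = \esum_(i in setT) if i \in f @` G then (S (e i))%:E else 0)%E.
    apply: eq_esum => n _; rewrite /c; have -> : ex n = (n \in f @` G); last by case: ifP.
    by apply/asboolP/idP => [[g Gg gn]|/set_mem[g Gg gn]]; [apply/mem_set; exists g|exists g].
  rewrite -esum_mkcond (@reindex_esum _ _ _ G (f @` G) f); last first.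
    by split => // g Gg; exists g.
  apply: le_lt_trans Soo; have -> : G = D `&` [set g | 0 < S g] by [].
  rewrite esum_mkcondr; apply: le_esum => g Dg; case: ifPn; last by rewrite lee_fin S0.
  by move=> /set_mem Sg; have [_ ->] := ef g (conj Dg Sg).
exists e, c; split=> //.
- by move=> n /cD/eP[[]].
- by move=> g Dg Sg; exists (f g); have [x eg] := ef g (conj Dg Sg); rewrite /c x eg.
move=> phi K phiK.
have iB (v : nat -> R) : (forall n, `|v n| <= c n) -> nu.-integrable setT (EFin \o v).
  move=> vc; apply: le_integrable ic => //.
  by move=> n _ /=; rewrite lee_fin (le_trans (vc n)) // ler_norm.
have iBK (v : nat -> R) : (forall n, `|v n| <= `|K| * c n) -> nu.-integrable setT (EFin \o v).
  move=> vc; have iK : nu.-integrable setT (fun n => `|K|%:E * (c n)%:E)%E by exact: integrableZl.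
  apply: le_integrable iK => //.
  by move=> n _ /=; rewrite lee_fin (le_trans (vc n)) // ler_norm.
have bphi n : `|phi (e n) * c n| <= `|K| * c n.
  rewrite normrM (ger0_norm (c0 n)); have [->|cn] := eqVneq (c n) 0; first by rewrite !mulr0.
  rewrite ler_wpM2r // (le_trans (phiK _ _)) ?ler_norm //; by have [[]] := eP _ (cD _ cn).
pose v (B : seq I) n := if e n \in B then phi (e n) * c n else 0.
have ivB B : nu.-integrable setT (EFin \o v B).
  by apply: iBK => n; rewrite /v; case: ifP => // _; rewrite normr0 mulr_ge0.
have sumB (B : seq I) : uniq B -> \sum_(g <- B) (if g \in D then phi g * S g else 0) = \int[nu]_(n in setT) v B n.
  elim: B => [_|g B ih /= /andP[gB uB]].
    by rewrite big_nil [RHS](_ : _ = \int[nu]_(n in setT) (cst 0 n)) // Rintegral_cst // mul0r.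
  rewrite big_cons ih //.
  pose a := if g \in D then phi g * S g else 0.
  have [ip ipE] := integral_counting_pt (f g) a.
  rewrite -[X in X + _]ipE -RintegralD //; apply: eq_Rintegral => n _.
  rewrite /v in_cons /a; have [->{n}|nf] := eqVneq n (f g).
    have [gG|gG] := pselect (G g).
      have [x eg] := ef g gG; rewrite eg eqxx /= (negbTE gB) addr0 mem_set; last by case: gG.
      by rewrite /c x eg.
    have a0 : (if g \in D then phi g * S g else 0) = 0.
      case: ifPn => // /set_mem Dg; have [->|Sg] := eqVneq (S g) 0; first by rewrite mulr0.
      by exfalso; apply: gG; split=> //; rewrite lt_neqAle eq_sym Sg S0.
    rewrite a0 add0r; case: eqP => //= eg.
    have : ~~ ex (f g) by apply/negP => /eP[]; rewrite eg.
    by rewrite /c => /negbTE ->; rewrite mulr0 eg (negbTE gB).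
  rewrite add0r; case: eqP => //= eg; rewrite eg (negbTE gB).
  suff -> : c n = 0 by rewrite mulr0.
  apply/eqP; apply/negPn/negP => /cD /eP[_]; rewrite eg => fn.
  by rewrite fn eqxx in nf.
have tail : \int[nu]_(n in setT) (if (n < N)%N then 0 else c n) @[N --> \oo] --> (0 : R).
  have z0 : \int[nu]_(n in setT) (0 : R) = 0 by rewrite Rintegral_cst // mul0r.
  rewrite -[X in _ --> X]z0.
  have [|||||_ L] // := @dominated_Rintegral R _ _ nu setT (fun N n => if (n < N)%N then 0 else c n) (fun=> 0) c measurableT.
  - apply: aeW => n _; apply: cvg_near_cst; exists n.+1 => // N /= nN.
    by rewrite nN.
  - by apply: aeW => n N _; case: ifP; rewrite ?normr0 // ger0_norm.
have PF := @summability.totally_filter I.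
have FF : Filter (@summability.totally I) by exact: PF.
apply/cvgrPdist_le => eps eps0.
have K0 : 0 < `|K| + 1 by rewrite ltr_wpDl.
have e1 : 0 < eps / (`|K| + 1) by rewrite divr_gt0.
have /cvgrPdist_le/(_ _ e1)[N _ hN] := tail.
have {hN} := hN N (leqnn N); rewrite sub0r normrN => hN.
exists (fset_set (e @` `I_N)) => // B /= AB.
have Ps : summability.partial_sum (fun g => if g \in D then phi g * S g else 0) B = \int[nu]_(n in setT) v B n.
  rewrite -sumB ?fset_uniq // /summability.partial_sum.
  by rewrite (big_seq_fsetE _ _ predT (fun g => if g \in D then phi g * S g else 0)).
rewrite Ps -RintegralB //; last exact: iBK.
rewrite (le_trans (le_normr_Rintegral _ _)) //.
  by apply: iBK => n; rewrite /v; case: ifP => _; rewrite ?subrr ?subr0 // normr0 mulr_ge0.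
apply: (@le_trans _ _ (\int[nu]_(n in setT) ((`|K| + 1) * (if (n < N)%N then 0 else c n)))).
  apply: le_Rintegral => //.
  - apply: iBK => n; rewrite normr_id /v; case: ifP => _; rewrite ?subrr ?subr0 // normr0 mulr_ge0 //.
  - have iN : nu.-integrable setT (EFin \o (fun n => if (n < N)%N then 0 else c n)).
      by apply: iB => n; case: ifP; rewrite ?normr0 // ger0_norm.
    have := integrableZl measurableT (`|K| + 1) iN; apply: eq_integrable => //.
  move=> n _; rewrite /v; case: ifP => [_|eB]; first by rewrite subrr normr0 mulr_ge0 ?(ltW K0) //; case: ifP.
  rewrite subr0; case: ifP => [nN|_]; last by rewrite (le_trans (bphi n)) // ler_wpM2r // lerDl.
  have [->|cn] := eqVneq (c n) 0; first by rewrite !mulr0 normr0.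
  exfalso; move/negP: eB; apply.
  have := fsubsetP AB (e n); apply; rewrite in_fset_set; last exact: finite_image.
  by apply/mem_set; exists n.
rewrite RintegralZl //; last first.
  by apply: iB => n; case: ifP; rewrite ?normr0 // ger0_norm.
rewrite -ler_pdivlMl // mulrC; apply: le_trans hN; exact: ler_norm.
Qed.

End Enumeration.

Section MartinSeries.
Import finmap.
Context {R : realType}.
Local Notation Re := complex.Re.
Local Notation Im := complex.Im.
Local Notation nu := (@counting nat R).

(** On the circle, conjugation together with [t * t^* = 1] exchanges numerator and denominator, so
    their moduli agree; they do not vanish because |a| and |b| differ. *)
Lemma moebius_circle (a b t : R[i]) : `|a| ^+ 2 - `|b| ^+ 2 = 1 -> cabs t = 1 -> cabs (moebius a b t) = 1.
Proof.
rewrite !normc_cabs => ab t1; have {}ab : cabs a ^+ 2 - cabs b ^+ 2 = 1.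
  by have := congr1 (@complex.Re R) ab; rewrite -!rmorphXn -rmorphB.
have tt : t * t^* = 1 by rewrite mul_conj t1 expr1n.
have E : cabs (a * t + b) = cabs (b^* * t + a^*).
  have Ec : (b^* * t + a^*)^* = b * t^* + a.
    by rewrite rmorphD rmorphM; congr (_ * _ + _); exact: conjCK.
  have <- : cabs (b * t^* + a) = cabs (b^* * t + a^*) by rewrite -Ec; exact: cabs_conj.
  rewrite -[RHS]mul1r -t1 -cabsM; congr cabs.
  by rewrite mulrDr (mulrC b) mulrA tt mul1r (mulrC t) addrC.
rewrite /moebius cabsM cabsV -E divff // cabs_eq0; apply/eqP => E0.
have : cabs (a * t) = cabs b by rewrite -[RHS]cabsN; congr cabs; apply/eqP; rewrite -addr_eq0 E0.
rewrite cabsM t1 mulr1 => H; move: ab; rewrite H subrr => /esym/eqP; by rewrite oner_eq0.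
Qed.

(** The group axiom gives the identity on the open disk, but its derivative is taken at [t0] on the
    circle. The values at 0 and 1/2 determine the coefficients: [b = 0] and [a] is real. *)
Lemma moebius_id (a b : R[i]) : `|a| ^+ 2 - `|b| ^+ 2 = 1 ->
  (forall z, disk z -> moebius a b z = z) -> forall z, moebius a b z = z.
Proof.
move=> ab mid.
have a0 : a != 0.
  apply/eqP => a0; move: ab; rewrite a0 normr0 expr0n /= sub0r => ab.
  have : (0 : R[i]) <= -1 by rewrite -ab opprK exprn_ge0.
  by rewrite oppr_ge0 ler10.
have ca0 : a^* != 0 by rewrite conjc_eq0.
have b0 : b = 0.
  have := mid 0; rewrite /moebius !mulr0 !add0r => /(_ _)/eqP.
  rewrite mulf_eq0 invr_eq0 (negbTE ca0) orbF => h; apply/eqP; apply: h.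
  by apply/diskE; rewrite cabs0.
have aa : a = a^*.
  have d2 : disk (2^-1 : R[i]).
    by rewrite /disk /= normfV normr_nat invf_lt1 ?ltr0n ?ltr1n.
  have := mid _ d2; rewrite /moebius b0 conjC0 mul0r add0r addr0 => h.
  apply: (@mulIf _ 2^-1); first by rewrite invr_eq0 pnatr_eq0.
  by rewrite -[RHS]mulrC -{2}h mulfVK.
by move=> z; rewrite /moebius b0 conjC0 mul0r add0r addr0 -aa mulrAC divff ?mul1r.
Qed.

Lemma martin_series (G : set (R[i] -> R[i])) (t0 : R[i]) : fuchsian G -> `|t0| = 1 ->
  (\esum_(g in G) (Re `|cderiv g t0|)%:E < +oo)%E ->
  exists (t : nat -> R[i]) (c : nat -> R),
  [/\ forall n, cabs (t n) = 1, forall n, 0 <= c n, nu.-integrable setT (EFin \o c),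
      exists k, 1 <= c k &
      forall z, disk z -> martin G t0 z =
        'i / 2 * @cint _ _ nat nu setT (fun n => schw z (t n) * (c n)%:C)].
Proof.
move=> [aut [g0 Gg0 g0E] _ _ _] nt0 hsum.
have t01 : cabs t0 = 1 by have := congr1 (@complex.Re R) nt0; rewrite normc_cabs.
pose S (g : R[i] -> R[i]) := cabs (cderiv g t0).
have SE : (\esum_(g in G) (S g)%:E < +oo)%E.
  by move: hsum; congr (_ < _)%E; apply: eq_esum => g _; rewrite normc_cabs.
have [e [c [c0 ic cG cS cphi]]] := unconditional_sum (fun x : R[i] => x) (fun g _ => cabs_ge0 (cderiv g t0)) SE.
have gt1 g : G g -> cabs (g t0) = 1.
  by move=> /aut[a [b [ab ->]]]; exact: moebius_circle.
(* Where [c n = 0] the map [e n] may lie outside [G]; the value 1 keeps every [t n] on the circle,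
   and the weight removes it from the sums. *)
pose t n := if c n == 0 then 1 else e n t0.
have t1 n : cabs (t n) = 1.
  by rewrite /t; case: eqP => [_|/eqP/cG/gt1]; rewrite ?cabs1.
exists t, c; split=> //.
  have gid : g0 = id.
    have [a [b [ab gE]]] := aut _ Gg0; apply/funext => z; rewrite gE; apply: moebius_id => // w dw.
    by rewrite -gE g0E.
  (* The identity supplies the index with [1 <= c k], on which the lower bound of W rests. *)
  have S1 : S g0 = 1.
    have -> : g0 = id by [].
    rewrite /S (@cder_cderiv _ id t0 1) ?cabs1 // => eps eps0; exists 1 => // w _.
    by rewrite mul1r subrr cabs0 mulr_ge0 ?cabs_ge0 // ltW.
  by have [k [_ ck]] := cS g0 Gg0 (eq_ind_r (fun x => 0 < x) ltr01 S1); exists k; rewrite ck -/(S g0) S1.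
move=> z /diskE z1; rewrite /martin; congr (_ * _).
pose K := 2 / (1 - cabs z).
have bK g : G g -> cabs (schw z (g t0)) <= K.
  move=> /gt1 h; rewrite /schw cabsM cabsV.
  have := circle_dist z h => h2; have z2 : 0 < 1 - cabs z by rewrite subr_gt0.
  apply: ler_pM; rewrite ?invr_ge0 ?cabs_ge0 //.
    by rewrite (le_trans (cabsD _ _)) // h; lra.
  by rewrite lef_pV2 ?posrE ?(lt_le_trans z2).
have lR := cphi (fun g => Re (schw z (g t0))) K (fun g Gg => le_trans (cabs_Re _) (bK g Gg)).
have lI := cphi (fun g => Im (schw z (g t0))) K (fun g Gg => le_trans (cabs_Im _) (bK g Gg)).
have PF := @summability.totally_filter (R[i] -> R[i]).
have FF : Filter (@summability.totally (R[i] -> R[i])) by exact: PF.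
have EG g : (if g \in G then (g t0 + z) / (g t0 - z) * `|cderiv g t0| else 0) =
   (if g \in G then Re (schw z (g t0)) * S g else 0) +i* (if g \in G then Im (schw z (g t0)) * S g else 0).
  case: ifP => // _; rewrite normc_cabs /S; apply/eqP; rewrite eq_complex /= ReMr ImMr.
  by rewrite !eqxx.
have EP (A : {fset (R[i] -> R[i])}) : summability.partial_sum (fun g => if g \in G then (g t0 + z) / (g t0 - z) * `|cderiv g t0| else 0) A =
  summability.partial_sum (fun g => if g \in G then Re (schw z (g t0)) * S g else 0) A +i*
  summability.partial_sum (fun g => if g \in G then Im (schw z (g t0)) * S g else 0) A.
  rewrite /summability.partial_sum.
  apply: (big_ind3 (fun (x : R[i]) y w => x = y +i* w)) => //.
  by move=> x1 x2 x3 y1 y2 y3 -> ->.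
have EPf : summability.partial_sum (fun g => if g \in G then (g t0 + z) / (g t0 - z) * `|cderiv g t0| else 0) = fun A =>
  summability.partial_sum (fun g => if g \in G then Re (schw z (g t0)) * S g else 0) A +i*
  summability.partial_sum (fun g => if g \in G then Im (schw z (g t0)) * S g else 0) A by apply/funext.
rewrite /summability.sum EPf.
apply: (@cvg_lim R[i]^o (@norm_hausdorff R[i] R[i]^o) _ _ PF); apply/cvg_complexP.
split.
  rewrite /cint /=; have <- : \int[nu]_(n in setT) (Re (schw z (e n t0)) * c n) =
     \int[nu]_(x in setT) Re (schw z (t x) * (c x)%:C).
    apply: eq_Rintegral => n _; rewrite ReMr /t; case: eqP => // ->; by rewrite !mulr0.
  exact: lR.
rewrite /cint /=; have <- : \int[nu]_(n in setT) (Im (schw z (e n t0)) * c n) =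
   \int[nu]_(x in setT) Im (schw z (t x) * (c x)%:C).
  apply: eq_Rintegral => n _; rewrite ImMr /t; case: eqP => // ->; by rewrite !mulr0.
exact: lI.
Qed.

End MartinSeries.

(** * Increments along a radius and the kernel on the circle *)

Section Ray.
Context {R : realType}.
Local Notation Re := complex.Re.
Local Notation Im := complex.Im.

Lemma is_derive_eps (q : R -> R) (r d : R) :
  (forall e : R, 0 < e -> exists2 del : R, 0 < del & forall s, `|s - r| < del ->
     `|q s - q r - d * (s - r)| <= e * `|s - r|) -> is_derive r 1 q d.
Proof.
move=> H; have L : h^-1 *: (q (h *: (1 : R) + r) - q r) @[h --> (0 : R)^'] --> d.
  apply/cvgrPdist_le => e e0; have [del d0 hd] := H e e0.
  apply/nbhs_ballP; exists del => // h; rewrite /ball /= sub0r normrN => hh hn0.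
  have h0 : 0 < `|h| by rewrite normr_gt0.
  rewrite /GRing.scale /= mulr1 -(ler_pM2r h0) -normrM.
  have -> : (d - h^-1 * (q (h + r) - q r)) * h = - (q (h + r) - q r - d * h) by field.
  by rewrite normrN; have := hd (h + r); rewrite addrK; exact.
split; first by apply/cvg_ex; exists d.
exact: (@cvg_lim R (@norm_hausdorff R R)) L.
Qed.

Lemma cderZ (f : R[i] -> R[i]) (z d k : R[i]) : cder f z d -> cder (fun w => k * f w) z (k * d).
Proof.
move=> H e e0; have k0 : 0 < cabs k + 1 by rewrite ltr_wpDl ?cabs_ge0.
have [r r0 hr] := H (e / (cabs k + 1)) (divr_gt0 e0 k0); exists r => // w wr.
rewrite -mulrBr -mulrA -mulrBr cabsM.
apply: (@le_trans _ _ ((cabs k + 1) * (e / (cabs k + 1) * cabs (w - z)))).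
  by apply: ler_pM; rewrite ?cabs_ge0 ?lerDl // hr.
by rewrite mulrA [X in X * _]mulrC divfK ?gt_eqF.
Qed.

Lemma ray_increment (m F : R[i] -> R[i]) (th a b M : R) : 0 <= a -> a < b ->
  (forall r, a <= r <= b -> cder m (r%:C * cis th) (F (r%:C * cis th))) ->
  (forall r, a <= r <= b -> cabs (F (r%:C * cis th)) <= M) ->
  `|Im (m (b%:C * cis th)) - Im (m (a%:C * cis th))| <= M * (b - a).
Proof.
move=> a0 ab dm FM.
pose q (r : R) := Im (m (r%:C * cis th)); pose dq (r : R) := Im (F (r%:C * cis th) * cis th).
have dqr r : a <= r <= b -> is_derive r 1 q (dq r).
  move=> hr; apply: is_derive_eps => e e0; have [del d0 hd] := dm r hr e e0.
  exists del => // s sr.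
  have E : s%:C * cis th - r%:C * cis th = (s - r)%:C * cis th by rewrite -mulrBl -rmorphB.
  have := hd (s%:C * cis th); rewrite E cabsM cabs_real cabs_cis mulr1 => /(_ sr).
  apply: le_trans; apply: le_trans (cabs_Im _); rewrite /q /dq.
  set x := m _; set y := m _; set z := F _.
  by rewrite !ImD !ImN (mulrC (s - r)%:C) mulrA ImMr.
have [] := @MVT R q dq a b ab.
- by move=> x; rewrite in_itv /= => /andP[ax xb]; apply: dqr; rewrite !ltW.
- apply: derivable_within_continuous => x; rewrite in_itv /= => hx.
  by have [] := dqr x hx.
move=> x; rewrite in_itv /= => /andP[ax xb] E.
rewrite -/(q b) -/(q a) E normrM (@gtr0_norm _ (b - a)) ?subr_gt0 //.
rewrite ler_wpM2r ?subr_ge0 ?(ltW ab) // (le_trans (cabs_Im _)) // cabsM cabs_cis mulr1.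
by apply: FM; rewrite !ltW.
Qed.

(** Conjugation is inversion on the circle, so [(t - z)^*] is -(t - z) / (t z). The argument of the
    result does not depend on [t]: summed over the poles, the boundary kernels add up without
    cancellation. *)
Lemma unimodular_ratio (z t : R[i]) : cabs z = 1 -> cabs t = 1 -> t != z ->
  dschw z t = - (2 / z) * ((cabs (t - z) ^+ 2)^-1)%:C.
Proof.
move=> z1 t1 tz; have z0 : z != 0 by rewrite -cabs_gt0 z1.
have t0 : t != 0 by rewrite -cabs_gt0 t1.
have d0 : t - z != 0 by rewrite subr_eq0.
have zc : z^* = z^-1 by apply: (mulfI z0); rewrite mul_conj z1 expr1n divff.
have tc : t^* = t^-1 by apply: (mulfI t0); rewrite mul_conj t1 expr1n divff.
have -> : ((cabs (t - z) ^+ 2)^-1)%:C = ((cabs (t - z) ^+ 2)%:C)^-1 by exact: fmorphV.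
rewrite -mul_conj rmorphB; rewrite [X in _ * (X - _)]tc [X in _ * (_ - X)]zc /dschw.
have -> : t^-1 - z^-1 = - ((t - z) / (t * z)) by field; rewrite z0 t0.
by field; rewrite z0 t0 d0.
Qed.

End Ray.

(** * Radial behaviour of the derivative of the Martin series *)

Section Series.
Context {R : realType}.
Local Notation Re := complex.Re.
Local Notation Im := complex.Im.
Local Notation nu := (@counting nat R).
Variables (t : nat -> R[i]).
Hypothesis t1 : forall n, cabs (t n) = 1.
Implicit Types (c : nat -> R) (z : R[i]).

(* The Martin function, its derivative, and twice its imaginary part. *)
Definition mser c z : R[i] := 'i / 2 * @cint R _ nat nu setT (fun n => schw z (t n) * (c n)%:C).
Definition dser c z : R[i] := 'i / 2 * @cint R _ nat nu setT (fun n => dschw z (t n) * (c n)%:C).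
Definition pser c z : R := \int[nu]_(n in setT) ((1 - cabs z ^+ 2) / cabs (t n - z) ^+ 2 * c n).

Let ms (g : R[i] -> R[i]) : (forall z, cabs z = 1 -> holo g z) ->
  measurable_fun setT (fun n => Re (g (t n))).
Proof. by []. Qed.

Lemma mser_cder c z : nu.-integrable setT (EFin \o c) -> cabs z < 1 -> cder (mser c) z (dser c z).
Proof.
move=> ic z1; apply: cderZ.
exact: (@schwarz_cder R _ nat nu setT measurableT t c t1 ic ms z z1).
Qed.

Lemma dser_holo c z : nu.-integrable setT (EFin \o c) -> cabs z < 1 -> holo (dser c) z.
Proof.
move=> ic z1; apply: cder_holo; apply: cderZ.
exact: (@dschwarz_cder R _ nat nu setT measurableT t c t1 ic ms z z1).
Qed.

Lemma Im_mser c z : cabs z < 1 -> Im (mser c z) = 2^-1 * pser c z.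
Proof.
move=> z1; have -> w : Im ('i / 2 * w : R[i]) = 2^-1 * Re w.
  rewrite (_ : 'i / 2 * w = 'i * w * (2^-1)%:C); last by rewrite fmorphV rmorph_nat mulrAC.
  by rewrite ImMr ImM /= mul0r mul1r add0r mulrC.
congr (_ * _); rewrite /pser /cint /=; apply: eq_Rintegral => n _.
by rewrite ReMr Re_schw_circle.
Qed.

Lemma cabs_i2 : cabs ('i / 2 : R[i]) = 2^-1.
Proof.
rewrite cabsM cabsV (_ : cabs 'i = 1); last first.
  by apply/eqP; rewrite -sqrp_eq1 ?cabs_ge0 // cabs_sqr /= expr0n expr1n add0r.
by rewrite mul1r (_ : (2 : R[i]) = (2 : R)%:C) ?cabs_real ?ger0_norm // rmorph_nat.
Qed.

Lemma dser_bound c (r : R) : nu.-integrable setT (EFin \o c) -> r < 1 ->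
  exists M, forall z, cabs z <= r -> cabs (dser c z) <= M.
Proof.
move=> ic r1; have q0 : 0 < 1 - r by rewrite subr_gt0.
pose C := 2 / (1 - r) ^+ 2; exists (2^-1 * (2 * C * \int[nu]_(n in setT) `|c n|)) => z zr.
have z1 : cabs z < 1 by exact: le_lt_trans r1.
rewrite /dser cabsM cabs_i2 ler_wpM2l //.
apply: (@cint_le R _ nat nu setT measurableT t c t1 ic ms) => //.
- exact: bdd_dschw.
- by rewrite divr_ge0 // exprn_ge0 // ltW.
move=> w w1; rewrite /dschw !cabsM cabsV cabsX w1 mulr1.
rewrite (_ : (2 : R[i]) = (2 : R)%:C) ?cabs_real ?ger0_norm ?rmorph_nat // ler_wpM2l //.
rewrite lef_pV2 ?posrE ?exprn_gt0 ?cabs_gt0 ?circle_neq // lerXn2r ?nnegrE ?cabs_ge0 ?(ltW q0) //.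
by apply: le_trans (circle_dist z w1); rewrite lerD2l lerN2.
Qed.

Let ker0 z n : cabs z < 1 -> 0 <= (1 - cabs z ^+ 2) / cabs (t n - z) ^+ 2.
Proof.
by move=> z1; rewrite divr_ge0 ?exprn_ge0 ?cabs_ge0 // subr_ge0 expr_le1 ?cabs_ge0 // ltW.
Qed.

Lemma integrable_pser c z : nu.-integrable setT (EFin \o c) -> cabs z < 1 ->
  nu.-integrable setT (EFin \o (fun n => (1 - cabs z ^+ 2) / cabs (t n - z) ^+ 2 * c n)).
Proof.
move=> ic z1; have := @cint_Re R _ nat nu setT measurableT t c t1 ic ms _ (bdd_schw z1).
by apply: eq_integrable => // n _ /=; rewrite Re_schw_circle.
Qed.

Lemma pser_ge0 c z : (forall n, 0 <= c n) -> cabs z < 1 -> 0 <= pser c z.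
Proof. by move=> c0 z1; apply: Rintegral_ge0 => n _; rewrite mulr_ge0 // ker0. Qed.

(** The radial step [1 - r] is itself at most [cabs (w - r%:C * z)], by [circle_dist]. *)
Lemma dist_radius (w z : R[i]) (r : R) : cabs w = 1 -> cabs z = 1 -> 0 <= r < 1 ->
  cabs (w - z) <= 2 * cabs (w - r%:C * z).
Proof.
move=> w1 z1 /andP[r0 r1]; have := circle_dist (r%:C * z) w1.
rewrite cabsM cabs_real ger0_norm // z1 mulr1 => h1.
have := cabsD (w - r%:C * z) ((r - 1)%:C * z).
rewrite cabsM z1 mulr1 cabs_real ler0_norm ?subr_le0 ?(ltW r1) //.
have -> : w - r%:C * z + (r - 1)%:C * z = w - z by rewrite rmorphB mulrBl mul1r; ring.
lra.
Qed.

Section Boundary.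
Variables (c : nat -> R) (th : R).
Hypothesis c0 : forall n, 0 <= c n.
Hypothesis ic : nu.-integrable setT (EFin \o c).
Hypothesis tth : forall n, t n != cis th.

(** The terms of W at the point [cis th]. *)
Definition wt n := c n / cabs (t n - cis th) ^+ 2.

Let wt0 n : 0 <= wt n. Proof. by rewrite divr_ge0 // exprn_ge0 // cabs_ge0. Qed.

Let d0 n : 0 < cabs (t n - cis th). Proof. by rewrite cabs_gt0 subr_eq0. Qed.

(** The constant is the 2 of the kernel times the square of the 2 in [dist_radius]. *)
Let bnd (r : R) n : 0 <= r < 1 -> cabs (dschw (r%:C * cis th) (t n)) * c n <= 8 * wt n.
Proof.
move=> r01; have dr := dist_radius (t1 n) (cabs_cis th) r01.
have dn := d0 n; have dp : 0 < cabs (t n - r%:C * cis th) by lra.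
rewrite /dschw !cabsM cabsV cabsX t1 mulr1 (_ : (2 : R[i]) = (2 : R)%:C) ?cabs_real ?ger0_norm ?rmorph_nat //.
rewrite /wt mulrA mulrAC (mulrC 8) -!mulrA [X in X <= _]mulrCA ler_wpM2l // mulrC.
rewrite ler_pdivlMr ?exprn_gt0 // -mulrA [X in X <= _]mulrC ler_pdivrMr ?exprn_gt0 //.
have : cabs (t n - cis th) ^+ 2 <= (2 * cabs (t n - r%:C * cis th)) ^+ 2.
  by rewrite lerXn2r ?nnegrE ?cabs_ge0 // mulr_ge0 // cabs_ge0.
by rewrite exprMn; lra.
Qed.

(** The single term [k] suffices; 4 is the square of the diameter of the circle. *)
Lemma wt_ge (k : nat) : 1 <= c k -> nu.-integrable setT (EFin \o wt) -> 4^-1 <= \int[nu]_(n in setT) wt n.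
Proof.
move=> ck iw; have [ip ipE] := integral_counting_pt k (wt k).
apply: (@le_trans _ _ (wt k)).
  have h : cabs (t k - cis th) <= 2 by rewrite (le_trans (cabsB _ _)) // t1 cabs_cis.
  have h2 : cabs (t k - cis th) ^+ 2 <= 4.
    have -> : (4 : R) = 2 ^+ 2 by ring.
    by rewrite lerXn2r ?nnegrE ?cabs_ge0.
  rewrite /wt ler_pdivlMr ?exprn_gt0 // (le_trans _ ck) // mulrC ler_pdivrMr //.
  by rewrite mul1r.
rewrite -{1}ipE; apply: le_Rintegral => // n _.
by case: eqP => [->|].
Qed.

(** The factor 1/2 in [dser] pays for bounding the real and the imaginary part separately by the
    full integral. *)
Lemma dser_radial_le (r : R) : nu.-integrable setT (EFin \o wt) -> 0 <= r < 1 ->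
  cabs (dser c (r%:C * cis th)) <= 8 * \int[nu]_(n in setT) wt n.
Proof.
move=> iw r01; have z1 : cabs (r%:C * cis th) < 1 by case/andP: r01 => r0 r1; rewrite cabs_rcis.
rewrite /dser cabsM cabs_i2 (@cintE R _ nat nu setT t c).
have iw8 : nu.-integrable setT (EFin \o (fun n => 8 * wt n)).
  by have := integrableZl measurableT 8 iw; apply: eq_integrable => // n _ /=; rewrite EFinM.
rewrite -RintegralZl //.
have B (v : nat -> R) : nu.-integrable setT (EFin \o (fun n => v n * c n)) ->
   (forall n, `|v n| <= cabs (dschw (r%:C * cis th) (t n))) ->
   `|\int[nu]_(n in setT) (v n * c n)| <= \int[nu]_(n in setT) (8 * wt n).
  move=> iv vC; rewrite (le_trans (le_normr_Rintegral measurableT iv)) //.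
  apply: le_Rintegral => //; first exact: integrable_norm iv.
  move=> n _; rewrite normrM (ger0_norm (c0 n)) (le_trans _ (bnd n r01)) //.
  by rewrite ler_wpM2r.
have b := bdd_dschw z1.
have iR := @cint_Re R _ nat nu setT measurableT t c t1 ic ms _ b.
have iI := @cint_Im R _ nat nu setT measurableT t c t1 ic ms _ b.
have BR := B _ iR (fun n => cabs_Re _); have BI := B _ iI (fun n => cabs_Im _).
rewrite mulrC ler_pdivrMr // (le_trans (cabs_le _)) //=.
by rewrite (mulr_natr _ 2) mulr2n; exact: lerD.
Qed.

(** Dominated convergence with [8 * wt]. By [unimodular_ratio] the limit kernels are nonnegative
    multiples of the one number [k], so the modulus of the sum is the sum of the moduli. *)
Lemma dser_radial_cvg : nu.-integrable setT (EFin \o wt) ->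
  cabs (dser c ((rad n)%:C * cis th)) @[n --> \oo] --> \int[nu]_(n in setT) wt n.
Proof.
move=> iw; have r01 n : 0 <= (rad n : R) < 1 by rewrite rad_lt1 ltW // rad_gt0.
have z1 n : cabs ((rad n)%:C * cis th) < 1 by rewrite cabs_rcis ?rad_lt1 // ltW // rad_gt0.
have iw8 : nu.-integrable setT (EFin \o (fun n => 8 * wt n)).
  by have := integrableZl measurableT 8 iw; apply: eq_integrable => // n _ /=; rewrite EFinM.
pose k : R[i] := - (2 / cis th).
have pt (j : nat) : (dschw ((rad n)%:C * cis th) (t j) : R[i]^o) @[n --> \oo] --> ((k * ((cabs (t j - cis th) ^+ 2)^-1)%:C : R[i]) : R[i]^o).
  rewrite -(unimodular_ratio (cabs_cis th) (t1 j) (tth j)).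
  have h : holo (fun z => dschw z (t j)) (cis th).
    apply: holoM; first exact: holo_cst.
    apply: holoV; first by rewrite expf_neq0 // subr_eq0.
    by apply: holoM; apply: holoB; [exact: holo_cst|exact: holo_id|exact: holo_cst|exact: holo_id].
  exact: rad_seq_cvg h.
have L (A : R[i] -> R) : (A = @complex.Re R \/ A = @complex.Im R) ->
    \int[nu]_(j in setT) (A (dschw ((rad n)%:C * cis th) (t j)) * c j) @[n --> \oo] -->
    A k * \int[nu]_(n in setT) wt n.
  move=> hA; rewrite -RintegralZl //.
  have [|||||_ H] // := @dominated_Rintegral R _ _ nu setT (fun n j => A (dschw ((rad n)%:C * cis th) (t j)) * c j)
    (fun j => A k * wt j) (fun j => 8 * wt j) measurableT.
  - apply: aeW => j _; have -> : A k * wt j = A (k * ((cabs (t j - cis th) ^+ 2)^-1)%:C) * c j.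
      by case: hA => ->; rewrite ?ReMr ?ImMr /wt; ring.
    apply: cvgMr_tmp; have [h1 h2] := (cvg_complexP _ _).1 (pt j).
    by case: hA => ->.
  - apply: aeW => j n _; rewrite normrM (ger0_norm (c0 j)) (le_trans _ (bnd j (r01 n))) //.
    by rewrite ler_wpM2r //; case: hA => ->; [exact: cabs_Re|exact: cabs_Im].
pose W := \int[nu]_(n in setT) wt n.
have W0 : 0 <= W by exact: Rintegral_ge0.
have C : (@cint R _ nat nu setT (fun j => dschw ((rad n)%:C * cis th) (t j) * (c j)%:C) : R[i]^o) @[n --> \oo]
    --> ((k * W%:C : R[i]) : R[i]^o).
  apply/cvg_complexP; rewrite ReMr ImMr; split.
    by under eq_cvg do rewrite (@cintE R _ nat nu setT t c) /=; apply: L; left.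
  by under eq_cvg do rewrite (@cintE R _ nat nu setT t c) /=; apply: L; right.
have -> : \int[nu]_(n in setT) wt n = 2^-1 * cabs (k * W%:C).
  rewrite cabsM cabs_real ger0_norm // cabsN cabsM cabsV cabs_cis invr1 mulr1.
  by rewrite (_ : (2 : R[i]) = (2 : R)%:C) ?cabs_real ?ger0_norm ?rmorph_nat // mulrA mulVf ?mul1r.
under eq_cvg do rewrite /dser cabsM cabs_i2.
by apply: cvgMl_tmp; exact: cvg_cabs C.
Qed.

(** Divided by 1 - r^2, [pser] is the sum of the c_j / |t_j - r cis th|^2, whose terms tend to [wt].
    Fatou's lemma transfers the bound, 1 + r being at least 1. *)
Lemma integrable_wt (M : R) : (\forall n \near \oo, pser c ((rad n)%:C * cis th) <= M * (1 - rad n)) ->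
  nu.-integrable setT (EFin \o wt).
Proof.
move=> PM; have r01 n : 0 <= (rad n : R) < 1 by rewrite rad_lt1 ltW // rad_gt0.
have z1 n : cabs ((rad n)%:C * cis th) < 1 by rewrite cabs_rcis ?rad_lt1 // ltW // rad_gt0.
pose h (n j : nat) := c j / cabs (t j - (rad n)%:C * cis th) ^+ 2.
have h0 n j : 0 <= h n j by rewrite divr_ge0 // exprn_ge0 // cabs_ge0.
have hw j : h n j @[n --> \oo] --> wt j.
  apply: cvgMl_tmp; apply: cvgV; first by rewrite expf_neq0 // cabs_eq0 subr_eq0.
  have H : holo (fun z => t j - z) (cis th) by apply: holoB; [exact: holo_cst|exact: holo_id].
  have C := cvg_cabs (rad_seq_cvg H).
  by apply: cvgM; exact: C.
have hE n : \int[nu]_(j in setT) h n j = pser c ((rad n)%:C * cis th) / (1 - rad n ^+ 2) /\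
   nu.-integrable setT (EFin \o h n).
  have q0 : 1 - rad n ^+ 2 != 0 :> R.
    by rewrite gt_eqF // subr_gt0 expr_lt1 ?rad_lt1 // ltW // rad_gt0.
  have E j : h n j = (1 - rad n ^+ 2)^-1 * ((1 - cabs ((rad n)%:C * cis th) ^+ 2) / cabs (t j - (rad n)%:C * cis th) ^+ 2 * c j).
    rewrite cabs_rcis; last by case/andP: (r01 n).
    by rewrite !mulrA mulVf // mul1r mulrC.
  have ip := integrable_pser ic (z1 n).
  split.
    rewrite mulrC /pser -RintegralZl //; apply: eq_Rintegral => j _; exact: E.
  have := integrableZl measurableT ((1 - rad n ^+ 2)^-1) ip; apply: eq_integrable => // j _ /=.
  by rewrite E EFinM.
have F := @lebesgue_integral_monotone_convergence.fatou _ _ R nu setT measurableT (fun n => EFin \o h n) (fun=> measurable_nat _) (fun n j _ => h0 n j).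
apply/integrableP; split=> //.
have -> : (\int[nu]_(x in setT) `|(EFin \o wt) x| = \int[nu]_(x in setT) limn_einf ((fun n => EFin \o h n)^~ x))%E.
  apply: eq_integral => j _ /=; rewrite ger0_norm //.
  have C : (h n j)%:E @[n --> \oo] --> (wt j)%:E by apply: cvg_EFin; [exact: nearW|exact: hw].
  by have [-> _] := cvg_limn_einf_sup C.
apply: (le_lt_trans F).
apply: (@le_lt_trans _ _ M%:E); last by rewrite ltry.
rewrite limn_einf_lim; apply: lime_le; first exact: is_cvg_einfs.
apply: filterS PM => n Pn; apply: (@le_trans _ _ (\int[nu]_(x in setT) (EFin \o h n) x)%E).
  by apply: ereal_inf_lbound; exists n => //=.
have [E ih] := hE n; rewrite -[leLHS]fineK; last by apply: integrable_fin_num ih.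
rewrite lee_fin -/(Rintegral nu setT (h n)) E.
have /andP[r0 r1] := r01 n.
have q1 : 0 < 1 - rad n :> R by rewrite subr_gt0.
have q2 : 1 <= 1 + rad n :> R by rewrite lerDl.
have -> : 1 - rad n ^+ 2 = (1 - rad n) * (1 + rad n) :> R by ring.
rewrite invfM mulrA ler_pdivrMr ?(lt_le_trans ltr01) // ler_pdivrMr //.
apply: (le_trans Pn); rewrite mulrAC ler_peMr //.
apply: le_trans (pser_ge0 c0 (z1 n)) Pn.
Qed.

End Boundary.
End Series.

(** * Vanishing of Im m at the boundary *)

Section Vanishing.
Context {R : realType}.
Local Notation Re := complex.Re.
Local Notation Im := complex.Im.
Local Notation nu := (@counting nat R).
Local Notation mu := (@lebesgue_measure R).
Variables (t : nat -> R[i]) (c : nat -> R).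
Hypothesis t1 : forall n, cabs (t n) = 1.
Hypothesis c0 : forall n, 0 <= c n.
Hypothesis ic : nu.-integrable setT (EFin \o c).

Let p0 : 0 < 2 * pi :> R. Proof. by rewrite mulr_gt0 // pi_gt0. Qed.

Lemma cis_inj (x y : R) : 0 < x < 2 * pi -> 0 < y < 2 * pi -> cis x = cis y -> x = y.
Proof.
wlog xy : x y / x <= y.
  by move=> H hx hy e; have [/H|/ltW/H h] := leP x y; [exact|rewrite h].
move=> /andP[x0 x1] /andP[y0 y1] e.
apply/eqP; rewrite eq_le xy /= leNgt; apply/negP => lxy.
have : cos (y - x) < 1 by apply: cos_lt1; apply/andP; split; lra.
have : cis (y - x) = 1 by apply: (mulIf (cis_neq0 x)); rewrite -cisD subrK mul1r e.
by move=> /(congr1 (@complex.Re R)) /= ->; rewrite ltxx.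
Qed.

Lemma ae_cis_neq : {ae mu, forall th, circ th -> forall n, t n != cis th}.
Proof.
apply: ae_circ.
have h n : {ae mu, forall th, 0 < th < 2 * pi -> t n != cis th}.
  have [[y yI ty]|ny] := pselect (exists2 y, 0 < y < 2 * pi & t n = cis y).
    exists [set y]; split; [exact: measurable_set1|exact: lebesgue_measure_set1|].
    move=> x /= /not_implyP[xI /negP]; rewrite negbK ty => /eqP e.
    exact/esym/cis_inj.
  apply: aeW => th hth; apply/eqP => e; apply: ny; by exists th.
by apply: ae_imply (ae_foralln h) => th H hth n; exact: H.
Qed.

Lemma poisson0 (x : R) : poisson 0 x = 1.
Proof. by rewrite /poisson cabs0 subr0 cabs_cis expr0n expr1n subr0 divr1. Qed.

Definition cut (j n : nat) : R := if (n < j)%N then 0 else c n.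

Let cut0 j n : 0 <= cut j n. Proof. by rewrite /cut; case: ifP. Qed.

Let icut j : nu.-integrable setT (EFin \o cut j).
Proof.
apply: le_integrable ic => // n _ /=; rewrite lee_fin /cut; case: ifP => // _.
by rewrite normr0.
Qed.

Lemma tail_cvg0 : \int[nu]_(n in setT) cut j n @[j --> \oo] --> (0 : R).
Proof.
have z0 : \int[nu]_(n in setT) (0 : R) = 0 by rewrite Rintegral_cst // mul0r.
rewrite -[X in _ --> X]z0.
have [|||||_ L] // := @dominated_Rintegral R _ _ nu setT cut (fun=> 0) c measurableT.
- apply: aeW => n _; apply: cvg_near_cst; exists n.+1 => // N /= nN.
  by rewrite /cut nN.
- by apply: aeW => n N _; rewrite /cut; case: ifP; rewrite ?normr0 // ger0_norm.
Qed.

(* The modulus of this function is [exp (- Im m)], with [m] the Martin function of the tail of the series.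
   Its mean logarithmic boundary modulus is at least minus a multiple of the mass of the tail, while the
   finitely many remaining terms do not contribute to [Im m] on the circle. *)
Definition sing j (z : R[i]) : R[i] := cexp ('i * mser t (cut j) z).

Lemma sing_analytic j : analytic_disk (sing j).
Proof.
move=> z /diskE z1; apply: (holo_comp (g := @cexp R)); last exact: holo_cexp.
by apply: holoM; [exact: holo_cst|exact: cder_holo (mser_cder t1 (icut j) z1)].
Qed.

Lemma cabs_sing j z : cabs z < 1 -> cabs (sing j z) = expR (- (2^-1 * pser t (cut j) z)).
Proof.
by move=> z1; rewrite cabs_cexp -Im_mser // ReM /= mul0r mul1r sub0r.
Qed.

Lemma sing_le1 j z : disk z -> cabs (sing j z) <= 1.
Proof.
move=> /diskE z1; rewrite cabs_sing // -expR0 ler_expR oppr_le0 mulr_ge0 //.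
exact: pser_ge0.
Qed.

Lemma pser0 j : pser t (cut j) 0 = \int[nu]_(n in setT) cut j n.
Proof.
rewrite /pser; apply: eq_Rintegral => n _.
by rewrite cabs0 subr0 t1 expr0n subr0 expr1n divr1 mul1r.
Qed.

Lemma pser_cut j z : cabs z < 1 ->
  pser t (cut j) z = (1 - cabs z ^+ 2) / cabs (t j - z) ^+ 2 * c j + pser t (cut j.+1) z.
Proof.
move=> z1; have [ip ipE] := integral_counting_pt j ((1 - cabs z ^+ 2) / cabs (t j - z) ^+ 2 * c j).
rewrite -ipE /pser -RintegralD //; last by apply: integrable_pser => //.
apply: eq_Rintegral => n _; rewrite /cut ltnS; case: ltngtP => [_|nj|->].
- by rewrite mulr0 addr0.
- by rewrite add0r.
- by rewrite mulr0 addr0.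
Qed.

Section Modulus.
Variable N : nat -> R -> R.
Hypothesis mN : forall j, measurable_fun (@circ R) (N j).
Hypothesis N01 : forall j th, 0 <= N j th <= 1.
Hypothesis N_rad : forall j,
  {ae mu, forall th, circ th -> cabs (sing j (r%:C * cis th)) @[r --> (1 : R)^'-] --> N j th}.

Let N_cvg j : {ae mu, forall th, circ th -> cabs (sing j ((rad n)%:C * cis th)) @[n --> \oo] --> N j th}.
Proof.
apply: ae_imply (N_rad j) => th h cth.
exact: (@cvg_comp _ _ _ (@rad R) (fun r => cabs (sing j (r%:C * cis th))) _ _ _ rad_left (h cth)).
Qed.

Let z1 n th : cabs ((rad n)%:C * cis th : R[i]) < 1.
Proof. by rewrite cabs_rcis ?rad_lt1 // ltW // rad_gt0. Qed.

(** The deleted term is a multiple of a Poisson kernel with pole [t j], which tends to 0 along every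
    radius that does not end at the pole. *)
Let N_step j : {ae mu, forall th, circ th -> N j th = N j.+1 th}.
Proof.
apply: ae_imply (ae_and ae_cis_neq (ae_and (N_cvg j) (N_cvg j.+1))) => th [h1 [h2 h3]] cth.
have {}h1 := h1 cth j; have {}h2 := h2 cth; have {}h3 := h3 cth.
pose e n := (1 - rad n ^+ 2) / cabs (t j - (rad n)%:C * cis th) ^+ 2 * c j.
have ce : e n @[n --> \oo] --> (0 : R).
  have -> : 0 = (1 - 1 * 1) / cabs (t j - cis th) ^+ 2 * c j by rewrite mulr1 subrr !mul0r.
  apply: cvgMr_tmp; apply: cvgM.
    by apply: cvgB; [exact: cvg_cst|apply: cvgM; exact: rad_cvg].
  apply: cvgV; first by rewrite expf_neq0 // cabs_eq0 subr_eq0.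
  have H : holo (fun z => t j - z) (cis th) by apply: holoB; [exact: holo_cst|exact: holo_id].
  have C := cvg_cabs (rad_seq_cvg H).
  by apply: cvgM; exact: C.
have E n : cabs (sing j ((rad n)%:C * cis th)) = expR (- (2^-1 * e n)) * cabs (sing j.+1 ((rad n)%:C * cis th)).
  rewrite !cabs_sing ?z1 // pser_cut ?z1 // -expRD; congr expR.
  by rewrite cabs_rcis ?(ltW (rad_gt0 n)) // -/(e n); ring.
have L : expR (- (2^-1 * e n)) * cabs (sing j.+1 ((rad n)%:C * cis th)) @[n --> \oo] --> 1 * N j.+1 th.
  apply: cvgM; last exact: h3.
  rewrite -[X in _ --> X](@expR0 R) -oppr0 -[in X in _ --> expR (- X)](mulr0 2^-1).
  apply: (@cvg_comp _ _ _ _ (@expR R)); last exact: continuous_expR.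
  by apply: cvgN; apply: cvgMl_tmp.
rewrite mul1r in L; have EF : (fun n => cabs (sing j ((rad n)%:C * cis th))) =
  (fun n => expR (- (2^-1 * e n)) * cabs (sing j.+1 ((rad n)%:C * cis th))) by apply/funext.
rewrite EF in h2; exact: (cvg_unique (@norm_hausdorff R R) h2 L).
Qed.

Let N_all j : {ae mu, forall th, circ th -> N j th = N 0%N th}.
Proof.
elim: j => [|j ih]; first by apply: aeW.
exact: ae_eq_trans (ae_eq_sym (N_step j)) ih.
Qed.

Let i0 : cabs (0 : R[i]) < 1. Proof. by rewrite cabs0. Qed.

Let ilnN j : mu.-integrable circ (EFin \o (fun th => ln (N j th))).
Proof.
exact: (boundary_log_integrable (@sing_analytic j) (@sing_le1 j) (mN j) (N01 j) (N_cvg j) i0 (cexp_neq0 _)).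
Qed.

(** Jensen's inequality for [sing j] at 0, where the logarithm of its modulus is minus half the mass
    of the tail. By [N_all] the boundary modulus may be taken to be [N 0] for every [j]. *)
Let int_lnN j : - (pi * \int[nu]_(n in setT) cut j n) <= \int[mu]_(th in circ) ln (N 0%N th).
Proof.
have := boundary_log_le (@sing_analytic j) (@sing_le1 j) (mN j) (N01 j) (N_cvg j) i0 (cexp_neq0 _) i0 (cexp_neq0 _).
rewrite cabs_sing // expRK pser0.
have -> : \int[mu]_(x in circ) (poisson 0 x * ln (N j x)) = \int[mu]_(x in circ) ln (N 0%N x).
  transitivity (\int[mu]_(x in circ) ln (N j x)).
    by apply: eq_Rintegral => x _; rewrite poisson0 mul1r.
  rewrite /Rintegral; congr fine; apply: ae_eq_integral; first exact: measurable_circL.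
  - exact: measurable_int (ilnN j).
  - exact: measurable_int (ilnN 0).
  have [A [mA A0 sA]] := N_all j; exists A; split=> // th nE.
  by apply: sA => NE; apply: nE => cth; rewrite (NE cth).
rewrite [X in _ <= X]mulrC ler_pdivlMr // => h.
by apply: le_trans h; rewrite mulNr lerN2; move: (pi : R) => p; lra.
Qed.

(** The mass of the tail tends to 0, so the integral of [ln (N 0 th)] is nonnegative. The integrand
    is nonpositive, hence [N 0] is 1 almost everywhere; and [pser] is -2 times the logarithm of the
    modulus of [sing 0]. *)
Lemma pser_vanish_modulus : {ae mu, forall th, circ th -> pser t c (r%:C * cis th) @[r --> (1 : R)^'-] --> (0 : R)}.
Proof.
have inn : mu.-integrable circ (EFin \o (fun th => -1 * ln (N 0%N th))) by exact: integrable_circZ (ilnN 0).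
have Npos := boundary_log_pos (@sing_analytic 0) (@sing_le1 0) (mN 0) (N01 0) (N_cvg 0) i0 (cexp_neq0 _).
have z : {ae mu, forall th, circ th -> -1 * ln (N 0%N th) = 0}.
  apply: ae_eq0_int_le0 => //.
    by apply: aeW => th _; rewrite mulN1r oppr_ge0 ln_le0 //; case/andP: (N01 0 th).
  rewrite RintegralZl; [|exact: measurable_circL|exact: ilnN].
  rewrite mulN1r oppr_le0.
  have L : - (pi * \int[nu]_(n in setT) cut j n) @[j --> \oo] --> (- (pi * 0) : R).
    by apply: cvgN; apply: cvgMl_tmp; exact: tail_cvg0.
  rewrite mulr0 oppr0 in L; apply: ler_cvg_to L (cvg_cst _) _; apply: nearW => j.
  exact: int_lnN.
apply: ae_imply (ae_and z (ae_and Npos (N_rad 0))) => th [h1 [h2 h3]] cth.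
have {}h1 := h1 cth; have {}h2 := h2 cth; have {}h3 := h3 cth.
have N1 : N 0%N th = 1.
  by apply: ln_inj; rewrite ?posrE // ln1; apply/eqP; rewrite -oppr_eq0 -mulN1r h1.
rewrite N1 in h3.
have L : -2 * ln (cabs (sing 0 (r%:C * cis th))) @[r --> (1 : R)^'-] --> -2 * ln (1 : R).
  apply: cvgMl_tmp; apply: (@cvg_comp _ _ _ _ (@ln R)); first exact: h3.
  exact: continuous_ln.
rewrite ln1 mulr0 in L; apply: left_eq_cvg L => r /andP[r0 r1].
rewrite cabs_sing ?cabs_rcis ?(ltW r0) // expRK.
have -> : cut 0 = c by apply/funext.
by rewrite mulNr mulrN opprK mulrA divff ?mul1r.
Qed.

End Modulus.

Lemma pser_vanish : {ae mu, forall th, circ th -> pser t c (r%:C * cis th) @[r --> (1 : R)^'-] --> (0 : R)}.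
Proof.
have [N hN] := choice (fun j => radial_modulus (@sing_analytic j) (@sing_le1 j)).
apply: (@pser_vanish_modulus N).
- by move=> j; have [] := hN j.
- by move=> j; have [_ h _] := hN j.
- move=> j; have [_ _ h] := hN j; apply: ae_imply h => th h cth; have [w sw ->] := h cth.
  exact: cvg_cabs sw.
Qed.

Lemma integrable_wt_ae (f g : R[i] -> R[i]) (Mf Mg : R) (z0 : R[i]) :
  analytic_disk f -> (forall z, disk z -> cabs (f z) <= Mf) ->
  analytic_disk g -> (forall z, disk z -> cabs (g z) <= Mg) ->
  disk z0 -> g z0 != 0 ->
  (forall z, disk z -> g z != 0 -> dser t c z = f z / g z) ->
  {ae mu, forall th, circ th -> nu.-integrable setT (EFin \o wt t c th)}.
Proof.
move=> af fM ag gM /diskE z01 gz0 dE.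
have [Nf [_ _ Nfr]] := radial_modulus af fM.
have [Ng [mNg Ng0 Ngr]] := radial_modulus ag gM.
have Ngc : {ae mu, forall th, circ th -> cabs (g ((rad n)%:C * cis th)) @[n --> \oo] --> Ng th}.
  apply: ae_imply Ngr => th h cth; have [w gw ->] := h cth.
  apply: (@cvg_comp _ _ _ (@rad R) (fun r => cabs (g (r%:C * cis th))) _ _ _ rad_left).
  exact: cvg_cabs gw.
have Ngp := boundary_log_pos ag gM mNg Ng0 Ngc z01 gz0.
apply: ae_imply (ae_and (ae_and Nfr Ngr) (ae_and Ngp (ae_and ae_cis_neq pser_vanish))) => th [[h1 h2] [h3 [h4 h5]]] cth.
have [wf fw _] := h1 cth; have [wg gw Ngw] := h2 cth; have {}h3 := h3 cth.
have {}h4 := h4 cth; have {}h5 := h5 cth; rewrite Ngw in h3.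
have zr (r : R) : 0 < r < 1 -> cabs (r%:C * cis th : R[i]) < 1 by move=> /andP[r0 r1]; rewrite cabs_rcis // ltW.
have cf : cabs (f (r%:C * cis th)) @[r --> (1 : R)^'-] --> cabs wf by exact: cvg_cabs fw.
have cg : cabs (g (r%:C * cis th)) @[r --> (1 : R)^'-] --> cabs wg by exact: cvg_cabs gw.
have [d1 d10 hd1] := (cvg_leftP _ _).1 cf _ ltr01.
have g2 : 0 < cabs wg / 2 by rewrite divr_gt0.
have [d2 d20 hd2] := (cvg_leftP _ _).1 cg _ g2.
pose d := Num.min 1 (Num.min d1 d2).
have d0 : 0 < d by rewrite !lt_min ltr01 d10.
(* Near the end of the radius |f| is at most its limit plus 1, and |g| at least half of its nonzero
   limit. *)
pose M := (cabs wf + 1) / (cabs wg / 2).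
have FM r : 1 - d < r -> r < 1 -> cabs (dser t c (r%:C * cis th)) <= M.
  move=> rd r1.
  have dd1 : d <= d1 by rewrite /d !ge_min lexx orbT.
  have dd2 : d <= d2 by rewrite /d !ge_min lexx !orbT.
  have dd3 : d <= 1 by rewrite /d !ge_min lexx.
  have r0 : 0 < r by lra.
  have a1 := hd1 r _ r1; have a2 := hd2 r _ r1.
  have {}a1 : `|cabs wf - cabs (f (r%:C * cis th))| <= 1 by apply: a1; lra.
  have {}a2 : `|cabs wg - cabs (g (r%:C * cis th))| <= cabs wg / 2 by apply: a2; lra.
  move: a1 a2; rewrite !ler_norml => /andP[a1 a1'] /andP[a2 a2'].
  have gp : cabs wg / 2 <= cabs (g (r%:C * cis th)) by lra.
  have gn : g (r%:C * cis th) != 0 by rewrite -cabs_gt0 (lt_le_trans g2).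
  have r01 : 0 < r < 1 by rewrite r0.
  rewrite dE //; last by apply/diskE; exact: zr.
  rewrite cabsM cabsV /M; apply: ler_pM; rewrite ?invr_ge0 ?cabs_ge0 //; first by lra.
  by rewrite lef_pV2 ?posrE // cabs_gt0.
have PM r : 1 - d < r -> r < 1 -> pser t c (r%:C * cis th) <= 2 * M * (1 - r).
  move=> rd r1; have dd3 : d <= 1 by rewrite /d !ge_min lexx.
  have r0 : 0 < r by lra.
  have M0 : 0 <= M by apply: le_trans (FM r rd r1); exact: cabs_ge0.
  (* The increment of Im m is controlled between [r] and [s]; afterwards [s] tends to 1, where
     [pser] vanishes by [h5]. The factor 2 comes from [Im_mser]. *)
  have B s : r < s -> s < 1 -> pser t c (r%:C * cis th) - 2 * M * (1 - r) <= pser t c (s%:C * cis th).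
    move=> rs s1.
    have dm x : r <= x <= s -> cder (mser t c) (x%:C * cis th) (dser t c (x%:C * cis th)).
      move=> /andP[x0 x1]; apply: mser_cder => //; apply: zr; apply/andP; split; lra.
    have fm x : r <= x <= s -> cabs (dser t c (x%:C * cis th)) <= M.
      by move=> /andP[x0 x1]; apply: FM; lra.
    have := ray_increment (ltW r0) rs dm fm.
    rewrite !Im_mser //; [|by apply: zr; apply/andP; split; lra|by apply: zr; apply/andP; split; lra].
    rewrite ler_norml => /andP[a _].
    have : M * (s - r) <= M * (1 - r) by rewrite ler_wpM2l // lerD2r ltW.
    lra.
  rewrite -subr_le0; apply: ler_cvg_to (cvg_cst _) h5 _.
  apply/left_nearP; exists (1 - r); first by rewrite subr_gt0.
  by move=> s rs s1; apply: B => //; lra.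
apply: (@integrable_wt R t t1 c th c0 ic h4 (2 * M)).
have /cvgrPdist_lt/(_ _ d0) := @rad_cvg R; apply: filterS => n.
rewrite ltr_norml => /andP[_ a]; apply: PM; [lra|exact: rad_lt1].
Qed.

End Vanishing.

(** * The inner-outer factorization *)

Section Factorization.
Context {R : realType}.
Local Notation Re := complex.Re.
Local Notation Im := complex.Im.
Local Notation nu := (@counting nat R).
Local Notation mu := (@lebesgue_measure R).
Variables (t : nat -> R[i]) (c : nat -> R) (k0 : nat).
Hypothesis t1 : forall n, cabs (t n) = 1.
Hypothesis c0 : forall n, 0 <= c n.
Hypothesis ic : nu.-integrable setT (EFin \o c).
Hypothesis ck0 : 1 <= c k0.
Variables (f g : R[i] -> R[i]) (Mf Mg : R) (z0 : R[i]).
Hypothesis af : analytic_disk f.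
Hypothesis fM : forall z, disk z -> cabs (f z) <= Mf.
Hypothesis ag : analytic_disk g.
Hypothesis gM : forall z, disk z -> cabs (g z) <= Mg.
Hypothesis z01 : cabs z0 < 1.
Hypothesis gz0 : g z0 != 0.
Let F := dser t c.
Hypothesis FE : forall z, disk z -> g z != 0 -> F z = f z / g z.

Let p0 : 0 < 2 * pi :> R. Proof. by rewrite mulr_gt0 // pi_gt0. Qed.

Let aF : analytic_disk F. Proof. by move=> z /diskE z1; exact: dser_holo. Qed.

(** [F] is bounded on smaller disks only, so the bounded case is applied to its dilation by [s],
    which lies strictly between [r] and 1. *)
Let F_log_subharmonic (r e : R) (z : R[i]) : 0 < r < 1 -> 0 < e -> cabs z < 1 ->
  cabs (F (r%:C * z)) <= expR ((2 * pi)^-1 *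
    \int[mu]_(th in circ) (poisson z th * ln (Num.max (cabs (F (r%:C * cis th))) e))).
Proof.
move=> /andP[r0 r1] e0 z1; pose s := (1 + r) / 2.
have s0 : 0 < s by rewrite /s; lra.
have s1 : s < 1 by rewrite /s; lra.
have rs : r / s < 1 by rewrite ltr_pdivrMr // /s; lra.
have rs0 : 0 < r / s by exact: divr_gt0.
pose G w := F (s%:C * w).
have sw w : disk w -> cabs (s%:C * w) <= s.
  by move=> /diskE w1; rewrite cabsM cabs_real gtr0_norm // ler_piMr // ltW.
have aG : analytic_disk G.
  move=> w dw; apply: (holo_comp (f := fun w => s%:C * w)).
    by apply: holoM; [exact: holo_cst|exact: holo_id].
  by apply: analytic_holo => //; exact: le_lt_trans (sw w dw) s1.
have [M FM] := dser_bound t1 ic s1.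
have GM w : disk w -> cabs (G w) <= M by move=> dw; apply: FM; exact: sw.
have rs01 : 0 < r / s < 1 by rewrite rs0.
have H := log_subharmonic aG GM rs01 e0 z1.
have E w : s%:C * ((r / s)%:C * w) = r%:C * w.
  by rewrite mulrA -rmorphM mulrCA divff ?mulr1 // gt_eqF.
have EG w : G ((r / s)%:C * w) = F (r%:C * w) by exact: (congr1 F (E w)).
have EI : \int[mu]_(th in circ) (poisson z th * ln (Num.max (cabs (G ((r / s)%:C * cis th))) e)) =
   \int[mu]_(th in circ) (poisson z th * ln (Num.max (cabs (F (r%:C * cis th))) e)).
  by apply: eq_Rintegral => th _; rewrite (EG (cis th)).
by rewrite -EI -(EG z).
Qed.

Let W th := \int[nu]_(n in setT) wt t c th n.

Let W_ae : {ae mu, forall th, circ th ->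
  [/\ cabs (F ((rad n)%:C * cis th)) @[n --> \oo] --> W th, 4^-1 <= W th &
      forall n, cabs (F ((rad n)%:C * cis th)) <= 8 * W th]}.
Proof.
have z0d : disk z0 by apply/diskE.
apply: ae_imply (ae_and (ae_cis_neq t) (integrable_wt_ae t1 c0 ic af fM ag gM z0d gz0 FE)) => th [h1 h2] cth.
have {}h1 := h1 cth; have {}h2 := h2 cth; split.
- exact: dser_radial_cvg.
- exact: (wt_ge t1 c0 h1 ck0 h2).
- by move=> n; apply: dser_radial_le => //; rewrite rad_lt1 ltW // rad_gt0.
Qed.

Let rad_of (h : R[i] -> R[i]) (N : R -> R) :
  {ae mu, forall th, circ th -> exists2 w : R[i],
      (h (r%:C * cis th) : R[i]^o) @[r --> (1 : R)^'-] --> (w : R[i]^o) & N th = cabs w} ->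
  {ae mu, forall th, circ th -> cabs (h ((rad n)%:C * cis th)) @[n --> \oo] --> N th}.
Proof.
apply: ae_imply => th H cth; have [w hw ->] := H cth.
apply: (@cvg_comp _ _ _ (@rad R) (fun r => cabs (h (r%:C * cis th))) _ _ _ rad_left).
exact: cvg_cabs hw.
Qed.

Let rd n th : disk ((rad n)%:C * cis th : R[i]).
Proof. by apply/diskE; rewrite cabs_rcis ?rad_lt1 // ltW // rad_gt0. Qed.

(** [lW] is a measurable representative of log W, read off from the boundary moduli of [f] and [g];
    all integrals below are written with it rather than with [W]. *)
Let log_W : exists lW : R -> R, mu.-integrable circ (EFin \o lW) /\
  {ae mu, forall th, circ th -> lW th = ln (W th)}.
Proof.
have [Nf [mNf Nf0 Nfr]] := radial_modulus af fM.
have [Ng [mNg Ng0 Ngr]] := radial_modulus ag gM.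
have Nfc := rad_of Nfr; have Ngc := rad_of Ngr.
have Ngp := boundary_log_pos ag gM mNg Ng0 Ngc z01 gz0.
have Wq : {ae mu, forall th, circ th -> [/\ 0 < Ng th, 0 < Nf th & Nf th = W th * Ng th]}.
  apply: ae_imply (ae_and Nfc (ae_and Ngc (ae_and Ngp W_ae))) => th [h1 [h2 [h3 h4]]] cth.
  have {}h1 := h1 cth; have {}h2 := h2 cth; have {}h3 := h3 cth; have [WF W4 _] := h4 cth.
  have E : Nf th = W th * Ng th.
    apply: (cvg_unique (@norm_hausdorff R R) h1).
    have L : cabs (F ((rad n)%:C * cis th)) * cabs (g ((rad n)%:C * cis th)) @[n --> \oo] --> W th * Ng th.
      by apply: cvgM.
    apply: cvg_trans L; apply: near_eq_cvg.
    have /cvgrPdist_lt/(_ _ h3) := h2; apply: filterS => n hn.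
    have gn : g ((rad n)%:C * cis th) != 0.
      by rewrite -cabs_eq0; apply/eqP => e; move: hn; rewrite e subr0 gtr0_norm // ltxx.
    by rewrite FE // cabsM cabsV mulfVK // cabs_eq0.
  split=> //; rewrite E mulr_gt0 // (lt_le_trans _ W4) //.
have [th cth [_ Nfp' _]] := ae_circ_exists Wq.
(* Integrability of [ln (Nf th)] requires a point where [f] does not vanish. The bound
   [4^-1 <= W th] makes the boundary modulus of [f] positive, so [f] is nonzero somewhere along a
   radius. *)
have [z1 z11 fz1] : exists2 z1, cabs z1 < 1 & f z1 != 0.
  have [th1 cth1 [h1 [_ h2 _]]] : exists2 th, circ th &
    cabs (f ((rad n)%:C * cis th)) @[n --> \oo] --> Nf th /\ [/\ 0 < Ng th, 0 < Nf th & Nf th = W th * Ng th].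
    by apply: ae_circ_exists; apply: ae_imply (ae_and Nfc Wq) => x [a b] cx; split; [exact: a|exact: b].
  have /cvgrPdist_lt/(_ _ h2)/filter_ex[n hn] := h1.
  exists ((rad n)%:C * cis th1); first by apply/diskE.
  by rewrite -cabs_eq0; apply/eqP => e; move: hn; rewrite e subr0 gtr0_norm // ltxx.
exists (fun th => ln (Nf th) - ln (Ng th)); split.
  apply: integrable_circB.
    exact: (boundary_log_integrable af fM mNf Nf0 Nfc z11 fz1).
  exact: (boundary_log_integrable ag gM mNg Ng0 Ngc z01 gz0).
apply: ae_imply (ae_and Wq W_ae) => x [a b] cx; have [g0 f0 E] := a cx; have [_ W4 _] := b cx.
by rewrite E lnM ?posrE // ?addrK // (lt_le_trans _ W4).
Qed.

Lemma factorization : exists Delta phi : R[i] -> R[i],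
  [/\ inner Delta, outer phi, forall z, disk z -> cabs (phi z) <= 4 &
      forall z, disk z -> F z = Delta z / phi z].
Proof.
have [lW [ilW lWE]] := log_W.
(* [-1 * lW th <= ln 4] is known almost everywhere only. The minimum makes it hold at every angle,
   as [poisson_le_int] demands, and [uE] below shows that almost everywhere nothing is changed. *)
pose u th := Num.min (ln 4) (-1 * lW th).
have inW : mu.-integrable circ (EFin \o (fun th => -1 * lW th)) by exact: integrable_circZ.
have l4 : 0 <= ln 4 :> R by rewrite ln_ge0 // ler1n.
have ialW : mu.-integrable circ (EFin \o (fun th => `|lW th|)) by exact: integrable_norm ilW.
have mlW : measurable_fun (@circ R) lW by apply/measurable_EFinP; exact: measurable_int ilW.
have iu : mu.-integrable circ (EFin \o u).
  have i2 : mu.-integrable circ (EFin \o (fun th => ln 4 - -1 * `|lW th|)).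
    exact: integrable_circB (integrable_circ_cst _) (integrable_circZ _ ialW).
  apply: le_integrable i2; first exact: measurable_circL.
    apply/measurable_EFinP; apply: measurable_minr => //.
    by apply: measurable_funM.
  move=> th _ /=; rewrite lee_fin mulN1r opprK (ger0_norm (addr_ge0 l4 (normr_ge0 _))).
  rewrite /u mulN1r /Num.min; case: ifP => _; first by rewrite ger0_norm // lerDl.
  by rewrite normrN lerDr.
have u4 th : circ th -> u th <= ln 4 by move=> _; rewrite ge_min lexx.
pose phi z := 1 * cexp (schwarz_int u z).
have phiE z : cabs z < 1 -> cabs (phi z) = expR ((2 * pi)^-1 * \int[mu]_(th in circ) (poisson z th * u th)).
  by move=> z1; rewrite /phi mul1r cabs_exp_schwarz.
have phi4 z : disk z -> cabs (phi z) <= 4.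
  move=> /diskE z1; rewrite phiE // -[leRHS]lnK ?posrE // ler_expR.
  exact: poisson_le_int.
have phi0 z : phi z != 0 by rewrite /phi mul1r cexp_neq0.
have aphi : analytic_disk phi.
  move=> z /diskE z1; apply: holoM; first exact: holo_cst.
  by apply: (holo_comp (g := @cexp R)); [exact: schwarz_int_holo|exact: holo_cexp].
have ophi : outer phi.
  exists 1, (fun th => expR (u th)); split.
  - by rewrite normr1.
  - by move=> th; exact: expR_gt0.
  - by apply: eq_integrable iu; [exact: measurable_circL|move=> th _ /=; rewrite expRK].
  - move=> z dz; rewrite /phi /schwarz_int; congr (_ * cexp (_ * _)).
    by congr cintegral; apply/funext => th; rewrite expRK.
pose Delta z := F z * phi z.
have aD : analytic_disk Delta by move=> z dz; apply: holoM; [exact: aF|exact: aphi].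
(* Truncation takes place at the fixed level 1/8. It lies below the lower bound 1/4 of [W], so it
   disappears in the limit, and together with |F| <= 8 W it gives the integrable bound ln 8 + |lW|
   for all radii. *)
have FW z : cabs z < 1 -> cabs (F z) <= expR ((2 * pi)^-1 * \int[mu]_(th in circ) (poisson z th * lW th)).
  move=> z1; have cP := poisson_continuous z1.
  pose C := (1 + cabs z) / (1 - cabs z).
  have e0 : 0 < 8^-1 :> R by [].
  have cF n : continuous (fun th => ln (Num.max (cabs (F ((rad n)%:C * cis th))) 8^-1)).
    have hr w : cabs w = rad n -> holo F w by move=> wr; apply: analytic_holo => //; rewrite wr rad_lt1.
    have [_ [_ cc]] := circle_continuous (ltW (rad_gt0 n)) hr.
    move=> th; apply: continuous_comp.
      by apply: continuous_max; [exact: cc|exact: cvg_cst].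
    by apply: continuous_ln; rewrite lt_max e0 orbT.
  have DCT := @dominated_Rintegral _ _ _ mu circ (fun n th => poisson z th * ln (Num.max (cabs (F ((rad n)%:C * cis th))) 8^-1))
    (fun th => poisson z th * lW th) (fun th => C * (ln 8 - -1 * `|lW th|)).
  have mP : measurable_fun (@circ R) (poisson z).
    by apply: measurable_funTS; exact: continuous_measurable_fun.
  have l8 : ln 8^-1 = - ln 8 :> R by rewrite lnV ?posrE.
  have [|||||_ L] := DCT measurable_circ.
  - move=> n; apply: measurable_funTS; apply: continuous_measurable_fun => th.
    by apply: cvgM; [exact: cP|exact: cF].
  - by apply: measurable_funM.
  - apply: integrable_circZ; exact: integrable_circB (integrable_circ_cst _) (integrable_circZ _ ialW).
  - apply: ae_imply (ae_and W_ae lWE) => th [h1 h2] cth; have [WF W4 _] := h1 cth.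
    apply: cvgMl_tmp; rewrite (h2 cth).
    have W0 : 0 < W th by exact: lt_le_trans W4.
    have W8 : 8^-1 <= W th by apply: le_trans W4; rewrite lef_pV2 ?posrE // ler_nat.
    apply: (@cvg_comp _ _ _ (fun n => Num.max (cabs (F ((rad n)%:C * cis th))) 8^-1) (@ln R)); last first.
      exact: continuous_ln.
    have WM : Num.max (cabs (F ((rad n)%:C * cis th))) 8^-1 @[n --> \oo] --> Num.max (W th) 8^-1.
      apply: (@cvg_comp _ _ _ _ (fun y : R => Num.max y 8^-1)); first exact: WF.
      by apply: (@continuous_max R R id (cst 8^-1)); [exact: cvg_id|exact: cvg_cst].
    by rewrite (max_l W8) in WM; exact: WM.
  - apply: ae_imply (ae_and W_ae lWE) => th [h1 h2] n cth; have [_ W4 F8] := h1 cth.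
    have W0 : 0 < W th by exact: lt_le_trans W4.
    have pp := ltW (poisson_gt0 th z1).
    rewrite (normrM (poisson z th)) (ger0_norm pp); apply: ler_pM (pp) (normr_ge0 _) (poisson_le th z1) _.
    rewrite mulN1r opprK (h2 cth) ler_norml.
    have m0 : 0 < Num.max (cabs (F ((rad n)%:C * cis th))) 8^-1 by rewrite lt_max e0 orbT.
    have a1 : ln 8^-1 <= ln (Num.max (cabs (F ((rad n)%:C * cis th))) 8^-1).
      by rewrite ler_ln ?posrE // le_max lexx orbT.
    have a2 : ln (Num.max (cabs (F ((rad n)%:C * cis th))) 8^-1) <= ln (8 * W th).
      rewrite ler_ln ?posrE ?mulr_gt0 // ge_max F8 /=.
      apply: (@le_trans _ _ (8 * 4^-1)); last by rewrite ler_pM2l.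
      lra.
    rewrite lnM ?posrE // in a2; rewrite l8 in a1.
    have a3 := ler_norm (ln (W th)); have a4 := normr_ge0 (ln (W th)).
    apply/andP; split; lra.
  have L2 : expR ((2 * pi)^-1 * \int[mu]_(th in circ) (poisson z th * ln (Num.max (cabs (F ((rad n)%:C * cis th))) 8^-1)))
     @[n --> \oo] --> expR ((2 * pi)^-1 * \int[mu]_(th in circ) (poisson z th * lW th)).
    apply: (@cvg_comp _ _ _ _ (@expR R)); last exact: continuous_expR.
    by apply: cvgMl_tmp; exact: L.
  have L1 : cabs (F ((rad n)%:C * z)) @[n --> \oo] --> cabs (F z).
    by apply: cvg_cabs; apply: rad_seq_cvg; exact: analytic_holo.
  apply: ler_cvg_to L1 L2 _; apply: nearW => n.
  by apply: F_log_subharmonic; rewrite ?rad_gt0 ?rad_lt1.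
have D1 z : disk z -> cabs (Delta z) <= 1.
  move=> /diskE z1; rewrite /Delta cabsM phiE //.
  apply: (@le_trans _ _ (expR ((2 * pi)^-1 * \int[mu]_(th in circ) (poisson z th * lW th)) *
     expR ((2 * pi)^-1 * \int[mu]_(th in circ) (poisson z th * u th)))).
    by rewrite ler_wpM2r ?expR_ge0 // FW.
  rewrite -expRD -mulrDr -[X in _ <= X]expR0 ler_expR pmulr_rle0 ?invr_gt0 //.
  rewrite -RintegralD; [|exact: measurable_circL|exact: integrable_poissonM|exact: integrable_poissonM].
  have h th : poisson z th * lW th + poisson z th * u th <= 0.
    rewrite -mulrDr pmulr_rle0 ?poisson_gt0 // -lerBrDl sub0r -mulN1r.
    by rewrite ge_min lexx orbT.
  rewrite -oppr_ge0 -mulN1r -RintegralZl; [|exact: measurable_circL|].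
    by apply: Rintegral_ge0 => th _; rewrite mulN1r oppr_ge0.
  exact: (integrableD measurable_circL (integrable_poissonM z1 ilW) (integrable_poissonM z1 iu)).
exists Delta, phi; split=> //; last by move=> z dz; rewrite /Delta mulfK.
split; first by split=> //; exists 1 => z dz; rewrite normc_cabs lecR D1.
have [Np [mNp Np0 Npr]] := radial_modulus aphi phi4.
have Npc := rad_of Npr.
have i0 : cabs (0 : R[i]) < 1 by rewrite cabs0.
have Npp := boundary_log_pos aphi phi4 mNp Np0 Npc i0 (phi0 0).
have ilp := boundary_log_integrable aphi phi4 mNp Np0 Npc i0 (phi0 0).
have [ND [_ _ NDr]] := radial_modulus aD D1.
have NDc := rad_of NDr.
have ND1 : {ae mu, forall th, circ th -> [/\ ND th = W th * Np th, ND th <= 1, 4^-1 <= W th & 0 < Np th]}.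
  apply: ae_imply (ae_and Npc (ae_and NDc (ae_and W_ae Npp))) => th [h1 [h2 [h3 h4]]] cth.
  have [WF W4 _] := h3 cth; split=> //; last exact: h4.
    have EF : (fun n => cabs (Delta ((rad n)%:C * cis th))) =
        (fun n => cabs (F ((rad n)%:C * cis th)) * cabs (phi ((rad n)%:C * cis th))).
      by apply/funext => n; exact: cabsM.
    have L := h2 cth; rewrite EF in L.
    by apply: (cvg_unique (@norm_hausdorff R R) L); apply: cvgM => //; exact: h1.
  by apply: ler_cvg_to (h2 cth) (cvg_cst _) _; apply: nearW => n; exact: D1.
have uE : {ae mu, forall th, circ th -> u th = - ln (W th)}.
  apply: ae_imply (ae_and ND1 lWE) => th [h1 h2] cth; have [_ _ W4 _] := h1 cth.
  rewrite /u (h2 cth) mulN1r min_r // -lnV ?posrE ?(lt_le_trans _ W4) // ler_ln ?posrE ?invr_gt0 ?(lt_le_trans _ W4) //.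
  by rewrite -[leRHS]invrK lef_pV2 ?posrE ?invr_gt0 // (lt_le_trans _ W4).
(* As [phi] is the exponential of a Schwarz integral, the logarithm of |phi(0)| is exactly the mean
   of [u], and Jensen's inequality makes the integral of [u] at most that of [ln (Np th)].
   Pointwise, [W th * Np th <= 1] gives the opposite order. *)
have z : {ae mu, forall th, circ th -> u th - ln (Np th) = 0}.
  apply: ae_eq0_int_le0; first exact: integrable_circB.
    apply: ae_imply (ae_and ND1 uE) => th [h1 h2] cth; have [E N1 W4 Np1] := h1 cth.
    have W0 : 0 < W th by rewrite (lt_le_trans _ W4).
    rewrite (h2 cth) -opprD oppr_ge0 -lnM ?posrE // -E ln_le0 //.
  rewrite RintegralB; [|exact: measurable_circL|exact: iu|exact: ilp].
  rewrite subr_le0.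
  have := boundary_log_le aphi phi4 mNp Np0 Npc i0 (phi0 0) i0 (phi0 0).
  rewrite phiE // expRK ler_pM2l ?invr_gt0 //.
  have P1 (h : R -> R) : \int[mu]_(th in circ) (poisson 0 th * h th) = \int[mu]_(th in circ) h th.
    by apply: eq_Rintegral => th _; rewrite poisson0 mul1r.
  by rewrite !P1.
have main : {ae mu, forall th, circ th -> exists2 w : R[i]^o, `|w| = 1 &
     (Delta (r%:C * cis th) : R[i]^o) @[r --> (1 : R)^'-] --> w}.
  apply: ae_imply (ae_and NDr (ae_and ND1 (ae_and uE z))) => th [h1 [h2 [h3 h4]]] cth.
  have [w Dw NDw] := h1 cth; have [E _ W4 Np1] := h2 cth; exists w => //.
  have W0 : 0 < W th by rewrite (lt_le_trans _ W4).
  rewrite normc_cabs -NDw E; have := h4 cth; rewrite (h3 cth) -opprD -lnM ?posrE // => /eqP.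
  rewrite oppr_eq0 => /eqP l0.
  have -> : W th * Np th = 1 by apply: ln_inj; rewrite ?posrE ?mulr_gt0 // ln1.
  by [].
apply: (ae_periodic p0).
- by move=> x [w w1]; rewrite cisD2pi => h; exists w.
- by move=> x [w w1 h]; exists w => //; rewrite cisD2pi.
by apply: ae_imply main => th h hth; apply: h; apply/circP.
Qed.

End Factorization.

Theorem theorem2p5 (R : realType) (G : set (R[i] -> R[i])) (t0 : R[i])
  (hG : fuchsian G) (ht0 : `|t0| = 1)
  (hsum : (\esum_(g in G) (complex.Re `|cderiv g t0|)%:E < +oo)%E)
  (hbc : bounded_characteristic (cderiv (martin G t0))) :
  exists Delta phi : R[i] -> R[i],
    [/\ inner Delta, outer phi,
        forall z, disk z -> `|phi z| <= 4 &
        forall z, disk z -> cderiv (martin G t0) z = Delta z / phi z].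
Proof.
have [t [c [t1 c0 ic [k ck] mE]]] := martin_series hG ht0 hsum.
have dE z : disk z -> cderiv (martin G t0) z = dser t c z.
  move=> /diskE z1; apply: cder_cderiv => e e0.
  have [r r0 hr] := mser_cder t1 ic z1 e0.
  (* [martin] is known to be the series inside the disk only, which [w] must not leave. *)
  exists (Num.min r (1 - cabs z)); first by rewrite lt_min r0 subr_gt0.
  move=> w; rewrite lt_min => /andP[wr wz].
  rewrite !mE; [exact: hr|by apply/diskE|].
  by apply/diskE; have := cabsD (w - z) z; rewrite subrK; lra.
have [f [g [[af [Mf fM]] [ag [Mg gM]] [z0 /diskE z01 gz0] FE]]] := hbc.
have fM' z : disk z -> cabs (f z) <= Mf by move=> /fM; rewrite normc_cabs lecR.
have gM' z : disk z -> cabs (g z) <= Mg by move=> /gM; rewrite normc_cabs lecR.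
have FE' z : disk z -> g z != 0 -> dser t c z = f z / g z by move=> dz gz; rewrite -dE // FE.
have [Delta [phi [iD oph ph4 DE]]] := factorization t1 c0 ic ck af fM' ag gM' z01 gz0 FE'.
exists Delta, phi; split=> // z dz; last by rewrite dE // DE.
rewrite normc_cabs (_ : (4 : R[i]) = (4 : R)%:C) ?lecR ?ph4 //.
by rewrite rmorph_nat.
Qed.
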